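(* Let $G$ be a finite group and $k\ge1$ with $|G|=k+1$. If there exists a near-group category with fusion rule $(G,k)$, then there is a permutation $\pi$ of the set $G\setminus\{\epsilon\}$ of non-identity elements of $G$ such that: (i) $\pi^3=\mathrm{id}$; (ii) $\pi(x)^{-1}=\pi^{-1}(x^{-1})$ for all $x\ne\epsilon$; (iii) $\pi(st)=\pi(t)\,\pi\bigl(\pi(s)^{-1}\pi(t^{-1})\bigr)$ for all $s,t\in G\setminus\{\epsilon\}$ with $s\ne t^{-1}$.
   Context: Standing conventions. Ground ring: an algebraically closed field $R$ whose characteristic does not divide $|G|$. A near-group category with fusion rule $(G,k)$ is an $R$-linear semisimple monoidal category with duality: finite-dimensional hom-spaces; finitely many isomorphism classes of simples $s_i$ with $\mathrm{hom}(s_i,s_j)\cong R$ if $i=j$ and $0$ otherwise, every object a finite direct sum of simples; bilinear tensor product with unit object $\epsilon$ and natural associativity isomorphisms satisfying the pentagon axiom; every object $x$ has a dual $x^*$ with evaluation and coevaluation satisfying the zig-zag identities. The simples are the invertible ones, forming a group isomorphic to $G$ (with identity $\epsilon$), and one non-invertible $m$ with $g\otimes m\cong m\otimes g\cong m$ and $m\otimes m\cong\bigoplus_{g\in G}g\oplus k\cdot m$. *)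

(* Defs.v *)
From HB Require Import structures.
From mathcomp Require Import all_boot all_order all_algebra all_fingroup all_field.
Set Implicit Arguments. Unset Strict Implicit. Unset Printing Implicit Defensive.
Import GRing.Theory.
Local Open Scope ring_scope.

Record MonCat (R : fieldType) := MonCatData {
  Obj : Type;
  Hom : Obj -> Obj -> vectType R;
  idm : forall x, Hom x x;
  comp : forall x y z, Hom y z -> Hom x y -> Hom x z;
  tens_ob : Obj -> Obj -> Obj;
  tens : forall x y x' y', Hom x x' -> Hom y y' -> Hom (tens_ob x y) (tens_ob x' y');
  munit : Obj;
  assoc : forall x y z, Hom (tens_ob (tens_ob x y) z) (tens_ob x (tens_ob y z));
  assoc_inv : forall x y z, Hom (tens_ob x (tens_ob y z)) (tens_ob (tens_ob x y) z);
  lunit : forall x, Hom (tens_ob munit x) x;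
  lunit_inv : forall x, Hom x (tens_ob munit x);
  runit : forall x, Hom (tens_ob x munit) x;
  runit_inv : forall x, Hom x (tens_ob x munit);
  dual : Obj -> Obj;
  ev : forall x, Hom (tens_ob (dual x) x) munit;
  coev : forall x, Hom munit (tens_ob x (dual x))
}.

Arguments Obj {R}.
Arguments Hom {R C} : rename.
Arguments idm {R C} x : rename.
Arguments comp {R C x y z} : rename.
Arguments tens_ob {R C} : rename.
Arguments tens {R C x y x' y'} : rename.
Arguments munit {R C} : rename.
Arguments assoc {R C} x y z : rename.
Arguments assoc_inv {R C} x y z : rename.
Arguments lunit {R C} x : rename.
Arguments lunit_inv {R C} x : rename.
Arguments runit {R C} x : rename.
Arguments runit_inv {R C} x : rename.
Arguments dual {R C} x : rename.
Arguments ev {R C} x : rename.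
Arguments coev {R C} x : rename.

Section CatLaws.
Variables (R : fieldType) (C : MonCat R).
Local Notation "f \o g" := (comp f g).
Local Notation "x (x) y" := (tens_ob x y) (at level 40, left associativity).
Local Notation "f <x> g" := (tens f g) (at level 40, left associativity).

Definition is_linear_category : Prop :=
  [/\ (forall (x y : Obj C) (f : Hom x y), idm y \o f = f /\ f \o idm x = f),
      (forall (w x y z : Obj C) (f : Hom y z) (g : Hom x y) (h : Hom w x),
          f \o (g \o h) = (f \o g) \o h),
      (forall (x y z : Obj C) (a : R) (f g : Hom y z) (h : Hom x y),
          (a *: f + g) \o h = a *: (f \o h) + (g \o h)) &
      (forall (x y z : Obj C) (a : R) (f : Hom y z) (g h : Hom x y),
          f \o (a *: g + h) = a *: (f \o g) + (f \o h))].

Definition is_bilinear_bifunctor : Prop :=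
  [/\ (forall x y : Obj C, idm x <x> idm y = idm (x (x) y)),
      (forall (x y z x' y' z' : Obj C) (f : Hom y z) (g : Hom x y) (f' : Hom y' z') (g' : Hom x' y'),
          (f \o g) <x> (f' \o g') = (f <x> f') \o (g <x> g')),
      (forall (x y x' y' : Obj C) (a : R) (f g : Hom x x') (h : Hom y y'),
          (a *: f + g) <x> h = a *: (f <x> h) + (g <x> h)) &
      (forall (x y x' y' : Obj C) (a : R) (f : Hom x x') (g h : Hom y y'),
          f <x> (a *: g + h) = a *: (f <x> g) + (f <x> h))].

Definition has_monoidal_constraints : Prop :=
  [/\ (forall x y z : Obj C, assoc x y z \o assoc_inv x y z = idm _ /\
                     assoc_inv x y z \o assoc x y z = idm _),
      (forall x : Obj C, lunit x \o lunit_inv x = idm _ /\ lunit_inv x \o lunit x = idm _),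
      (forall x : Obj C, runit x \o runit_inv x = idm _ /\ runit_inv x \o runit x = idm _) &
      [/\
      (forall (x y z x' y' z' : Obj C) (f : Hom x x') (g : Hom y y') (h : Hom z z'),
          assoc x' y' z' \o ((f <x> g) <x> h) = (f <x> (g <x> h)) \o assoc x y z),
      (forall (x x' : Obj C) (f : Hom x x'), lunit x' \o (idm munit <x> f) = f \o lunit x) &
      (forall (x x' : Obj C) (f : Hom x x'), runit x' \o (f <x> idm munit) = f \o runit x)]].

Definition pentagon_triangle : Prop :=
  (forall w x y z : Obj C,
     assoc w x (y (x) z) \o assoc (w (x) x) y z =
     (idm w <x> assoc x y z) \o assoc w (x (x) y) z \o (assoc w x y <x> idm z)) /\
  (forall x y : Obj C, (idm x <x> lunit y) \o assoc x munit y = runit x <x> idm y).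

Definition has_duals : Prop :=
  forall x : Obj C,
    runit x \o (idm x <x> ev x) \o assoc x (dual x) x \o (coev x <x> idm x)
       \o lunit_inv x = idm x /\
    lunit (dual x) \o (ev x <x> idm (dual x)) \o assoc_inv (dual x) x (dual x)
       \o (idm (dual x) <x> coev x) \o runit_inv (dual x) = idm (dual x).

Definition is_rigid_monoidal : Prop :=
  [/\ is_linear_category, is_bilinear_bifunctor, has_monoidal_constraints,
      pentagon_triangle & has_duals].

Definition iso (x y : Obj C) : Prop :=
  exists (f : Hom x y) (g : Hom y x), f \o g = idm y /\ g \o f = idm x.

Definition is_dsum (x : Obj C) (n : nat) (y : 'I_n -> Obj C) : Prop :=
  exists (p : forall j, Hom x (y j)) (e : forall j, Hom (y j) x),
    [/\ (forall j, p j \o e j = idm (y j)),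
        (forall i j, i != j -> p i \o e j = 0) &
        \sum_j (e j \o p j) = idm x].

End CatLaws.

(* A near-group category with fusion rule (G,k), G the whole finite group gT.
   Simples: phi g (g in G), invertible, forming a group isomorphic to G with
   identity the unit object, and one non-invertible m. *)
Definition near_group_category (R : fieldType) (C : MonCat R)
    (gT : finGroupType) (k : nat) : Prop :=
  is_rigid_monoidal C /\
  exists (phi : gT -> Obj C) (m : Obj C),
    let s := fun o : option gT => if o is Some g then phi g else m in
    [/\
        (forall i j, \dim {: Hom (s i) (s j)} = (i == j)%N),
        (forall x : Obj C, exists n (y : 'I_n -> option gT),
            is_dsum x (fun j => s (y j))),
        iso (phi 1%g) munit /\
        (forall g h, iso (tens_ob (phi g) (phi h)) (phi (g * h)%g)),
        (forall g, iso (tens_ob (phi g) m) m /\ iso (tens_ob m (phi g)) m) &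
        exists n (y : 'I_n -> option gT),
          [/\ (forall g, #|[pred j | y j == Some g]| = 1%N),
              #|[pred j | y j == None]| = k &
              is_dsum (tens_ob m m) (fun j => s (y j))]].

(* Main.v *)
(** The tensor product of [m] with itself is handled in a strict calculus of words.
    On [V = Hom(m m, m)], of dimension [k = |G| - 1], the group acts through the left leg, the
    right leg and the middle.  Left and right actions commute up to a scalar whose [k]-th power
    (a determinant) and [|G|]-th power are both [1], so all three actions commute.  The space
    [Hom(m m m, m)] has two bases, one for each bracketing; comparing them shows that [V] has
    no invariants under the left action, that the centralizer of the left action is spanned by
    the right action, hence that [G] is abelian, and that [V] is the sum of one line for each
    nontrivial character of [G].  Each line carries three weights [a], [b], [c] (left, middle,
    right).  The maps [e m] and [m e], where [e : m m -> 1], give relations that make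
    [mu : a |-> b] an involution and express [c] by [mu]; the weights of the composites
    [(m m) m -> m m -> m] in the other basis give the functional equation of [mu].  Characters
    are identified with [G] by a nondegenerate bicharacter, and [pi] is [mu] followed by
    inversion. *)
Require Import Defs.
From HB Require Import structures.
From mathcomp Require Import all_boot all_order all_algebra all_fingroup all_solvable all_field.
From mathcomp Require Import zify.
Import GRing.Theory Defs.
Set Implicit Arguments. Unset Strict Implicit. Unset Printing Implicit Defensive.
Local Open Scope ring_scope.

(** * Strictification of a rigid monoidal category *)

(** The equality [|G| = k + 1] enters beyond the commutation scalar: it drives the growth count that
    excludes invariants, and it matches the [k] weight lines with the [k] nonidentity elements. The
    obstacle is that isomorphisms such as [g m -> m] are given without coherence, hence only up to
    scalars. The left and right actions conjugate by them, so the scalars cancel. The middle action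
    mixes the two sides; it is pinned down by requiring that a [g] between the two legs of [e] may
    be absorbed on either side. For the growth count, one tree shows [|G|] trivial lines and [k]
    copies of [V] inside the left module Hom(m m m, m); the other bounds it by a regular
    representation and Hom(D, V), where D = Hom(m, m m). An invariant vector would make
    multiplicities in tensor powers of D outgrow the dimensions. Commutativity comes from the middle
    action: it commutes with the left one, hence lies in the span of the right one, with which it
    also commutes; rotating a leg by [e] carries this over to the left action. The assumptions on
    [R] serve to diagonalize the left action and to provide roots of unity for the bicharacter. *)

(* Transparent, so that the casts in [rw_nil] and [rw_rw] reduce away on explicit words. *)
Fixpoint catA {A : Type} (u v w : seq A) : (u ++ v) ++ w = u ++ (v ++ w) :=
  if u is a :: u' then f_equal (cons a) (catA u' v w) else erefl.

Fixpoint catn {A : Type} (u : seq A) : u ++ [::] = u :=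
  if u is a :: u' then f_equal (cons a) (catn u') else erefl.

(* [cell u v] stands for the morphisms between the right-nested tensor products of the words
   [u] and [v]; [lw a f] is [id_a (x) f] and [rw x f] is [f (x) id_x]. *)
Record strict_data (R : fieldType) (A : Type) := StrictData {
  cell : seq A -> seq A -> vectType R;
  cid : forall u, cell u u;
  cc : forall u v w, cell v w -> cell u v -> cell u w;
  lw : forall a u v, cell u v -> cell (a :: u) (a :: v);
  rw : forall x u v, cell u v -> cell (u ++ x) (v ++ x)
}.

Arguments cell {R A} s u v.
Arguments cid {R A s} u.
Arguments cc {R A s u v w}.
Arguments lw {R A s} a {u v}.
Arguments rw {R A s} x {u v}.

Fixpoint lws {R A} {S : strict_data R A} (x : seq A) (u v : seq A) (f : cell S u v) :
    cell S (x ++ u) (x ++ v) :=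
  if x is a :: x' then lw a (lws x' f) else f.

Definition recast {R A} {S : strict_data R A} {u u' v v' : seq A}
    (eu : u = u') (ev : v = v') (f : cell S u v) : cell S u' v' :=
  match eu in _ = u', ev in _ = v' return cell S u' v' with
  | erefl, erefl => f end.

(** A strict monoidal category with the whiskerings as primitives. Left whiskering adds a single
    letter and needs no cast, so reassociation of words appears only in [rw_nil] and [rw_rw]; [xch]
    is the interchange law. *)
Record strict_laws (R : fieldType) (A : Type) (S : strict_data R A) : Prop := StrictLaws {
  cc1f : forall u v (f : cell S u v), cc (cid v) f = f;
  ccf1 : forall u v (f : cell S u v), cc f (cid u) = f;
  ccA : forall t u v w (f : cell S v w) (g : cell S u v) (h : cell S t u),
    cc f (cc g h) = cc (cc f g) h;
  cc_linl : forall u v w a (f g : cell S v w) (h : cell S u v),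
    cc (a *: f + g) h = a *: cc f h + cc g h;
  cc_linr : forall u v w a (f : cell S v w) (g h : cell S u v),
    cc f (a *: g + h) = a *: cc f g + cc f h;
  lw1 : forall a u, lw a (cid u) = cid (s := S) (a :: u);
  lwM : forall a u v w (f : cell S v w) (g : cell S u v),
    lw a (cc f g) = cc (lw a f) (lw a g);
  lw_lin : forall a u v b (f g : cell S u v), lw a (b *: f + g) = b *: lw a f + lw a g;
  rw1 : forall x u, rw x (cid u) = cid (s := S) (u ++ x);
  rwM : forall x u v w (f : cell S v w) (g : cell S u v),
    rw x (cc f g) = cc (rw x f) (rw x g);
  rw_lin : forall x u v b (f g : cell S u v), rw x (b *: f + g) = b *: rw x f + rw x g;
  rw_lw : forall a x u v (f : cell S u v), rw x (lw a f) = lw a (rw x f);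
  rw_nil : forall u v (f : cell S u v), recast (catn u) (catn v) (rw [::] f) = f;
  rw_rw : forall x y u v (f : cell S u v),
    recast (catA u x y) (catA v x y) (rw y (rw x f)) = rw (x ++ y) f;
  xch : forall u v x y (f : cell S u v) (h : cell S x y),
    cc (rw y f) (lws u h) = cc (lws v h) (rw x f)
}.

(** * Coherence from the pentagon and the triangle *)

Section Coherence.
Variables (R : fieldType) (C : MonCat R).
Hypothesis rigC : is_rigid_monoidal C.
Local Notation "f \o g" := (comp f g).
Local Notation "x (x) y" := (tens_ob x y) (at level 40, left associativity).
Local Notation "f <x> g" := (tens f g) (at level 40, left associativity).
Local Notation I := (@munit R C).
Implicit Types (x y z : Obj C).

Lemma comp1m x y (f : Hom x y) : idm y \o f = f.
Proof. by case: rigC => -[/(_ x y f)[]]. Qed.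
Lemma compm1 x y (f : Hom x y) : f \o idm x = f.
Proof. by case: rigC => -[/(_ x y f)[]]. Qed.
Lemma compA w x y z (f : Hom y z) (g : Hom x y) (h : Hom w x) : f \o (g \o h) = (f \o g) \o h.
Proof. by case: rigC => -[]. Qed.
Lemma comp_linl x y z a (f g : Hom y z) (h : Hom x y) :
  (a *: f + g) \o h = a *: (f \o h) + (g \o h).
Proof. by case: rigC => -[]. Qed.
Lemma comp_linr x y z a (f : Hom y z) (g h : Hom x y) :
  f \o (a *: g + h) = a *: (f \o g) + (f \o h).
Proof. by case: rigC => -[]. Qed.
Lemma tens1 x y : idm x <x> idm y = idm (x (x) y).
Proof. by case: rigC => _ []. Qed.
Lemma tensM x y z x' y' z' (f : Hom y z) (g : Hom x y) (f' : Hom y' z') (g' : Hom x' y') :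
  (f \o g) <x> (f' \o g') = (f <x> f') \o (g <x> g').
Proof. by case: rigC => _ []. Qed.
Lemma tens_linl x y x' y' a (f g : Hom x x') (h : Hom y y') :
  (a *: f + g) <x> h = a *: (f <x> h) + (g <x> h).
Proof. by case: rigC => _ []. Qed.
Lemma tens_linr x y x' y' a (f : Hom x x') (g h : Hom y y') :
  f <x> (a *: g + h) = a *: (f <x> g) + (f <x> h).
Proof. by case: rigC => _ []. Qed.
Lemma assocK x y z : assoc_inv x y z \o assoc x y z = idm _.
Proof. by case: rigC => _ _ [/(_ x y z)[]]. Qed.
Lemma assocVK x y z : assoc x y z \o assoc_inv x y z = idm _.
Proof. by case: rigC => _ _ [/(_ x y z)[]]. Qed.
Lemma lunitK x : lunit_inv x \o lunit x = idm _.
Proof. by case: rigC => _ _ [_ /(_ x)[]]. Qed.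
Lemma lunitVK x : lunit x \o lunit_inv x = idm _.
Proof. by case: rigC => _ _ [_ /(_ x)[]]. Qed.
Lemma runitK x : runit_inv x \o runit x = idm _.
Proof. by case: rigC => _ _ [_ _ /(_ x)[]]. Qed.
Lemma runitVK x : runit x \o runit_inv x = idm _.
Proof. by case: rigC => _ _ [_ _ /(_ x)[]]. Qed.
Lemma assoc_nat x y z x' y' z' (f : Hom x x') (g : Hom y y') (h : Hom z z') :
  assoc x' y' z' \o ((f <x> g) <x> h) = (f <x> (g <x> h)) \o assoc x y z.
Proof. by case: rigC => _ _ [_ _ _ []]. Qed.
Lemma lunit_nat x x' (f : Hom x x') : lunit x' \o (idm I <x> f) = f \o lunit x.
Proof. by case: rigC => _ _ [_ _ _ []]. Qed.
Lemma runit_nat x x' (f : Hom x x') : runit x' \o (f <x> idm I) = f \o runit x.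
Proof. by case: rigC => _ _ [_ _ _ []]. Qed.
Lemma pentagon w x y z :
     assoc w x (y (x) z) \o assoc (w (x) x) y z =
     (idm w <x> assoc x y z) \o assoc w (x (x) y) z \o (assoc w x y <x> idm z).
Proof. by case: rigC => _ _ _ []. Qed.
Lemma triangle x y : (idm x <x> lunit y) \o assoc x I y = runit x <x> idm y.
Proof. by case: rigC => _ _ _ []. Qed.

Lemma epi_comp x y z (s : Hom x y) (s' : Hom y x) (f g : Hom y z) :
  s \o s' = idm y -> f \o s = g \o s -> f = g.
Proof. by move=> ss fg; rewrite -(compm1 f) -(compm1 g) -ss !compA fg. Qed.
Lemma mono_comp x y z (s : Hom x y) (s' : Hom y x) (f g : Hom z x) :
  s' \o s = idm x -> s \o f = s \o g -> f = g.
Proof. by move=> ss fg; rewrite -(comp1m f) -(comp1m g) -ss -!compA fg. Qed.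

Lemma tens_l x y x' y' (f : Hom x y) (g : Hom x' y') :
  (idm y <x> g) \o (f <x> idm x') = f <x> g.
Proof. by rewrite -tensM comp1m compm1. Qed.
Lemma tens_r x y x' y' (f : Hom x y) (g : Hom x' y') :
  (f <x> idm y') \o (idm x <x> g) = f <x> g.
Proof. by rewrite -tensM comp1m compm1. Qed.
Lemma tensMl x y z a (f : Hom y z) (g : Hom x y) :
  (f \o g) <x> idm a = (f <x> idm a) \o (g <x> idm a).
Proof. by rewrite -tensM compm1. Qed.
Lemma tensMr x y z a (f : Hom y z) (g : Hom x y) :
  idm a <x> (f \o g) = (idm a <x> f) \o (idm a <x> g).
Proof. by rewrite -tensM compm1. Qed.

(* Tensoring with the unit is faithful, so it is enough to compare after [I (x) _],
   where pentagon and triangle apply. *)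
Lemma lunit_tens x y : lunit (x (x) y) \o assoc I x y = lunit x <x> idm y.
Proof.
suff E : idm I <x> (lunit (x (x) y) \o assoc I x y) = idm I <x> (lunit x <x> idm y).
  apply: (epi_comp (lunitVK _)); rewrite -!lunit_nat E.
  by [].
apply: (epi_comp (assocVK _ _ _)).
have K : (assoc I I x <x> idm y) \o (assoc_inv I I x <x> idm y) = idm _.
  by rewrite -tensMl assocVK tens1.
apply: (epi_comp K).
rewrite tensMr -!compA [X in _ \o X]compA -pentagon !compA triangle.
rewrite -tens1 -assoc_nat -triangle tensMl !compA assoc_nat.
by [].
Qed.

Lemma lunit_tens_inv x y : assoc I x y \o (lunit_inv x <x> idm y) = lunit_inv (x (x) y).
Proof.
apply: (mono_comp (lunitK _)); rewrite compA lunit_tens -tensMl !lunitVK.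
by rewrite tens1.
Qed.

(** Mirror image of [lunit_tens]: the comparison is made after tensoring with the unit on the
    right. *)
Lemma runit_tens x y : (idm x <x> runit y) \o assoc x y I = runit (x (x) y).
Proof.
suff E : ((idm x <x> runit y) \o assoc x y I) <x> idm I = runit (x (x) y) <x> idm I.
  by apply: (epi_comp (runitVK _)); rewrite -!runit_nat E.
apply: (mono_comp (assocK _ _ _)).
rewrite -triangle compA -tens1 assoc_nat -compA pentagon !compA -tensMr triangle.
by rewrite -assoc_nat tensMl compA.
Qed.

(** Naturality of [lunit] at [lunit I] itself turns [lunit] of [I (x) I] into [id (x) lunit I]; the
    triangle then compares the two unit constraints. *)
Lemma lunit_unit : lunit I = runit I.
Proof.
have E : lunit (I (x) I) = idm I <x> lunit I.
  by apply: (mono_comp (lunitK _)); rewrite lunit_nat.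
apply: (epi_comp (runitVK _)); rewrite -!runit_nat; congr (_ \o _).
by rewrite -triangle -lunit_tens E.
Qed.

Lemma triangle_inv x y : assoc x I y \o (runit_inv x <x> idm y) = idm x <x> lunit_inv y.
Proof.
have K : (idm x <x> lunit_inv y) \o (idm x <x> lunit y) = idm _.
  by rewrite -tensMr lunitK tens1.
apply: (mono_comp K); rewrite compA triangle -tensMl -tensMr lunitVK runitVK.
by rewrite !tens1.
Qed.

(** A word is treated as the endofunctor [x |-> ob w x], acting on morphisms by [obm w]; [sh w] is
    its compatibility with tensoring on the right. Morphisms of words are taken at the last slot
    [I]. *)
Fixpoint ob (w : seq (Obj C)) x : Obj C := if w is a :: w' then a (x) ob w' x else x.

Fixpoint obm w x y (f : Hom x y) : Hom (ob w x) (ob w y) :=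
  if w is a :: w' then idm a <x> obm w' f else f.

Fixpoint sh w x y : Hom (ob w x (x) y) (ob w (x (x) y)) :=
  if w is a :: w' then (idm a <x> sh w' x y) \o assoc a (ob w' x) y else idm _.

Fixpoint shi w x y : Hom (ob w (x (x) y)) (ob w x (x) y) :=
  if w is a :: w' then assoc_inv a (ob w' x) y \o (idm a <x> shi w' x y) else idm _.

Lemma obm1 w x : obm w (idm x) = idm (ob w x).
Proof. by elim: w => //= a w ->; rewrite tens1. Qed.
Lemma obmM w x y z (f : Hom y z) (g : Hom x y) : obm w (f \o g) = obm w f \o obm w g.
Proof. by elim: w => //= a w ->; rewrite tensMr. Qed.
Lemma shK w x y : shi w x y \o sh w x y = idm _.
Proof.
elim: w => [|a w IH] /=; first by rewrite comp1m.
by rewrite -compA [X in _ \o X]compA -tensMr IH tens1 comp1m assocK.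
Qed.
Lemma shVK w x y : sh w x y \o shi w x y = idm _.
Proof.
elim: w => [|a w IH] /=; first by rewrite comp1m.
by rewrite -compA [X in _ \o X]compA assocVK comp1m -tensMr IH tens1.
Qed.
Lemma sh_nat w x x' y y' (f : Hom x x') (g : Hom y y') :
  sh w x' y' \o (obm w f <x> g) = obm w (f <x> g) \o sh w x y.
Proof.
elim: w => [|a w IH] /=; first by rewrite comp1m compm1.
by rewrite -compA assoc_nat !compA -!tensMr IH.
Qed.
(** Induction on the word; each letter costs one pentagon. *)
Lemma sh_assoc w x y z :
  sh w x (y (x) z) \o assoc (ob w x) y z =
  obm w (assoc x y z) \o sh w (x (x) y) z \o (sh w x y <x> idm z).
Proof.
elim: w => [|a w IH] /=; first by rewrite tens1 comp1m !compm1.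
rewrite -compA pentagon tensMl !compA -tensMr IH !tensMr.
rewrite -!compA [in RHS](compA (assoc _ _ _)) assoc_nat.
by rewrite !compA.
Qed.

(* The action of [f (x) x] on right-nested words; by [ext_uniq] it is the only family
   natural and tensorial in [x] that extends [f]. *)
Definition ext w w' (f : Hom (ob w I) (ob w' I)) x : Hom (ob w x) (ob w' x) :=
  obm w' (lunit x) \o (sh w' I x \o (f <x> idm x) \o shi w I x) \o obm w (lunit_inv x).

Lemma ext_uniq w w' (al : forall x, Hom (ob w x) (ob w' x)) x :
  (forall x y (f : Hom x y), obm w' f \o al x = al y \o obm w f) ->
  sh w' I x \o (al I <x> idm x) = al (I (x) x) \o sh w I x ->
  al x = ext (al I) x.
Proof.
move=> aln alt; rewrite /ext alt -(compA (al _)) shVK compm1 aln.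
by rewrite -compA -obmM lunitVK obm1 compm1.
Qed.

Lemma ext_nat w w' (f : Hom (ob w I) (ob w' I)) x y (h : Hom x y) :
  obm w' h \o ext f x = ext f y \o obm w h.
Proof.
have lin : lunit_inv y \o h = (idm I <x> h) \o lunit_inv x.
  by apply: (mono_comp (lunitK y)); rewrite !compA lunitVK lunit_nat -compA lunitVK comp1m compm1.
have shin : shi w I y \o obm w (idm I <x> h) = (idm (ob w I) <x> h) \o shi w I x.
  apply: (mono_comp (shK w I y)); rewrite !compA shVK comp1m -obm1 sh_nat -compA shVK.
  by rewrite compm1.
have mid : obm w' (idm I <x> h) \o (sh w' I x \o (f <x> idm x) \o shi w I x) =
           sh w' I y \o (f <x> idm y) \o shi w I y \o obm w (idm I <x> h).
  rewrite -!(compA _ (shi w I y)) shin !compA -sh_nat obm1.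
  by rewrite -!(compA (sh w' I y)) tens_l tens_r.
rewrite /ext (compA (obm w' h)) (compA (obm w' h)) -obmM -lunit_nat obmM.
rewrite -(compA (obm w' (lunit y))) mid -!(compA _ (obm w (lunit_inv y))) -obmM lin obmM.
by rewrite -!compA.
Qed.

Lemma ext1 w x : ext (idm (ob w I)) x = idm _.
Proof. by rewrite -(@ext_uniq w w (fun x => idm _)) // => *; rewrite ?tens1 ?comp1m ?compm1. Qed.

Lemma extM u v w (f : Hom (ob v I) (ob w I)) (g : Hom (ob u I) (ob v I)) x :
  ext (f \o g) x = ext f x \o ext g x.
Proof.
rewrite /ext tensMl -!compA; congr (_ \o (_ \o (_ \o _))).
rewrite [in RHS](compA (obm v _)) -obmM lunitK obm1 comp1m.
by rewrite [in RHS](compA (shi _ _ _)) shK comp1m.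
Qed.

Lemma obm_runit w x : obm w (runit x) \o sh w x I = runit (ob w x).
Proof.
elim: w => [|a w IH] /=; first by rewrite compm1.
by rewrite compA -tensMr IH runit_tens.
Qed.

Lemma ext_unit w w' (f : Hom (ob w I) (ob w' I)) : ext f I = f.
Proof.
rewrite /ext !compA {1}lunit_unit obm_runit runit_nat -obm_runit -lunit_unit.
rewrite -!compA (compA (sh w I I)) shVK comp1m -obmM lunitVK obm1.
exact: compm1.
Qed.

Lemma ext_lin w w' a (f g : Hom (ob w I) (ob w' I)) x :
  ext (a *: f + g) x = a *: ext f x + ext g x.
Proof. by rewrite /ext tens_linl ?(comp_linl, comp_linr). Qed.

Lemma ext_lw a w w' (f : Hom (ob w I) (ob w' I)) x :
  ext (w := a :: w) (w' := a :: w') (idm a <x> f) x = idm a <x> ext f x.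
Proof.
rewrite /ext /= !tensMr; congr (_ \o _ \o _).
rewrite -!compA [in LHS](compA (assoc _ _ _)) assoc_nat -!compA.
by rewrite [in LHS](compA (assoc _ _ _)) assocVK comp1m.
Qed.

(** With [ext_nat], this lets [ext_uniq] recognize families built from [ext f]. *)
Lemma ext_tens w w' (f : Hom (ob w I) (ob w' I)) x y :
  sh w' x y \o (ext f x <x> idm y) = ext f (x (x) y) \o sh w x y.
Proof.
have shiA : shi w I (x (x) y) \o obm w (assoc I x y) \o sh w (I (x) x) y =
            assoc (ob w I) x y \o (shi w I x <x> idm y).
  apply: (mono_comp (shK w I (x (x) y))).
  rewrite !compA shVK comp1m sh_assoc -!compA -tensMl shVK.
  by rewrite tens1 compm1.
rewrite /ext !tensMl !compA sh_nat -lunit_tens obmM.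
rewrite -!compA; congr (_ \o _).
rewrite (compA (sh w' _ _)) (compA (obm w' _)) (compA (obm w' _)) -sh_assoc.
rewrite -!compA; congr (_ \o _).
rewrite (compA (assoc _ _ _)) assoc_nat tens1 -!compA; congr (_ \o _).
rewrite (compA (assoc _ _ _)) -shiA -!compA; congr (_ \o _).
rewrite sh_nat (compA (obm w _)) -obmM (lunit_tens_inv x y).
by [].
Qed.

(** An equality of objects rather than an isomorphism; on explicit words it reduces to [erefl], and
    so do the casts along it. *)
Fixpoint ob_cat u v x : ob u (ob v x) = ob (u ++ v) x :=
  if u is a :: u' then f_equal (tens_ob a) (ob_cat u' v x) else erefl.

Definition hcast x x' y y' (ex : x = x') (ey : y = y') (f : Hom x y) : Hom x' y' :=
  match ex in _ = x', ey in _ = y' return Hom x' y' with erefl, erefl => f end.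

Lemma hcast_comp x x' y y' z z' (ex : x = x') (ey : y = y') (ez : z = z')
    (f : Hom y z) (g : Hom x y) :
  hcast ex ez (f \o g) = hcast ey ez f \o hcast ex ey g.
Proof. by case: x' / ex; case: y' / ey; case: z' / ez. Qed.
Lemma hcast_idm x x' (ex : x = x') : hcast ex ex (idm x) = idm x'.
Proof. by case: x' / ex. Qed.
Lemma hcast_lin x x' y y' (ex : x = x') (ey : y = y') a (f g : Hom x y) :
  hcast ex ey (a *: f + g) = a *: hcast ex ey f + hcast ex ey g.
Proof. by case: x' / ex; case: y' / ey. Qed.
Lemma hcast_tensr a x x' y y' (ex : x = x') (ey : y = y') (f : Hom x y) :
  idm a <x> hcast ex ey f = hcast (f_equal (tens_ob a) ex) (f_equal (tens_ob a) ey) (idm a <x> f).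
Proof. by case: x' / ex; case: y' / ey. Qed.
Lemma hcast_tensl a x x' y y' (ex : x = x') (ey : y = y') (f : Hom x y) :
  hcast ex ey f <x> idm a =
  hcast (f_equal (tens_ob^~ a) ex) (f_equal (tens_ob^~ a) ey) (f <x> idm a).
Proof. by case: x' / ex; case: y' / ey. Qed.
Lemma hcast_assoc a x x' y (ex : x = x') :
  assoc a x' y =
  hcast (f_equal (tens_ob^~ y) (f_equal (tens_ob a) ex))
        (f_equal (tens_ob a) (f_equal (tens_ob^~ y) ex)) (assoc a x y).
Proof. by case: x' / ex. Qed.

Lemma obm_cat u v x y (f : Hom x y) :
  obm (u ++ v) f = hcast (ob_cat u v x) (ob_cat u v y) (obm u (obm v f)).
Proof. by elim: u => //= a u ->; rewrite hcast_tensr. Qed.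

Lemma sh_cat u v x y :
  sh (u ++ v) x y = hcast (f_equal (tens_ob^~ y) (ob_cat u v x)) (ob_cat u v (x (x) y))
                      (obm u (sh v x y) \o sh u (ob v x) y).
Proof.
elim: u => [|a u IH] /=; first by rewrite compm1.
by rewrite IH hcast_tensr (hcast_assoc _ _ (ob_cat u v x)) -hcast_comp tensMr compA.
Qed.

Definition whisk v w w' (f : Hom (ob w I) (ob w' I)) : Hom (ob (w ++ v) I) (ob (w' ++ v) I) :=
  hcast (ob_cat w v I) (ob_cat w' v I) (ext f (ob v I)).

(** Both families are natural and tensorial in [x] and agree at [I], so [ext_uniq] applies. The law
    [rw_rw] rests on this. *)
Lemma ext_whisk v w w' (f : Hom (ob w I) (ob w' I)) x :
  ext (whisk v f) x = hcast (ob_cat w v x) (ob_cat w' v x) (ext f (ob v x)).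
Proof.
symmetry.
apply: (@ext_uniq _ _ (fun x => hcast (ob_cat w v x) (ob_cat w' v x) (ext f (ob v x)))).
  by move=> y z h; cbv beta; rewrite !obm_cat -!hcast_comp ext_nat.
rewrite !sh_cat hcast_tensl -!hcast_comp; congr hcast.
rewrite -[LHS]compA ext_tens [LHS]compA [RHS]compA. congr (_ \o _).
by rewrite ext_nat.
Qed.

Definition moncat_strict : strict_data R (Obj C) :=
  @StrictData R (Obj C) (fun u v => Hom (ob u I) (ob v I))
    (fun u => idm _) (fun u v w f g => f \o g)
    (fun a u v f => idm a <x> f) whisk.

Lemma lws_obm (x : seq (Obj C)) u v (f : cell moncat_strict u v) :
  lws x f = hcast (ob_cat x u I) (ob_cat x v I) (obm x (f : Hom (ob u I) (ob v I))).
Proof. by elim: x => //= a x ->; rewrite hcast_tensr. Qed.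

Lemma hcast_recast u u' v v' (eu : u = u') (ev : v = v') (f : cell moncat_strict u v) :
  recast eu ev f = hcast (f_equal (ob^~ I) eu) (f_equal (ob^~ I) ev) f.
Proof. by case: u' / eu; case: v' / ev. Qed.

Lemma hcast_trans x x' x'' y y' y'' (ex : x = x') (ex' : x' = x'') (ey : y = y') (ey' : y' = y'')
   (f : Hom x y) : hcast ex' ey' (hcast ex ey f) = hcast (etrans ex ex') (etrans ey ey') f.
Proof. by case: x'' / ex'; case: y'' / ey'. Qed.

Lemma f_equal_ob x a (u v : seq (Obj C)) (e : u = v) :
  f_equal (ob^~ x) (f_equal (cons a) e) = f_equal (tens_ob a) (f_equal (ob^~ x) e).
Proof. by case: v / e. Qed.
Lemma etrans_f_equal (f : Obj C -> Obj C) x y z (e : x = y) (e' : y = z) :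
  etrans (f_equal f e) (f_equal f e') = f_equal f (etrans e e').
Proof. by case: z / e'. Qed.
Lemma f_equal_comp (f g : Obj C -> Obj C) x y (e : x = y) :
  f_equal (fun z => f (g z)) e = f_equal f (f_equal g e).
Proof. by case: y / e. Qed.

(** The equality proofs themselves have to be compared: [Obj C] is an arbitrary type, in which two
    proofs of the same equality need not coincide. *)
Lemma ob_catA u v w x :
  etrans (ob_cat u v (ob w x)) (etrans (ob_cat (u ++ v) w x) (f_equal (ob^~ x) (catA u v w))) =
  etrans (f_equal (ob u) (ob_cat v w x)) (ob_cat u (v ++ w) x).
Proof.
elim: u => [|a u IH] /=; first by case: _ / (ob_cat v w x).
by rewrite f_equal_ob !etrans_f_equal IH -etrans_f_equal -f_equal_comp.
Qed.

Lemma ob_catn w x : etrans (ob_cat w [::] x) (f_equal (ob^~ x) (catn w)) = erefl.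
Proof. by elim: w => //= a w IH; rewrite f_equal_ob etrans_f_equal IH. Qed.

Lemma hcast_ext w w' x x' (e : x = x') (f : Hom (ob w I) (ob w' I)) :
  ext f x' = hcast (f_equal (ob w) e) (f_equal (ob w') e) (ext f x).
Proof. by case: x' / e. Qed.

Lemma moncat_strict_laws : strict_laws moncat_strict.
Proof.
split=> /=.
- by move=> *; apply: comp1m.
- by move=> *; apply: compm1.
- by move=> *; apply: compA.
- by move=> *; apply: comp_linl.
- by move=> *; apply: comp_linr.
- by move=> *; apply: tens1.
- by move=> *; apply: tensMr.
- by move=> *; apply: tens_linr.
- by move=> x u; rewrite /whisk ext1 hcast_idm.
- by move=> x u v w f g; rewrite /whisk extM (hcast_comp _ (ob_cat v x I)).
- by move=> x u v b f g; rewrite /whisk ext_lin hcast_lin.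
- by move=> a x u v f; rewrite /whisk ext_lw hcast_tensr.
- move=> u v f; rewrite hcast_recast /whisk hcast_trans /= ext_unit.
  by rewrite !ob_catn.
- move=> x y u v f; rewrite hcast_recast {1}/whisk ext_whisk !hcast_trans.
  rewrite /whisk (hcast_ext (ob_cat x y I)) hcast_trans -!ob_catA.
  by rewrite -!hcast_trans.
- move=> u v x y f h; rewrite !lws_obm /whisk /= -!hcast_comp.
  by rewrite ext_nat.
Qed.

End Coherence.

Definition cell_iso {R A} {S : strict_data R A} (u v : seq A) :=
  exists (f : cell S u v) (g : cell S v u), cc f g = cid v /\ cc g f = cid u.

Definition cell_dsum {R A} (S : strict_data R A) (u : seq A) (n : nat) (y : 'I_n -> seq A) :=
  exists (p : forall j, cell S u (y j)) (e : forall j, cell S (y j) u),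
    [/\ forall j, cc (p j) (e j) = cid (y j),
        forall i j, i != j -> cc (p i) (e j) = 0 &
        \sum_j cc (e j) (p j) = cid u].

(** Of the dual of [m], [sng_dual] keeps only the zig-zags and a decomposition into simples; that
    [m] is its own dual is derived later. *)
Record strict_near_group (R : fieldType) (A : Type) (S : strict_data R A)
    (gT : finGroupType) (k : nat) (s : option gT -> A) : Prop := StrictNearGroup {
  sng_laws : strict_laws S;
  sng_hom0 : forall i j (f : cell S [:: s i] [:: s j]), i != j -> f = 0;
  sng_hom1 : forall i (f : cell S [:: s i] [:: s i]), exists a, f = a *: cid _;
  sng_id0 : forall i, cid [:: s i] != 0 :> cell S _ _;
  sng_unit : @cell_iso R A S [:: s (Some 1%g)] [::];
  sng_mul : forall g h, @cell_iso R A S [:: s (Some g); s (Some h)] [:: s (Some (g * h)%g)];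
  sng_lact : forall g, @cell_iso R A S [:: s (Some g); s None] [:: s None];
  sng_ract : forall g, @cell_iso R A S [:: s None; s (Some g)] [:: s None];
  sng_dsum : exists n (y : 'I_n -> option gT),
    [/\ forall g, #|[pred j | y j == Some g]| = 1%N,
        #|[pred j | y j == None]| = k &
        cell_dsum S [:: s None; s None] (fun j => [:: s (y j)])];
  sng_dual : exists (b : A) (ev : cell S [:: b; s None] [::]) (co : cell S [::] [:: s None; b]),
    [/\ cc (lw (s None) ev) (rw [:: s None] co) = cid [:: s None],
        cc (rw [:: b] ev) (lw b co) = cid [:: b] &
        exists n (y : 'I_n -> option gT), cell_dsum S [:: b] (fun j => [:: s (y j)])]
}.

(** * Transport of the near-group axioms to words *)

Section Strictify.
Variables (R : fieldType) (C : MonCat R).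
Hypothesis rigC : is_rigid_monoidal C.
Local Notation "f \o g" := (comp f g).
Local Notation "x (x) y" := (tens_ob x y) (at level 40, left associativity).
Local Notation "f <x> g" := (tens f g) (at level 40, left associativity).
Local Notation I := (@munit R C).
Local Notation S := (moncat_strict C).
Implicit Types (x y z : Obj C).

Lemma iso_refl x : iso x x.
Proof. by exists (idm x), (idm x); rewrite comp1m. Qed.
Lemma iso_sym x y : iso x y -> iso y x.
Proof. by move=> [f [g [fg gf]]]; exists g, f. Qed.
Lemma iso_trans x y z : iso x y -> iso y z -> iso x z.
Proof.
move=> [f [g [fg gf]]] [f' [g' [fg' gf']]]; exists (f' \o f), (g \o g'); split.
  by rewrite -(compA rigC) (compA rigC f) fg comp1m.
by rewrite -(compA rigC) (compA rigC g') gf' comp1m.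
Qed.
Lemma iso_tens x y x' y' : iso x y -> iso x' y' -> iso (x (x) x') (y (x) y').
Proof.
move=> [f [g [fg gf]]] [f' [g' [fg' gf']]]; exists (f <x> f'), (g <x> g').
by rewrite -!tensM // fg gf fg' gf' !tens1.
Qed.
Lemma iso_runit x : iso (x (x) I) x.
Proof. by exists (runit x), (runit_inv x); rewrite runitK ?runitVK. Qed.

Lemma compf0 x y z (f : Hom y z) : f \o (0 : Hom x y) = 0.
Proof.
have := comp_linr rigC (-1) f 0 (0 : Hom x y).
by rewrite scaler0 addr0 scaleN1r addNr.
Qed.
Lemma comp0f x y z (f : Hom x y) : (0 : Hom y z) \o f = 0.
Proof.
have := comp_linl rigC (-1) 0 (0 : Hom y z) f.
by rewrite scaler0 addr0 scaleN1r addNr.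
Qed.
Lemma comp_sumr n x y z (f : Hom y z) (g : 'I_n -> Hom x y) :
  f \o (\sum_j g j) = \sum_j (f \o g j).
Proof.
apply: (big_morph (fun b => f \o b)) => [u v|]; last exact: compf0.
by have := comp_linr rigC 1 f u v; rewrite !scale1r.
Qed.
Lemma comp_suml n x y z (f : Hom x y) (g : 'I_n -> Hom y z) :
  (\sum_j g j) \o f = \sum_j (g j \o f).
Proof.
apply: (big_morph (fun b => b \o f)) => [u v|]; last exact: comp0f.
by have := comp_linl rigC 1 u v f; rewrite !scale1r.
Qed.

Lemma dsum_iso x x' n (y y' : 'I_n -> Obj C) :
  iso x x' -> (forall j, exists (f : Hom (y j) (y' j)) g, f \o g = idm _ /\ g \o f = idm _) ->
  is_dsum x y -> is_dsum x' y'.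
Proof.
move=> [f [g [fg gf]]] /fin_all_exists [f' /fin_all_exists [g' fg']] [p [e [pe1 pe0 pes]]].
exists (fun j => f' j \o p j \o g), (fun j => f \o e j \o g' j).
have E i j : (f' i \o p i \o g) \o (f \o e j \o g' j) = f' i \o (p i \o e j) \o g' j.
  by rewrite -!(compA rigC) (compA rigC g) gf comp1m.
split=> [j|i j ij|]; rewrite ?E.
- by rewrite pe1 compm1 //; case: (fg' j).
- by rewrite pe0 // compf0 comp0f.
- rewrite -fg -[f in RHS](compm1 rigC) -pes comp_sumr comp_suml; apply: eq_bigr => j _.
  rewrite !(compA rigC) -(compA rigC _ (g' j) (f' j)).
  by have [_ ->] := fg' j; rewrite compm1.
Qed.

Section Duals.
Variables (a b : Obj C) (evb : Hom (b (x) a) I) (cob : Hom I (a (x) b)).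
Hypothesis zig : runit a \o (idm a <x> evb) \o assoc a b a \o (cob <x> idm a) \o lunit_inv a = idm a.
Hypothesis zag : lunit b \o (evb <x> idm b) \o assoc_inv b a b \o (idm b <x> cob) \o runit_inv b = idm b.

Let co x : Hom x (a (x) (b (x) x)) := assoc a b x \o (cob <x> idm x) \o lunit_inv x.
Let ev x : Hom (b (x) (a (x) x)) x := lunit x \o (evb <x> idm x) \o assoc_inv b a x.

Lemma lunit_inv_nat x y (h : Hom x y) : lunit_inv y \o h = (idm I <x> h) \o lunit_inv x.
Proof.
apply: (mono_comp rigC (lunitK rigC y)).
by rewrite !(compA rigC) lunitVK // lunit_nat // -(compA rigC) lunitVK // comp1m // compm1.
Qed.

Lemma assoc_inv_nat x y z x' y' z' (f : Hom x x') (g : Hom y y') (h : Hom z z') :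
  assoc_inv x' y' z' \o (f <x> (g <x> h)) = ((f <x> g) <x> h) \o assoc_inv x y z.
Proof.
apply: (mono_comp rigC (assocK rigC _ _ _)).
by rewrite !(compA rigC) assocVK // assoc_nat // -(compA rigC) assocVK // comp1m // compm1.
Qed.

(** The family [co] is natural and tensorial in [x], hence the extension of its component at [I]:
    right whiskering of the cell [co I] gives again a component of [co]. *)
Lemma co_ext x : co x = ext (w := [::]) (w' := [:: a; b]) (co I) x.
Proof.
apply: (ext_uniq rigC (w := [::]) (w' := [:: a; b]) (al := co)) => /= [{}x y h|].
  rewrite /co -[RHS](compA rigC) lunit_inv_nat !(compA rigC); congr (_ \o _).
  rewrite -[RHS](compA rigC) (tens_r rigC) -[in RHS](tens_l rigC cob) !(compA rigC); congr (_ \o _).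
  by rewrite -(tens1 rigC) (assoc_nat rigC).
rewrite /co !(compm1 rigC) !(tensMl rigC) (tens1 rigC) (comp1m rigC).
rewrite -(lunit_tens_inv rigC) !(compA rigC) -(pentagon rigC) -!(compA rigC); congr (_ \o _).
by rewrite !(compA rigC) (assoc_nat rigC) tens1.
Qed.

Lemma ev_ext x : ev x = ext (w := [:: b; a]) (w' := [::]) (ev I) x.
Proof.
apply: (ext_uniq rigC (w := [:: b; a]) (w' := [::]) (al := ev)) => /= [{}x y h|].
  rewrite /ev -!(compA rigC) assoc_inv_nat !(compA rigC); congr (_ \o _).
  rewrite -lunit_nat // -!(compA rigC) tens1 //; congr (_ \o _).
  by rewrite tens_l // tens_r.
rewrite /ev (comp1m rigC) !(tensMl rigC) (tens1 rigC) (comp1m rigC).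
rewrite -(lunit_tens rigC) -!(compA rigC); congr (_ \o _).
rewrite [in LHS](compA rigC) (assoc_nat rigC) (tens1 rigC) -!(compA rigC); congr (_ \o _).
apply: (epi_comp rigC (s := assoc b a I <x> idm x) (s' := assoc_inv b a I <x> idm x)).
  by rewrite -tensMl // assocVK // tens1.
rewrite -!(compA rigC) -tensMl // assocK // tens1 // compm1 // (compA rigC (idm b <x> _)) -pentagon //.
by rewrite (compA rigC) assocK // comp1m.
Qed.

(** Once the casts are gone, each strict zig-zag is the given one tensored with [idm I]; a pentagon
    absorbs the remaining associators. *)
Lemma strict_dual :
  exists (e : cell S [:: b; a] [::]) (c : cell S [::] [:: a; b]),
    cc (lw a e) (rw [:: a] c) = cid [:: a] /\ cc (rw [:: b] e) (lw b c) = cid [:: b].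
Proof.
exists (ev I), (co I); split=> /=.
  rewrite /whisk /= -[ext _ _](co_ext (a (x) I)) /co /ev !(tensMr rigC).
  transitivity ((runit a \o (idm a <x> evb) \o assoc a b a \o (cob <x> idm a) \o
      lunit_inv a) <x> idm I); last by rewrite zig (tens1 rigC).
  rewrite !(tensMl rigC) -(triangle rigC) -(lunit_tens_inv rigC).
  rewrite !(compA rigC); congr (_ \o _).
  rewrite -!(compA rigC); congr (_ \o _).
  rewrite [in RHS](compA rigC (assoc a I I)) (assoc_nat rigC) -!(compA rigC); congr (_ \o _).
  rewrite -(tens1 rigC) -(assoc_nat rigC cob) (compA rigC (assoc a b _)) (pentagon rigC).
  by rewrite !(compA rigC) -(tensMr rigC) (assocK rigC) (tens1 rigC) comp1m.
rewrite /whisk /= -[ext _ _](ev_ext (b (x) I)) /co /ev !(tensMr rigC).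
transitivity ((lunit b \o (evb <x> idm b) \o assoc_inv b a b \o (idm b <x> cob) \o
      runit_inv b) <x> idm I); last by rewrite zag (tens1 rigC).
rewrite !(tensMl rigC) -(triangle_inv rigC) -(lunit_tens rigC).
rewrite -!(compA rigC); congr (_ \o _).
rewrite !(compA rigC) (assoc_nat rigC evb); congr (_ \o _).
rewrite -[in RHS](compA rigC) -[in LHS](compA rigC _ (_ <x> _)) -(assoc_nat rigC (idm b) cob).
rewrite -[in RHS](compA rigC) !(compA rigC) (tens1 rigC); congr (_ \o _).
rewrite -!(compA rigC); congr (_ \o _).
apply: (epi_comp rigC (s := assoc b a b <x> idm I) (s' := assoc_inv b a b <x> idm I)).
  by rewrite -(tensMl rigC) (assocVK rigC) tens1.
rewrite -!(compA rigC) -(tensMl rigC) (assocK rigC) (tens1 rigC) (compm1 rigC).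
rewrite [idm b <x> _ \o _](compA rigC) -(pentagon rigC) (compA rigC) (assocK rigC).
by rewrite (comp1m rigC).
Qed.
End Duals.

Lemma dsum_obj x n (y : 'I_n -> Obj C) : is_dsum x y ->
  forall u, iso x (ob u I) -> cell_dsum S u (fun j => [:: y j]).
Proof.
move=> xy u xu; apply: (dsum_iso (y' := fun j => y j (x) I) xu) xy => j.
by exists (runit_inv (y j)), (runit (y j)); rewrite runitK ?runitVK.
Qed.

(** The one-letter word [x] denotes [x (x) I], so cells and morphisms differ by conjugation with
    [runit]. *)
Lemma obj_cell x y (f : cell S [:: x] [:: y]) :
  exists g : Hom x y, f = runit_inv y \o g \o runit x.
Proof.
exists (runit y \o f \o runit_inv x).
by rewrite !(compA rigC) (runitK rigC) (comp1m rigC) -(compA rigC) (runitK rigC) compm1.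
Qed.

Lemma near_group_strict (gT : finGroupType) k :
  (exists (phi : gT -> Obj C) (m : Obj C),
    let s := fun o : option gT => if o is Some g then phi g else m in
    [/\ (forall i j, \dim {: Hom (s i) (s j)} = (i == j)%N),
        (forall x : Obj C, exists n (y : 'I_n -> option gT), is_dsum x (fun j => s (y j))),
        iso (phi 1%g) I /\
        (forall g h, iso (tens_ob (phi g) (phi h)) (phi (g * h)%g)),
        (forall g, iso (tens_ob (phi g) m) m /\ iso (tens_ob m (phi g)) m) &
        exists n (y : 'I_n -> option gT),
          [/\ (forall g, #|[pred j | y j == Some g]| = 1%N),
              #|[pred j | y j == None]| = k &
              is_dsum (tens_ob m m) (fun j => s (y j))]]) ->
  exists s : option gT -> Obj C, strict_near_group S k s.
Proof.
move=> [phi [m]]; set s := fun o => _ => /= -[dims dec [iso1 isoM] isoA [n [y [yG yk ydec]]]].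
have iso2 (a b c : Obj C) : iso (a (x) b) c -> @cell_iso R _ S [:: a; b] [:: c].
  move=> /= h; apply: (iso_trans (y := tens_ob a b)).
    by apply: iso_tens; [apply: iso_refl | apply: iso_runit].
  by apply: (iso_trans h); apply/iso_sym/iso_runit.
have id0 i : idm (s i) != 0.
  apply/eqP => id0; have := dims i i.
  have -> : fullv = 0%VS :> {vspace Hom (s i) (s i)}.
    apply/vspaceP => f; rewrite memvf memv0; apply/esym/eqP.
    by rewrite -(comp1m rigC f) id0 comp0f.
  by rewrite dimv0 eqxx.
exists s; split.
- exact: moncat_strict_laws.
- move=> i j f ij; have [g ->] := obj_cell f.
  suff -> : g = 0 by rewrite compf0 comp0f.
  have /eqP := dims i j; rewrite (negPf ij) dimv_eq0 => /eqP E.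
  by apply/eqP; rewrite -memv0 -E memvf.
- move=> i f; have [g ->] := obj_cell f.
  have /= /eqP := dims i i; rewrite eqxx => d1.
  have: (<[idm (s i)]> == fullv)%VS.
    by rewrite eqEdim subvf (eqP d1) dim_vline id0.
  move/eqP => E; have : g \in fullv by rewrite memvf.
  rewrite -E => /vlineP[a ->]; exists a => /=.
  have -> : runit_inv (s i) \o (a *: idm (s i)) = a *: (runit_inv (s i)).
    have := comp_linr rigC a (runit_inv (s i)) (idm (s i)) 0.
    by rewrite !addr0 compf0 addr0 (compm1 rigC).
  have := comp_linl rigC a (runit_inv (s i)) 0 (runit (s i)).
  by rewrite !addr0 comp0f addr0 (runitK rigC).
- move=> i; apply: contra (id0 i) => /= /eqP E; apply/eqP.
  rewrite -(runitVK rigC) -(compm1 rigC (runit (s i))) E.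
  by rewrite compf0 comp0f.
- by apply: (iso_trans (iso_runit _)).
- by move=> g h; apply: iso2; apply: isoM.
- by move=> g; apply: iso2; case: (isoA g).
- by move=> g; apply: iso2; case: (isoA g).
- exists n, y; split=> //; apply: (dsum_obj ydec).
  by apply: iso_tens; [apply: iso_refl | apply/iso_sym/iso_runit].
- have [_ _ _ _ /(_ m) [zig zag]] := rigC.
  have [e [c [ec ce]]] := strict_dual zig zag.
  exists (dual m), e, c; split=> //.
  have [n' [y' ydec']] := dec (dual m); exists n', y'; apply: (dsum_obj ydec').
  exact/iso_sym/iso_runit.
Qed.
End Strictify.

(** * The strict calculus of a near-group category *)

(* [fV = Hom(m m, m)], [fD = Hom(m, m m)], [fH = Hom(m m m, m)]. An element of [G] can be
   absorbed by [m] on the left of the source ([aL]), on its right ([aR]) or between the two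
   factors ([aM]); [dL], [dR], [dM] are the dual actions. [t1] and [t2] compose along
   [(m m) m -> m m -> m] and [m (m m) -> m m -> m], and [c1], [c2] extract the corresponding
   components. With [e : m m -> 1], [pP = e m] and [pQ = m e], and [qQ g] is the right
   translate of [pQ] by [g]. *)
Record fusion_data (R : fieldType) (gT : finGroupType) (k : nat) := FusionData {
  fV : vectType R; fD : vectType R; fH : vectType R;
  pair : fV -> fD -> R;
  bV : 'I_k -> fV; bD : 'I_k -> fD;
  aL : gT -> fV -> fV; aM : gT -> fV -> fV; aR : gT -> fV -> fV;
  dL : gT -> fD -> fD; dM : gT -> fD -> fD; dR : gT -> fD -> fD;
  t1 : fV -> fV -> fH; t2 : fV -> fV -> fH;
  c1 : fH -> fD -> fV; c2 : fH -> fD -> fV;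
  hL : gT -> fH -> fH;
  pP : fH; pQ : fH; qQ : gT -> fH
}.

(** The two bracketings meet in the laws on [c2 (pP F)] and [c1 (pQ F)], which rotate a leg of a
    dual vector by [e], and in the last two laws, which slide a [g] through the first tree. *)
Record fusion_laws R gT k (F : fusion_data R gT k) : Prop := FusionLaws {
  pair_linl : forall x b (f f' : fV F), pair (b *: f + f') x = b * pair f x + pair f' x;
  pair_linr : forall f b (x x' : fD F), pair f (b *: x + x') = b * pair f x + pair f x';
  pair_basis : forall i j, pair (bV F i) (bD F j) = (i == j)%:R;
  bVE : forall f, f = \sum_i pair f (bD F i) *: bV F i;
  bDE : forall x, x = \sum_i pair (bV F i) x *: bD F i;
  aL_lin : forall g, linear (@aL _ _ _ F g);
  aM_lin : forall g, linear (@aM _ _ _ F g);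
  aR_lin : forall g, linear (@aR _ _ _ F g);
  t1_linl : forall f1, linear (fun f => t1 f f1 : fH F);
  t1_linr : forall f, linear (t1 f : fV F -> fH F);
  t2_linl : forall f1, linear (fun f => t2 f f1 : fH F);
  t2_linr : forall f, linear (t2 f : fV F -> fH F);
  c1_linl : forall x, linear (fun P => c1 P x : fV F);
  c1_linr : forall P : fH F, linear (c1 P);
  c2_linl : forall x, linear (fun P => c2 P x : fV F);
  c2_linr : forall P : fH F, linear (c2 P);
  hL_lin : forall g, linear (@hL _ _ _ F g);
  pair_L : forall g (f : fV F) x, pair (aL g f) (dL g x) = pair f x;
  pair_R : forall g (f : fV F) x, pair (aR g f) (dR g x) = pair f x;
  pair_M : forall g (f : fV F) x, pair (aM g f) x = pair f (dM g x);
  aL1 : forall f : fV F, aL 1%g f = f;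
  aLM : forall g h (f : fV F), aL g (aL h f) = aL (g * h)%g f;
  hL1 : forall P : fH F, hL 1%g P = P;
  hLM : forall g h (P : fH F), hL g (hL h P) = hL (g * h)%g P;
  aLM_comm : forall g h (f : fV F), aL g (aM h f) = aM h (aL g f);
  aMR_comm : forall g h (f : fV F), aM g (aR h f) = aR h (aM g f);
  hL_t1 : forall g (f f1 : fV F), hL g (t1 f f1) = t1 (aL g f) (aL g f1);
  hL_t2 : forall g (f f1 : fV F), hL g (t2 f f1) = t2 (aL g f) f1;
  hL_qQ : forall g h, hL g (qQ F h) = qQ F h;
  c1_t1 : forall (f f1 : fV F) x, c1 (t1 f f1) x = pair f1 x *: f;
  c2_t2 : forall (f f1 : fV F) x, c2 (t2 f f1) x = pair f1 x *: f;
  c2_qQ : forall g x, c2 (qQ F g) x = 0;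
  c1_qQ : forall g x, c1 (qQ F g) x = aR g (c1 (pQ F) x);
  c1_hL : forall g (P : fH F) x, c1 (hL g P) (dL g x) = aL g (c1 P x);
  c2_hL : forall g (P : fH F) x, c2 (hL g P) x = aL g (c2 P x);
  tree1_span : forall P : fH F, exists y : gT -> R,
    P = \sum_g y g *: hL g (pP F) + \sum_i t1 (c1 P (bD F i)) (bV F i);
  tree2_span : forall P : fH F, exists y : gT -> R,
    P = \sum_g y g *: qQ F g + \sum_i t2 (c2 P (bD F i)) (bV F i);
  hLP_free : forall y : gT -> R, \sum_g y g *: hL g (pP F) = 0 -> forall g, y g = 0;
  qQ_free : forall y : gT -> R, \sum_g y g *: qQ F g = 0 -> forall g, y g = 0;
  c2_P_M : forall g x, aM g (c2 (pP F) (dL g x)) = c2 (pP F) x;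
  c2_P_R : forall g x, c2 (pP F) (dR g x) = aR g (c2 (pP F) x);
  c1_Q_L : forall g x, c1 (pQ F) (dL g x) = aL g (c1 (pQ F) x);
  c1_Q_M : forall g x, c1 (pQ F) (dR g x) = aM g (c1 (pQ F) x);
  c2_P_inj : forall x, c2 (pP F) x = 0 -> x = 0;
  c1_Q_inj : forall x, c1 (pQ F) x = 0 -> x = 0;
  c2_t1_M : forall g (f f1 : fV F) x, c2 (t1 f (aM g f1)) x = aM g (c2 (t1 f f1) (dL g x));
  c2_t1_MR : forall g (f f1 : fV F) x, c2 (t1 (aM g f) (aR g f1)) x = c2 (t1 f f1) (dM g x)
}.

(** * Diagram calculus on words *)

Section Calculus.
Variables (R : fieldType) (A : Type) (S : strict_data R A).
Hypothesis SL : strict_laws S.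
Local Notation "f \o g" := (cc f g).
Local Notation "a ~> f" := (lw a f) (at level 35, right associativity).
Local Notation "f <~ x" := (rw x f) (at level 37, left associativity).
Implicit Types (u v w : seq A).

Let c1f := cc1f SL.
Let cf1 := ccf1 SL.
Let cA := ccA SL.

Lemma cc0l u v w (h : cell S u v) : (0 : cell S v w) \o h = 0.
Proof.
have := cc_linl SL (-1) 0 (0 : cell S v w) h.
by rewrite scaler0 addr0 scaleN1r addNr.
Qed.
Lemma cc0r u v w (f : cell S v w) : f \o (0 : cell S u v) = 0.
Proof.
have := cc_linr SL (-1) f 0 (0 : cell S u v).
by rewrite scaler0 addr0 scaleN1r addNr.
Qed.
Lemma ccZl u v w b (f : cell S v w) (h : cell S u v) : (b *: f) \o h = b *: (f \o h).
Proof. by have := cc_linl SL b f 0 h; rewrite !addr0 cc0l addr0. Qed.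
Lemma ccZr u v w b (f : cell S v w) (h : cell S u v) : f \o (b *: h) = b *: (f \o h).
Proof. by have := cc_linr SL b f h 0; rewrite !addr0 cc0r addr0. Qed.
Lemma ccDl u v w (f g : cell S v w) (h : cell S u v) : (f + g) \o h = (f \o h) + (g \o h).
Proof. by have := cc_linl SL 1 f g h; rewrite !scale1r. Qed.
Lemma ccDr u v w (f : cell S v w) (g h : cell S u v) : f \o (g + h) = (f \o g) + (f \o h).
Proof. by have := cc_linr SL 1 f g h; rewrite !scale1r. Qed.
Lemma cc_suml (I : finType) u v w (F : I -> cell S v w) (h : cell S u v) :
  (\sum_i F i) \o h = \sum_i (F i \o h).
Proof. by apply: (big_morph (fun f => f \o h)) => [f g|]; [apply: ccDl | apply: cc0l]. Qed.
Lemma cc_sumr (I : finType) u v w (F : I -> cell S u v) (h : cell S v w) :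
  h \o (\sum_i F i) = \sum_i (h \o F i).
Proof. by apply: (big_morph (fun f => h \o f)) => [f g|]; [apply: ccDr | apply: cc0r]. Qed.

Lemma lwZ a u v b (f : cell S u v) : a ~> (b *: f) = b *: (a ~> f).
Proof.
have := lw_lin SL a b f 0; have := lw_lin SL a (-1) 0 (0 : cell S u v).
by rewrite scaler0 addr0 scaleN1r addNr => ->; rewrite !addr0.
Qed.
Lemma lw0 a u v : a ~> (0 : cell S u v) = 0.
Proof. by have := lwZ a 0 (0 : cell S u v); rewrite !scale0r. Qed.
Lemma lwD a u v (f g : cell S u v) : a ~> (f + g) = (a ~> f) + (a ~> g).
Proof. by have := lw_lin SL a 1 f g; rewrite !scale1r. Qed.
Lemma rwZ x u v b (f : cell S u v) : (b *: f) <~ x = b *: (f <~ x).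
Proof.
have := rw_lin SL x b f 0; have := rw_lin SL x (-1) 0 (0 : cell S u v).
by rewrite scaler0 addr0 scaleN1r addNr => ->; rewrite !addr0.
Qed.
Lemma rw0 x u v : (0 : cell S u v) <~ x = 0.
Proof. by have := rwZ x 0 (0 : cell S u v); rewrite !scale0r. Qed.
Lemma rwD x u v (f g : cell S u v) : (f + g) <~ x = (f <~ x) + (g <~ x).
Proof. by have := rw_lin SL x 1 f g; rewrite !scale1r. Qed.
Lemma lw_sum (I : finType) a u v (F : I -> cell S u v) : a ~> (\sum_i F i) = \sum_i (a ~> F i).
Proof. by apply: (big_morph (fun f => a ~> f)) => [f g|]; [apply: lwD | apply: lw0]. Qed.
Lemma rw_sum (I : finType) x u v (F : I -> cell S u v) : (\sum_i F i) <~ x = \sum_i (F i <~ x).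
Proof. by apply: (big_morph (fun f => f <~ x)) => [f g|]; [apply: rwD | apply: rw0]. Qed.

(** Composites are kept left-nested; [cch] and [cch1] rewrite two adjacent factors inside them. *)
Lemma cch t u v v' w (k : cell S v w) (f : cell S u v) (g : cell S t u) (f' : cell S v' v) (g' : cell S t v') :
  f \o g = f' \o g' -> k \o f \o g = k \o f' \o g'.
Proof. by move=> E; rewrite -cA E cA. Qed.
Lemma cch1 u v w (k : cell S v w) (f : cell S u v) (g : cell S v u) :
  f \o g = cid v -> k \o f \o g = k.
Proof. by move=> E; rewrite -cA E cf1. Qed.

Lemma lwK a u v (f : cell S u v) (g : cell S v u) :
  f \o g = cid v -> (a ~> f) \o (a ~> g) = cid _.
Proof. by move=> E; rewrite -(lwM SL) E (lw1 SL). Qed.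
Lemma rwK x u v (f : cell S u v) (g : cell S v u) :
  f \o g = cid v -> (f <~ x) \o (g <~ x) = cid _.
Proof. by move=> E; rewrite -(rwM SL) E (rw1 SL). Qed.

Lemma rwE x u v w (f : cell S v w) (g : cell S u v) (h : cell S u w) :
  f \o g = h -> (f <~ x) \o (g <~ x) = h <~ x.
Proof. by move=> <-; rewrite (rwM SL). Qed.

(** In these names the digits are the lengths of the source and target words of [f]. On words of
    known length the concatenations and casts compute away. *)
Lemma xch21 a b c x y (f : cell S [:: a; b] [:: c]) (h : cell S x y) :
  (f <~ y) \o (a ~> b ~> h) = (c ~> h) \o (f <~ x).
Proof. exact: (xch SL f h). Qed.
Lemma xch12 a b c x y (f : cell S [:: c] [:: a; b]) (h : cell S x y) :
  (f <~ y) \o (c ~> h) = (a ~> b ~> h) \o (f <~ x).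
Proof. exact: (xch SL f h). Qed.
Lemma xch20 a b x y (f : cell S [:: a; b] [::]) (h : cell S x y) :
  (f <~ y) \o (a ~> b ~> h) = h \o (f <~ x).
Proof. exact: (xch SL f h). Qed.
Lemma xch02 a b x y (f : cell S [::] [:: a; b]) (h : cell S x y) :
  (f <~ y) \o h = (a ~> b ~> h) \o (f <~ x).
Proof. exact: (xch SL f h). Qed.
Lemma xch10 a x y (f : cell S [:: a] [::]) (h : cell S x y) :
  (f <~ y) \o (a ~> h) = h \o (f <~ x).
Proof. exact: (xch SL f h). Qed.
Lemma xch11 a b x y (f : cell S [:: a] [:: b]) (h : cell S x y) :
  (f <~ y) \o (a ~> h) = (b ~> h) \o (f <~ x).
Proof. exact: (xch SL f h). Qed.
Lemma rw11 a b x y (f : cell S [:: a] [:: b]) : f <~ x <~ y = f <~ (x ++ y).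
Proof. exact: (rw_rw SL x y f). Qed.
Lemma rw01 a x y (f : cell S [::] [:: a]) : f <~ x <~ y = f <~ (x ++ y).
Proof. exact: (rw_rw SL x y f). Qed.
Lemma rw11_nil a b (f : cell S [:: a] [:: b]) : f <~ [::] = f.
Proof. exact: (rw_nil SL f). Qed.
Lemma rw21 a b c x y (f : cell S [:: a; b] [:: c]) : f <~ x <~ y = f <~ (x ++ y).
Proof. exact: (rw_rw SL x y f). Qed.
Lemma rw12 a b c x y (f : cell S [:: c] [:: a; b]) : f <~ x <~ y = f <~ (x ++ y).
Proof. exact: (rw_rw SL x y f). Qed.
Lemma rw20 a b x y (f : cell S [:: a; b] [::]) : f <~ x <~ y = f <~ (x ++ y).
Proof. exact: (rw_rw SL x y f). Qed.
Lemma rw12_nil a b c (f : cell S [:: c] [:: a; b]) : f <~ [::] = f.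
Proof. exact: (rw_nil SL f). Qed.
Lemma rw02 a b x y (f : cell S [::] [:: a; b]) : f <~ x <~ y = f <~ (x ++ y).
Proof. exact: (rw_rw SL x y f). Qed.

Section Data.
Variables (gT : finGroupType) (G : gT -> A) (m : A) (k : nat).
Variables (lam : forall g, cell S [:: G g; m] [:: m]) (lamV : forall g, cell S [:: m] [:: G g; m]).
Variables (rho : forall g, cell S [:: m; G g] [:: m]) (rhoV : forall g, cell S [:: m] [:: m; G g]).
Variables (kap : forall g h, cell S [:: G g; G h] [:: G (g * h)%g]).
Variables (kapV : forall g h, cell S [:: G (g * h)%g] [:: G g; G h]).
Variables (e : cell S [:: m; m] [::]) (c : cell S [::] [:: m; m]).
Hypothesis lamK : forall g, lamV g \o lam g = cid _.
Hypothesis lamVK : forall g, lam g \o lamV g = cid _.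
Hypothesis rhoK : forall g, rhoV g \o rho g = cid _.
Hypothesis rhoVK : forall g, rho g \o rhoV g = cid _.
Hypothesis kapK : forall g h, kapV g h \o kap g h = cid _.
Hypothesis kapVK : forall g h, kap g h \o kapV g h = cid _.
Variables (ups : cell S [:: G 1%g] [::]) (upsV : cell S [::] [:: G 1%g]).
Hypothesis upsK : upsV \o ups = cid _.
Hypothesis upsVK : ups \o upsV = cid _.
Hypothesis zig : (m ~> e) \o (c <~ [:: m]) = cid _.
Hypothesis zag : (e <~ [:: m]) \o (m ~> c) = cid _.
(** Fixes the scale of [rho g] relative to [lam g]. Without it the middle action would be defined
    only up to a scalar for each [g]. *)
Hypothesis norm : forall g, e \o (m ~> lam g) = e \o (rho g <~ [:: m]).
Variable sc : cell S [:: m] [:: m] -> R.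
Hypothesis scE : forall f, f = sc f *: cid _.
Hypothesis id_neq0 : cid [:: m] != 0 :> cell S _ _.

Local Notation V := (cell S [:: m; m] [:: m]).
Local Notation D := (cell S [:: m] [:: m; m]).
Local Notation H := (cell S [:: m; m; m] [:: m]).

Definition Lact x g (P : cell S (m :: x) [:: m]) : cell S (m :: x) [:: m] :=
  lam g \o (G g ~> P) \o (lamV g <~ x).
Definition Ract2 g (f : V) : V := rho g \o (f <~ [:: G g]) \o (m ~> rhoV g).
Definition Ract3 g (P : H) : H := rho g \o (P <~ [:: G g]) \o (m ~> m ~> rhoV g).
Definition Mact g (f : V) : V := f \o (m ~> lam g) \o (rhoV g <~ [:: m]).
Definition Ldual g (x : D) : D := (lam g <~ [:: m]) \o (G g ~> x) \o lamV g.
Definition Rdual g (x : D) : D := (m ~> rho g) \o (x <~ [:: G g]) \o rhoV g.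
Definition Mdual g (x : D) : D := (m ~> lam g) \o (rhoV g <~ [:: m]) \o x.
Definition tree1 (f f1 : V) : H := f \o (f1 <~ [:: m]).
Definition tree2 (f f1 : V) : H := f \o (m ~> f1).
Definition cap1 (P : H) (x : D) : V := P \o (x <~ [:: m]).
Definition cap2 (P : H) (x : D) : V := P \o (m ~> x).
Definition pr (f : V) (x : D) : R := sc (f \o x).
Definition P0 : H := e <~ [:: m].
Definition Q0 : H := m ~> e.

(** Schur's lemma: two isomorphisms from the same word to [m] differ by a scalar, and their inverses
    by the inverse scalar. *)
Lemma iso_prop u (f f' : cell S u [:: m]) fV f'V :
  f \o fV = cid _ -> fV \o f = cid _ -> f' \o f'V = cid _ -> f'V \o f' = cid _ ->
  exists b, [/\ b != 0, f = b *: f' & fV = b^-1 *: f'V].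
Proof.
move=> fK fVK fK' fVK'; pose b := sc (f \o f'V); have E := scE (f \o f'V); rewrite -/b in E.
have fE : f = b *: f' by rewrite -[f]cf1 -fVK' cA E ccZl c1f.
have b0 : b != 0.
  apply/eqP => b0; move: id_neq0; rewrite -fK fE b0 scale0r cc0l.
  by rewrite eqxx.
exists b; split=> //.
rewrite -[fV]c1f -fVK' -cA; have -> : f' = b^-1 *: f by rewrite fE scalerA mulVf ?scale1r.
by rewrite ccZl ccZr fK cf1.
Qed.

(** The chosen [lam] and [kap] are compatible only up to a scalar, but [Lact] uses both [lam] and
    its inverse, so that scalar cancels and a genuine action results. *)
Lemma LactM x g h (P : cell S (m :: x) [:: m]) : Lact g (Lact h P) = Lact (g * h)%g P.
Proof.
have [||||b [b0 E EV]] := @iso_prop _ (lam g \o (G g ~> lam h)) (lam (g * h)%g \o (kap g h <~ [:: m]))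
  ((G g ~> lamV h) \o lamV g) ((kapV g h <~ [:: m]) \o lamV (g * h)%g).
- by rewrite cA (cch1 _ (lwK _ (lamVK h))); apply: lamVK.
- by rewrite cA (cch1 _ (lamK g)) (lwK _ (lamK h)).
- by rewrite cA (cch1 _ (rwK _ (kapVK g h))); apply: lamVK.
- by rewrite cA (cch1 _ (lamK _)) (rwK _ (kapK g h)).
rewrite /Lact !(lwM SL) !cA E !ccZl.
have := congr1 (rw x) EV; rewrite rwZ !(rwM SL) rw12 (rw_lw SL) => EVx.
rewrite -[X in b *: X]cA EVx !ccZr scalerA divff // scale1r !cA.
by rewrite (cch _ (xch21 _ _)) (cch1 _ (rwK _ (kapVK g h))).
Qed.

Lemma Lact1 x (P : cell S (m :: x) [:: m]) : Lact 1%g P = P.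
Proof.
have [||||b [b0 E EV]] := @iso_prop _ (lam 1%g) (ups <~ [:: m]) (lamV 1%g) (upsV <~ [:: m]) => //.
- exact: rwK upsVK.
- exact: rwK upsK.
have := congr1 (rw x) EV; rewrite rwZ rw01 => EVx.
rewrite /Lact EVx E !ccZl ccZr scalerA divff // scale1r.
by rewrite xch10 -cA (rwK _ upsVK) cf1.
Qed.

(** The scalar [b] measures the failure of left and right absorption on [m] to commute. *)
Lemma chi_ex g h : exists b, [/\ b != 0,
  lam g \o (G g ~> rho h) = b *: (rho h \o (lam g <~ [:: G h])) &
  (G g ~> rhoV h) \o lamV g = b^-1 *: ((lamV g <~ [:: G h]) \o rhoV h)].
Proof.
apply: iso_prop.
- by rewrite cA (cch1 _ (lwK _ (rhoVK h))); apply: lamVK.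
- by rewrite cA (cch1 _ (lamK g)) (lwK _ (rhoK h)).
- by rewrite cA (cch1 _ (rwK _ (lamVK g))); apply: rhoVK.
- by rewrite cA (cch1 _ (rhoK _)) (rwK _ (lamK g)).
Qed.

Lemma L_tree1 g f f1 : Lact g (tree1 f f1) = tree1 (Lact g f) (Lact g f1).
Proof.
rewrite /Lact /tree1 !(lwM SL) !(rwM SL) rw12 (rw_lw SL) !cA.
by rewrite (cch1 _ (rwK _ (lamK g))).
Qed.

Lemma L_tree2 g f f1 : Lact g (tree2 f f1) = tree2 (Lact g f) f1.
Proof. by rewrite /Lact /tree2 !(lwM SL) !cA (cch _ (xch12 _ _)). Qed.

Lemma cap2_L g P x : cap2 (Lact g P) x = Lact g (cap2 P x).
Proof. by rewrite /Lact /cap2 !(lwM SL) !cA (cch _ (xch12 _ _)). Qed.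

Lemma cap1_L g P x : cap1 (Lact g P) (Ldual g x) = Lact g (cap1 P x).
Proof.
rewrite /Lact /cap1 /Ldual !(lwM SL) !(rwM SL) rw21 (rw_lw SL) !cA.
by rewrite (cch1 _ (rwK _ (lamK g))).
Qed.

Lemma cap1_R h P x : cap1 (Ract3 h P) x = Ract2 h (cap1 P x).
Proof. by rewrite /Ract3 /Ract2 /cap1 !(rwM SL) rw12 -!cA xch12. Qed.

Lemma cap2_R h P x : cap2 (Ract3 h P) (Rdual h x) = Ract2 h (cap2 P x).
Proof.
rewrite /Ract3 /Ract2 /cap2 /Rdual !(rwM SL) !(lwM SL) (rw_lw SL) !cA.
by rewrite (cch1 _ (lwK _ (lwK _ (rhoK h)))).
Qed.

Lemma R_P0 g : Ract3 g P0 = P0.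
Proof. by rewrite /Ract3 /P0 rw20 -cA xch20 cA rhoVK c1f. Qed.

Lemma L_Q0 g : Lact g Q0 = Q0.
Proof. by rewrite /Lact /Q0 -cA -xch12 rw12_nil cA lamVK c1f. Qed.

Lemma normV g : e \o (m ~> lam g) \o (rhoV g <~ [:: m]) = e.
Proof. by rewrite norm (cch1 _ (rwK _ (rhoVK g))). Qed.

(** The [g] between the inputs of [f1] stands to the left of the left leg of [x]; pulling it through
    [x] produces [Ldual g x] and leaves it between the two outer strands. *)
Lemma cap2_M12 g f f1 x :
  cap2 (tree1 f (Mact g f1)) x = Mact g (cap2 (tree1 f f1) (Ldual g x)).
Proof.
rewrite /cap2 /tree1 /Mact /Ldual !(lwM SL) !(rwM SL) rw12 (rw_lw SL) !cA.
rewrite (cch1 _ (lwK _ (lamK g))).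
by rewrite -[LHS]cA xch12 cA.
Qed.

(** The [rho g] in [Ract2] cancels the [rhoV g] in [Mact], which leaves a [g] between the two legs
    of [x]. *)
Lemma cap2_M23 g f f1 x :
  cap2 (tree1 (Mact g f) (Ract2 g f1)) x = cap2 (tree1 f f1) (Mdual g x).
Proof.
rewrite /cap2 /tree1 /Mact /Ract2 /Mdual !(lwM SL) !(rwM SL) (rw_lw SL) !cA.
rewrite (cch1 _ (rwK _ (rhoK g))) rw21.
by rewrite -[f \o _ \o _]cA -xch21 cA.
Qed.

Lemma T_M g x : Mact g (cap2 P0 (Ldual g x)) = cap2 P0 x.
Proof.
rewrite /cap2 /P0 /Mact /Ldual !(lwM SL) !cA (cch1 _ (lwK _ (lamK g))).
rewrite -[LHS]cA -xch12 cA; congr (_ \o _).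
by have := congr1 (rw [:: m]) (normV g); rewrite !(rwM SL) rw12 (rw_lw SL).
Qed.

Lemma T_R g x : cap2 P0 (Rdual g x) = Ract2 g (cap2 P0 x).
Proof. by rewrite -{1}(R_P0 g) cap2_R. Qed.

Lemma T'_L g x : cap1 Q0 (Ldual g x) = Lact g (cap1 Q0 x).
Proof. by rewrite -{1}(L_Q0 g) cap1_L. Qed.

Lemma T'_M g x : cap1 Q0 (Rdual g x) = Mact g (cap1 Q0 x).
Proof.
rewrite /cap1 /Q0 /Mact /Rdual !(rwM SL) rw12 (rw_lw SL) !cA.
have := congr1 (lw m) (norm g); rewrite !(lwM SL) => <-.
by rewrite (cch _ (xch12 _ _)).
Qed.

Lemma sc_inj b b' : b *: cid [:: m] = b' *: cid [:: m] :> cell S _ _ -> b = b'.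
Proof.
move/eqP; rewrite -subr_eq0 -scalerBl scaler_eq0 (negPf id_neq0) orbF.
by rewrite subr_eq0 => /eqP.
Qed.

Lemma pr_linl b f f' x : pr (b *: f + f') x = b * pr f x + pr f' x.
Proof.
apply: sc_inj; rewrite /pr -scE scalerDl -scalerA -!scE.
exact: cc_linl.
Qed.
Lemma pr0l x : pr 0 x = 0.
Proof. by rewrite /pr cc0l; apply: sc_inj; rewrite -scE scale0r. Qed.
Lemma prZl b f x : pr (b *: f) x = b * pr f x.
Proof. by have := pr_linl b f 0 x; rewrite !addr0 pr0l addr0. Qed.
Lemma pr_linr b f x x' : pr f (b *: x + x') = b * pr f x + pr f x'.
Proof.
apply: sc_inj; rewrite /pr -scE scalerDl -scalerA -!scE.
exact: cc_linr.
Qed.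

Lemma pr_L g f x : pr (Lact g f) (Ldual g x) = pr f x.
Proof.
apply: sc_inj; rewrite /pr -!scE /Lact /Ldual !cA (cch1 _ (rwK _ (lamK g))).
by rewrite -(cA (lam g)) -(lwM SL) (scE (f \o x)) lwZ (lw1 SL) ccZr cf1 ccZl lamVK.
Qed.

Lemma pr_R g f x : pr (Ract2 g f) (Rdual g x) = pr f x.
Proof.
apply: sc_inj; rewrite /pr -!scE /Ract2 /Rdual !cA (cch1 _ (lwK _ (rhoK g))).
have := congr1 (rw [:: G g]) (scE (f \o x)); rewrite (rwM SL) rwZ (rw1 SL) => E.
by rewrite -(cA (rho g)) E ccZr cf1 ccZl rhoVK.
Qed.

Lemma pr_M g f x : pr (Mact g f) x = pr f (Mdual g x).
Proof. by rewrite /pr /Mact /Mdual !cA. Qed.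

(** Bending the leg back with [c] undoes the rotation, by the zig-zag. *)
Lemma T_inj x : cap2 P0 x = 0 -> x = 0.
Proof.
move=> T0; have := congr1 (fun f => (m ~> f) \o (c <~ [:: m])) T0.
rewrite lw0 cc0l /cap2 /P0 (lwM SL) -cA -xch02 cA.
have := congr1 (rw [:: m]) zig; rewrite (rwM SL) rw02 (rw_lw SL) (rw1 SL) => ->.
by rewrite c1f.
Qed.

Lemma T'_inj x : cap1 Q0 x = 0 -> x = 0.
Proof.
move=> T0; have := congr1 (fun f : V => (f <~ [:: m]) \o (m ~> c)) T0.
rewrite rw0 cc0l /cap1 /Q0 (rwM SL) rw12 -cA xch12 rw12_nil cA (rw_lw SL).
by have := congr1 (lw m) zag; rewrite (lwM SL) (lw1 SL) => ->; rewrite c1f.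
Qed.

Lemma LR_comm g h b : lam g \o (G g ~> rho h) = b *: (rho h \o (lam g <~ [:: G h])) ->
  forall f, Lact g (Ract2 h f) = b *: Ract2 h (Lact g f).
Proof.
move=> E f; rewrite /Lact /Ract2 !(lwM SL) !(rwM SL) (rw_lw SL) rw12 !cA E !ccZl.
by rewrite (cch _ (xch12 _ _)).
Qed.

Lemma LR_Q0 g h b : lam g \o (G g ~> rho h) = b *: (rho h \o (lam g <~ [:: G h])) ->
  Lact g (Ract3 h Q0) = b *: Ract3 h Q0.
Proof.
move=> E; rewrite -{2}(L_Q0 g).
rewrite /Lact /Ract3 !(lwM SL) !(rwM SL) (rw_lw SL) rw12 !cA E !ccZl.
by rewrite (cch _ (xch12 _ _)).
Qed.

Lemma LM_comm g h b : (G g ~> rhoV h) \o lamV g = b *: ((lamV g <~ [:: G h]) \o rhoV h) ->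
  forall f, Lact g (Mact h f) = b *: Mact h (Lact g f).
Proof.
move=> /(congr1 (rw [:: m])); rewrite rwZ !(rwM SL) rw12 (rw_lw SL) => E f.
rewrite /Lact /Mact !(lwM SL) !cA -[LHS]cA E ccZr !cA.
by rewrite (cch _ (xch12 _ _)).
Qed.

Lemma MR_comm g h b : lam g \o (G g ~> rho h) = b *: (rho h \o (lam g <~ [:: G h])) ->
  forall f, Mact g (Ract2 h f) = b *: Ract2 h (Mact g f).
Proof.
move=> E f.
have {}E : rhoV h \o lam g = b *: ((lam g <~ [:: G h]) \o (G g ~> rhoV h)).
  have E' : lam g = b *: (rho h \o ((lam g <~ [:: G h]) \o (G g ~> rhoV h))).
    by rewrite cA -ccZl -E -cA (lwK _ (rhoVK h)) cf1.
  by rewrite {1}E' ccZr cA rhoK c1f.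
rewrite /Mact /Ract2 !(rwM SL) (rw_lw SL) rw12 !cA -(cA _ (m ~> rhoV h)).
rewrite -(lwM SL) E lwZ (lwM SL) ccZr !cA.
by rewrite (cch _ (xch12 _ _)) !ccZl.
Qed.

Lemma Lact_lin x g b (P P' : cell S (m :: x) [:: m]) : Lact g (b *: P + P') = b *: Lact g P + Lact g P'.
Proof. by rewrite /Lact (lw_lin SL) (cc_linr SL) (cc_linl SL). Qed.
Lemma Ract2_lin g b f f' : Ract2 g (b *: f + f') = b *: Ract2 g f + Ract2 g f'.
Proof. by rewrite /Ract2 (rw_lin SL) (cc_linr SL) (cc_linl SL). Qed.
Lemma Mact_lin g b f f' : Mact g (b *: f + f') = b *: Mact g f + Mact g f'.
Proof. by rewrite /Mact !(cc_linl SL). Qed.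
Lemma cap1_linl x b P P' : cap1 (b *: P + P') x = b *: cap1 P x + cap1 P' x.
Proof. by rewrite /cap1 (cc_linl SL). Qed.
Lemma cap1_linr P b x x' : cap1 P (b *: x + x') = b *: cap1 P x + cap1 P x'.
Proof. by rewrite /cap1 (rw_lin SL) (cc_linr SL). Qed.
Lemma cap2_linl x b P P' : cap2 (b *: P + P') x = b *: cap2 P x + cap2 P' x.
Proof. by rewrite /cap2 (cc_linl SL). Qed.
Lemma cap2_linr P b x x' : cap2 P (b *: x + x') = b *: cap2 P x + cap2 P x'.
Proof. by rewrite /cap2 (lw_lin SL) (cc_linr SL). Qed.
Lemma tree1_linl f1 b f f' : tree1 (b *: f + f') f1 = b *: tree1 f f1 + tree1 f' f1.
Proof. by rewrite /tree1 (cc_linl SL). Qed.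
Lemma tree1_linr f b f1 f1' : tree1 f (b *: f1 + f1') = b *: tree1 f f1 + tree1 f f1'.
Proof. by rewrite /tree1 (rw_lin SL) (cc_linr SL). Qed.
Lemma tree2_linl f1 b f f' : tree2 (b *: f + f') f1 = b *: tree2 f f1 + tree2 f' f1.
Proof. by rewrite /tree2 (cc_linl SL). Qed.
Lemma tree2_linr f b f1 f1' : tree2 f (b *: f1 + f1') = b *: tree2 f f1 + tree2 f f1'.
Proof. by rewrite /tree2 (lw_lin SL) (cc_linr SL). Qed.

(** * The two tree bases of Hom(m m m, m) *)

Section Semisimple.
Variables (z : R) (v : 'I_k -> V) (d : 'I_k -> D).
Hypothesis ecE : e \o c = z *: cid _.
Hypothesis z0 : z != 0.
Hypothesis vdE : forall i j, v i \o d j = (i == j)%:R *: cid _.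
Hypothesis homGm : forall g (f : cell S [:: G g] [:: m]), f = 0.
Hypothesis hommG : forall g (f : cell S [:: m] [:: G g]), f = 0.
Hypothesis homGG : forall g h (f : cell S [:: G g] [:: G h]), g != h -> f = 0.
(** Quantified over [U] and [T] because two families are used: [u1], [s1] with [g] to the left of
    [e] and [c], and [u2], [s2] with [g] to the right. *)
Hypothesis complete : forall (U : forall g, cell S [:: m; m] [:: G g])
    (T : forall g, cell S [:: G g] [:: m; m]), (forall g, U g \o T g = z *: cid _) ->
  cid [:: m; m] = z^-1 *: (\sum_g (T g \o U g)) + \sum_i (d i \o v i).

Let u1 g := (G g ~> e) \o (lamV g <~ [:: m]).
Let s1 g := (lam g <~ [:: m]) \o (G g ~> c).
Let u2 g := (e <~ [:: G g]) \o (m ~> rhoV g).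
Let s2 g := (m ~> rho g) \o (c <~ [:: G g]).

Lemma us1 g : u1 g \o s1 g = z *: cid _.
Proof.
rewrite /u1 /s1 cA (cch1 _ (rwK _ (lamK g))) -(lwM SL) ecE lwZ (lw1 SL).
by [].
Qed.
Lemma us2 g : u2 g \o s2 g = z *: cid _.
Proof.
rewrite /u2 /s2 cA (cch1 _ (lwK _ (rhoK g))).
by have := congr1 (rw [:: G g]) ecE; rewrite (rwM SL) rwZ (rw1 SL).
Qed.

Lemma LP0 g : Lact g P0 = lam g \o (u1 g <~ [:: m]).
Proof. by rewrite /Lact /u1 /P0 (rwM SL) rw12 (rw_lw SL) cA. Qed.
Lemma RQ0 g : Ract3 g Q0 = rho g \o (m ~> u2 g).
Proof. by rewrite /Ract3 /u2 /Q0 (lwM SL) (rw_lw SL) cA. Qed.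

(** Decompose the identity of [m m], tensor with [m] on the right and compose with [P]. The
    invertible summands contribute multiples of [Lact g P0] because Hom(g m, m) is a line. *)
Lemma tree1_complete P : exists y : gT -> R,
  P = \sum_g y g *: Lact g P0 + \sum_i tree1 (cap1 P (d i)) (v i).
Proof.
exists (fun g => z^-1 * sc (P \o (s1 g <~ [:: m]) \o lamV g)).
rewrite -[LHS]cf1; have := congr1 (rw [:: m]) (complete us1).
rewrite (rw1 SL) rwD rwZ !rw_sum => ->.
rewrite ccDr ccZr !cc_sumr scaler_sumr; congr (_ + _); apply: eq_bigr => g _; last first.
  by rewrite (rwM SL) cA.
rewrite (rwM SL) cA -scalerA LP0 -(ccZl (sc _)); congr (_ *: (_ \o _)).
by rewrite -[LHS]cf1 -(lamK g) cA [X in X \o _]scE ccZl c1f.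
Qed.

Lemma tree2_complete P : exists y : gT -> R,
  P = \sum_g y g *: Ract3 g Q0 + \sum_i tree2 (cap2 P (d i)) (v i).
Proof.
exists (fun g => z^-1 * sc (P \o (m ~> s2 g) \o rhoV g)).
rewrite -[LHS]cf1; have := congr1 (lw m) (complete us2).
rewrite (lw1 SL) lwD lwZ !lw_sum => ->.
rewrite ccDr ccZr !cc_sumr scaler_sumr; congr (_ + _); apply: eq_bigr => g _; last first.
  by rewrite (lwM SL) cA.
rewrite (lwM SL) cA -scalerA RQ0 -(ccZl (sc _)); congr (_ *: (_ \o _)).
by rewrite -[LHS]cf1 -(rhoK g) cA [X in X \o _]scE ccZl c1f.
Qed.

Lemma lam_neq0 g : lam g != 0.
Proof.
apply/eqP => l0; move: id_neq0; rewrite -(lamVK g) l0 cc0l.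
by rewrite eqxx.
Qed.
Lemma rho_neq0 g : rho g != 0.
Proof.
apply/eqP => l0; move: id_neq0; rewrite -(rhoVK g) l0 cc0l.
by rewrite eqxx.
Qed.

(** Composing with [s1 h] isolates one coefficient, as distinct invertible simples admit no nonzero
    map. *)
Lemma LP0_indep (y : gT -> R) : \sum_g y g *: Lact g P0 = 0 -> forall g, y g = 0.
Proof.
move=> y0 h; have := congr1 (fun f : H => f \o (s1 h <~ [:: m])) y0.
rewrite cc0l cc_suml (bigD1 h) //= big1 ?addr0 => [|g gh].
  rewrite LP0 ccZl -cA (rwE _ (us1 h)) rwZ (rw1 SL) ccZr cf1 scalerA.
  by move/eqP; rewrite scaler_eq0 (negPf (lam_neq0 h)) orbF mulf_eq0 (negPf z0) orbF => /eqP.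
by rewrite LP0 ccZl -cA (rwE _ (homGG (u1 g \o s1 h) _)) 1?eq_sym // rw0 cc0r scaler0.
Qed.

Lemma RQ0_indep (y : gT -> R) : \sum_g y g *: Ract3 g Q0 = 0 -> forall g, y g = 0.
Proof.
move=> y0 h; have := congr1 (fun f : H => f \o (m ~> s2 h)) y0.
rewrite cc0l cc_suml (bigD1 h) //= big1 ?addr0 => [|g gh].
  rewrite RQ0 ccZl -cA -(lwM SL) us2 lwZ (lw1 SL) ccZr cf1 scalerA.
  by move/eqP; rewrite scaler_eq0 (negPf (rho_neq0 h)) orbF mulf_eq0 (negPf z0) orbF => /eqP.
by rewrite RQ0 ccZl -cA -(lwM SL) [_ \o s2 h]homGG 1?eq_sym // lw0 cc0r scaler0.
Qed.

Lemma cap2_RQ0 g x : cap2 (Ract3 g Q0) x = 0.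
Proof. by rewrite /cap2 RQ0 -cA -(lwM SL) [_ \o x]hommG lw0 cc0r. Qed.

Lemma cap1_tree1 f f1 x : cap1 (tree1 f f1) x = pr f1 x *: f.
Proof.
have := congr1 (rw [:: m]) (scE (f1 \o x)); rewrite (rwM SL) rwZ (rw1 SL) => E.
by rewrite /cap1 /tree1 -cA E ccZr cf1.
Qed.
Lemma cap2_tree2 f f1 x : cap2 (tree2 f f1) x = pr f1 x *: f.
Proof. by rewrite /cap2 /tree2 -cA -(lwM SL) (scE (f1 \o x)) lwZ (lw1 SL) ccZr cf1. Qed.

Lemma cidmm_V f : f = \sum_i pr f (d i) *: v i.
Proof.
rewrite -[LHS]cf1 (complete us1) ccDr ccZr cc_sumr big1 ?scaler0 ?add0r => [|g _]; last first.
  by rewrite cA [_ \o s1 g]homGm cc0l.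
by rewrite cc_sumr; apply: eq_bigr => i _; rewrite cA (scE (f \o d i)) ccZl c1f.
Qed.
Lemma cidmm_D x : x = \sum_i pr (v i) x *: d i.
Proof.
rewrite -[LHS]c1f (complete us1) ccDl ccZl cc_suml big1 ?scaler0 ?add0r => [|g _]; last first.
  by rewrite -cA [_ \o x]hommG cc0r.
by rewrite cc_suml; apply: eq_bigr => i _; rewrite -cA (scE (v i \o x)) ccZr cf1.
Qed.
Lemma pr_vd i j : pr (v i) (d j) = (i == j)%:R.
Proof. by apply: sc_inj; rewrite /pr -scE vdE. Qed.


Let mat (F : V -> V) : 'M[R]_k := \matrix_(i, j) pr (F (v i)) (d j).

Lemma mat_comp (F F' : V -> V) : linear F' -> mat (F' \o F)%FUN = mat F *m mat F'.
Proof.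
move=> lF; apply/matrixP => i j; rewrite !mxE /= {1}(cidmm_V (F (v i))).
have lin0 : F' 0 = 0 by have := lF (-1) 0 0; rewrite scaler0 addr0 scaleN1r addNr.
have -> : F' (\sum_l pr (F (v i)) (d l) *: v l) = \sum_l pr (F (v i)) (d l) *: F' (v l).
  elim/big_rec2: _ => // l f f' _ <-; exact: lF.
have -> : pr (\sum_l pr (F (v i)) (d l) *: F' (v l)) (d j) =
   \sum_l pr (F (v i)) (d l) * pr (F' (v l)) (d j).
  elim/big_rec2: _ => [|l b f _ <-]; [exact: pr0l | exact: pr_linl].
by apply: eq_bigr => l _; rewrite !mxE.
Qed.

(** The contragredient map [F'] supplies the inverse matrix. *)
Lemma mat_dual_unit (F : V -> V) (F' : D -> D) :
  (forall f x, pr (F f) (F' x) = pr f x) -> mat F \in unitmx.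
Proof.
move=> FF'; suff /mulmx1_unit[] : mat F *m (\matrix_(i, j) pr (v i) (F' (d j))) = 1%:M by [].
apply/matrixP => i j; rewrite !mxE -(pr_vd i j) -FF' [in RHS](cidmm_V (F (v i))).
have -> x : pr (\sum_l pr (F (v i)) (d l) *: v l) x = \sum_l pr (F (v i)) (d l) * pr (v l) x.
  elim/big_rec2: _ => [|l b f _ <-]; [exact: pr0l | exact: pr_linl].
by apply: eq_bigr => l _; rewrite !mxE.
Qed.

Hypothesis k_gt0 : (0 < k)%N.
Hypothesis cardG : #|gT| = k.+1.

(* The scalar of the bimodule [m] is killed by its [k]-th power (take determinants on [V])
   and by its [#|G|]-th power, and [#|G| = k + 1]. *)
Lemma chi1 g h b : b != 0 -> lam g \o (G g ~> rho h) = b *: (rho h \o (lam g <~ [:: G h])) -> b = 1.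
Proof.
move=> b0 E; have LR := LR_comm E.
have bk : b ^+ k = 1.
  have : mat (fun f => Lact g (Ract2 h f)) = mat (fun f => b *: Ract2 h (Lact g f)).
    by apply/matrixP => i j; rewrite !mxE LR.
  have -> : mat (fun f => Lact g (Ract2 h f)) = mat (Ract2 h) *m mat (Lact g).
    rewrite -mat_comp //; exact: Lact_lin.
  have -> : mat (fun f => b *: Ract2 h (Lact g f)) = b *: (mat (Lact g) *m mat (Ract2 h)).
    rewrite -mat_comp; last exact: Ract2_lin.
    by apply/matrixP => i j; rewrite !mxE /= prZl.
  move/(congr1 determinant); rewrite detZ !det_mulmx (mulrC (\det (mat (Lact g)))).
  set D1 := _ * _ => D1E; have D10 : D1 != 0.
    by rewrite mulf_neq0 // -unitfE -/(mat _ \in unitmx);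
     [apply: (mat_dual_unit (pr_R h)) | apply: (mat_dual_unit (pr_L g))].
  by apply: (mulIf D10); rewrite -D1E mul1r.
(* Iterate [LR] along the powers of [g]. At exponent [|G|] the left action is trivial, and [Ract2 h]
   does not kill a basis vector since the pairing is preserved. *)
have bn : b ^+ #|gT| = 1.
  have LRn n f : Lact (g ^+ n)%g (Ract2 h f) = b ^+ n *: Ract2 h (Lact (g ^+ n)%g f).
    elim: n f => [|n IH] f; first by rewrite expg0 !Lact1 scale1r.
    by rewrite expgSr -!LactM LR {1}/Lact lwZ ccZr ccZl -/(Lact _ _) IH scalerA -exprS.
  pose i0 := Ordinal k_gt0.
  have := LRn #|gT| (v i0); rewrite -cardsT expg_cardG ?inE // !Lact1 => E1.
  have := pr_R h (v i0) (d i0); rewrite E1 pr_vd eqxx.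
  by rewrite prZl pr_R pr_vd eqxx mulr1.
by move: bn; rewrite cardG exprS bk mulr1.
Qed.

Lemma comm_rel g h : lam g \o (G g ~> rho h) = rho h \o (lam g <~ [:: G h]) /\
  (G g ~> rhoV h) \o lamV g = (lamV g <~ [:: G h]) \o rhoV h.
Proof.
have [b [b0 E E']] := chi_ex g h.
by move: (E) E'; rewrite (chi1 b0 E) invr1 !scale1r.
Qed.

Definition calculus_fusion : fusion_data R gT k :=
  @FusionData R gT k V D H pr v d (fun g => Lact g) Mact Ract2 Ldual Mdual Rdual
    tree1 tree2 cap1 cap2 (fun g => Lact g) P0 Q0 (fun g => Ract3 g Q0).

Lemma calculus_fusion_laws : fusion_laws calculus_fusion.
Proof.
split=> /=.
- by move=> *; apply: pr_linl.
- by move=> *; apply: pr_linr.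
- exact: pr_vd.
- exact: cidmm_V.
- exact: cidmm_D.
- by move=> g b f f'; apply: Lact_lin.
- by move=> g b f f'; apply: Mact_lin.
- by move=> g b f f'; apply: Ract2_lin.
- by move=> f1 b f f'; apply: tree1_linl.
- by move=> f b f1 f1'; apply: tree1_linr.
- by move=> f1 b f f'; apply: tree2_linl.
- by move=> f b f1 f1'; apply: tree2_linr.
- by move=> x b P P'; apply: cap1_linl.
- by move=> P b x x'; apply: cap1_linr.
- by move=> x b P P'; apply: cap2_linl.
- by move=> P b x x'; apply: cap2_linr.
- by move=> g b P P'; apply: Lact_lin.
- exact: pr_L.
- exact: pr_R.
- exact: pr_M.
- by move=> f; apply: Lact1.
- by move=> g h f; apply: LactM.
- by move=> f; apply: Lact1.
- by move=> g h f; apply: LactM.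
- move=> g h f; rewrite -[RHS]scale1r; apply: LM_comm.
  by rewrite scale1r; case: (comm_rel g h).
- move=> g h f; rewrite -[RHS]scale1r; apply: MR_comm.
  by rewrite scale1r; case: (comm_rel g h).
- exact: L_tree1.
- exact: L_tree2.
- move=> g h; rewrite -[RHS]scale1r; apply: LR_Q0.
  by rewrite scale1r; case: (comm_rel g h).
- exact: cap1_tree1.
- exact: cap2_tree2.
- exact: cap2_RQ0.
- by move=> g x; apply: cap1_R.
- exact: cap1_L.
- exact: cap2_L.
- exact: tree1_complete.
- exact: tree2_complete.
- exact: LP0_indep.
- exact: RQ0_indep.
- exact: T_M.
- exact: T_R.
- exact: T'_L.
- exact: T'_M.
- exact: T_inj.
- exact: T'_inj.
- exact: cap2_M12.
- exact: cap2_M23.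
Qed.
End Semisimple.
End Data.
End Calculus.

(** * Extracting the calculus from a near-group category *)

Section Decomposition.
Variables (R : fieldType) (A : Type) (S : strict_data R A) (gT : finGroupType) (k : nat).
Variable s : option gT -> A.
Hypothesis NG : strict_near_group S k s.
Local Notation "f \o g" := (cc f g).
Local Notation "a ~> f" := (lw a f) (at level 35, right associativity).
Local Notation "f <~ x" := (rw x f) (at level 37, left associativity).
Local Notation m := (s None).
Local Notation G g := (s (Some g)).
Let SL := sng_laws NG.
Let cA := ccA SL.
Let c1f := cc1f SL.
Let cf1 := ccf1 SL.

Lemma scalar_fun (i : option gT) : exists sc : cell S [:: s i] [:: s i] -> R,
  forall f, f = sc f *: cid _.
Proof.
exists (fun f => coord [tuple (cid [:: s i] : cell S _ _)] ord0 f) => f.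
have [b fE] := sng_hom1 NG f.
have : f \in <<[tuple (cid [:: s i] : cell S _ _)]>>%VS.
  by rewrite span_seq1 fE memvZ // memv_line.
by move/coord_span => {1}->; rewrite big_ord1.
Qed.

Lemma iso_cancel u v (f : cell S u v) (g : cell S v u) w (h : cell S w v) :
  g \o f = cid _ -> f \o g = cid _ -> g \o h = 0 -> h = 0.
Proof. by move=> gf fg gh; rewrite -[h]c1f -fg -cA gh cc0r. Qed.

(** The type of [p] depends on its label, so changing the label produces a new pair; the idempotent
    [e p] is what stays the same. *)
Lemma summand_eq u o o' (p : cell S u [:: s o]) (e : cell S [:: s o] u) : o = o' ->
  p \o e = cid _ ->
  exists (p' : cell S u [:: s o']) (e' : cell S [:: s o'] u), e' \o p' = e \o p /\ p' \o e' = cid _.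
Proof. by move=> oo'; case: o' / oo' => pe; exists p, e. Qed.

Lemma scalar_unit (f : cell S [::] [::]) : exists b, f = b *: cid _.
Proof.
have [ups [upsV [upsVK upsK]]] := sng_unit NG.
have [b E] := sng_hom1 NG (upsV \o f \o ups); exists b.
rewrite -[f]c1f -upsVK -[f]cf1 -[in X in _ \o (f \o X)]upsVK.
by rewrite -!cA (cA upsV) (cA _ ups) E (ccZl SL) (ccZr SL) c1f.
Qed.

(** The unit occurs exactly once in [m m], and its endomorphisms are scalars, so both Hom-spaces are
    lines spanned by a split pair. *)
Lemma unit_line : exists (p0 : cell S [:: m; m] [::]) (e0 : cell S [::] [:: m; m]),
  [/\ p0 \o e0 = cid _, forall F : cell S [:: m; m] [::], exists b, F = b *: p0 &
    forall F : cell S [::] [:: m; m], exists b, F = b *: e0].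
Proof.
have [ups [upsV [upsVK upsK]]] := sng_unit NG.
have [n [y [yG _ [p [e [pe1 pe0 pes]]]]]] := sng_dsum NG.
have [j0 j0E] : exists j0, forall j, (y j == Some 1%g) = (j == j0).
  have /eqP/cards1P[j0 E] : #|[set j | y j == Some 1%g]| = 1%N.
    by rewrite cardsE; apply: yG.
  by exists j0 => j; have := congr1 (fun B : {set 'I_n} => j \in B) E; rewrite !inE.
have yj0 : y j0 = Some 1%g by apply/eqP; rewrite j0E.
have [p1 [e1 [ep1 pe11]]] := summand_eq yj0 (pe1 j0).
exists (ups \o p1), (e1 \o upsV); split.
- by rewrite -cA (cA p1) pe11 c1f.
- move=> F; have [b E] := scalar_unit (F \o (e1 \o upsV)); exists b.
  rewrite -[LHS]cf1 -pes (cc_sumr SL) (bigD1 j0) //= big1 ?addr0 => [|j jj]; last first.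
    rewrite cA; suff -> : F \o e j = 0 by rewrite cc0l.
    by apply: (iso_cancel upsK upsVK); apply: (sng_hom0 NG); rewrite j0E.
  have Ep : p1 = upsV \o (ups \o p1) by rewrite cA upsK c1f.
  by rewrite -ep1 {1}Ep (cA e1) (cA F) E (ccZl SL) c1f.
- move=> F; have [b E] := scalar_unit (ups \o p1 \o F); exists b.
  rewrite -[LHS]c1f -pes (cc_suml SL) (bigD1 j0) //= big1 ?addr0 => [|j jj]; last first.
    rewrite -cA; suff -> : p j \o F = 0 by rewrite cc0r.
    rewrite -[p j \o F]cf1 -upsVK cA.
    suff -> : p j \o F \o ups = 0 by rewrite cc0l.
    by apply: (sng_hom0 NG); rewrite eq_sym j0E.
  have Ee : e1 = e1 \o upsV \o ups by rewrite -cA upsK cf1.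
  by rewrite -ep1 {1}Ee -!cA (cA ups) E !(ccZr SL) cf1.
Qed.

Lemma cell0_mG g (f : cell S [:: m] [:: G g]) : f = 0.
Proof. exact: (sng_hom0 NG). Qed.
Lemma cell0_Gm g (f : cell S [:: G g] [:: m]) : f = 0.
Proof. exact: (sng_hom0 NG). Qed.
Lemma cell0_m (f : cell S [:: m] [::]) : f = 0.
Proof.
have [ups [upsV [upsVK upsK]]] := sng_unit NG.
by apply: (iso_cancel upsK upsVK); apply: cell0_mG.
Qed.

(* [m] is self-dual: the only simple mapping nontrivially to its dual [b] is [m],
   because [Hom(x, b) = Hom(x (x) m, 1)]. *)
Lemma self_dual : exists (e : cell S [:: m; m] [::]) (c : cell S [::] [:: m; m]),
  (m ~> e) \o (c <~ [:: m]) = cid _ /\ (e <~ [:: m]) \o (m ~> c) = cid _.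
Proof.
have [b [ev [co [zig zag [n [y [p [e [pe1 pe0 pes]]]]]]]]] := sng_dual NG.
have inj a (f : cell S [:: a] [:: b]) : ev \o (f <~ [:: m]) = 0 -> f = 0.
  move=> f0; have := congr1 (fun F : cell S [:: a; m] [::] => (F <~ [:: b]) \o (a ~> co)) f0.
  rewrite (rw0 SL) (cc0l SL) (rwM SL) (rw11 SL) -cA (xch11 SL) (rw11_nil SL) cA zag c1f.
  by [].
have [p0 [e0 [pe p0E _]]] := unit_line.
have id0 := sng_id0 NG.
have yN j : y j = None.
  case E : (y j) => [g|] //; have [p' [e' [_ pe']]] := summand_eq E (pe1 j).
  have [lam [lamV [lamVK lamK]]] := sng_lact NG g.
  have : e' = 0.
    apply: inj; rewrite -[LHS]cf1 -lamK cA [X in X \o _](_ : _ = 0) ?cc0l //.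
    exact: cell0_m.
  by move=> e'0; have := id0 (Some g); rewrite -pe' e'0 (cc0r SL) eqxx.
have e_neq0 j : e j != 0.
  by apply: contra (id0 (y j)) => /eqP E; rewrite -(pe1 j) E (cc0r SL).
(* With no summand [co] would vanish; two copies of [m] would give two independent maps in the line
   Hom(m m, 1). *)
have n1 : n = 1%N.
  case: n y p e pe1 pe0 pes yN e_neq0 => [|[|n]] y p e pe1 pe0 pes yN e_neq0 //.
    have co0 : co = 0.
      by rewrite -[co]c1f -(lw1 SL) -pes big_ord0 (lw0 SL) (cc0l SL).
    by have := id0 None; rewrite -zig co0 (rw0 SL) (cc0r SL) eqxx.
  have [p1 [e1 [ep1 pe1']]] := summand_eq (yN ord0) (pe1 ord0).
  have [p2 [e2 [ep2 pe2']]] := summand_eq (yN ord_max) (pe1 ord_max).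
  have p1e2 : p1 \o e2 = 0.
    have -> : p1 \o e2 = p1 \o ((e1 \o p1) \o (e2 \o p2)) \o e2.
      by rewrite !cA pe1' c1f -!cA pe2' cf1.
    by rewrite ep1 ep2 -(cA (e ord0)) (cA (p ord0)) pe0 // (cc0l SL) !(cc0r SL) (cc0l SL).
  have [b1 E1] := p0E (ev \o (e1 <~ [:: m])).
  have [b2 E2] := p0E (ev \o (e2 <~ [:: m])).
  have b10 : b1 != 0.
    apply/eqP => b10; move: E1; rewrite b10 scale0r => /inj e10.
    by have := id0 None; rewrite -pe1' e10 (cc0r SL) eqxx.
  have e21 : e2 = (b2 / b1) *: e1.
    apply/eqP; rewrite -subr_eq0; apply/eqP/inj.
    rewrite (rwD SL) -scaleNr (rwZ SL) (ccDr SL) (ccZr SL) E1 E2 scalerA mulNr divfK //.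
    by rewrite scaleNr subrr.
  have : e2 = 0.
    move: p1e2; rewrite e21 (ccZr SL) pe1' => /eqP; rewrite scaler_eq0 (negPf (id0 None)) orbF.
    by move=> /eqP->; rewrite scale0r.
  by move=> e20; have := id0 None; rewrite -pe2' e20 (cc0r SL) eqxx.
subst n.
have [psV [ps [psE psK]]] := summand_eq (yN ord0) (pe1 ord0).
have psVK : ps \o psV = cid _ by rewrite psE -pes big_ord1.
exists (ev \o (ps <~ [:: m])), ((m ~> psV) \o co); split.
  rewrite (lwM SL) (rwM SL) (rw_lw SL) cA.
  have E := rwE SL [:: m] psVK; rewrite (rw1 SL) in E.
  by rewrite (cch1 SL _ (lwK SL _ E)).
rewrite (rwM SL) (rw11 SL) -cA (xch11 SL) (rw11_nil SL) (lwM SL) !cA.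
by rewrite (xch20 SL) -(cA psV) zag cf1.
Qed.

(** Each invertible simple occurs once in [m m], so any [U g], [T g] with nonzero composite [z]
    recover its idempotent: [T g U g] is a multiple of it, and composing with [T g] shows the factor
    to be [z]. *)
Lemma summand_complete n (y : 'I_n -> option gT)
    (p : forall j, cell S [:: m; m] [:: s (y j)]) (e : forall j, cell S [:: s (y j)] [:: m; m]) :
  (forall g, #|[pred j | y j == Some g]| = 1%N) -> #|[pred j | y j == None]| = k ->
  (forall j, p j \o e j = cid (s := S) [:: s (y j)]) ->
  (forall i j, i != j -> p i \o e j = 0) ->
  \sum_j (e j \o p j) = cid (s := S) [:: m; m] ->
  exists (v : 'I_k -> cell S [:: m; m] [:: m]) (d : 'I_k -> cell S [:: m] [:: m; m]),
  (forall i j, v i \o d j = (i == j)%:R *: cid (s := S) [:: m]) /\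
  forall z, z != 0 -> forall (U : forall g, cell S [:: m; m] [:: G g])
    (T : forall g, cell S [:: G g] [:: m; m]), (forall g, U g \o T g = z *: cid _) ->
  cid [:: m; m] = z^-1 *: (\sum_g (T g \o U g)) + \sum_i (d i \o v i).
Proof.
move=> yG yk pe1 pe0 pes.
have pick_v (i : 'I_#|[pred j | y j == None]|) :
    exists (v : cell S [:: m; m] [:: m]) (d : cell S [:: m] [:: m; m]),
    d \o v = e (enum_val i) \o p (enum_val i) /\ v \o d = cid _.
  have /eqP yi : y (enum_val i) == None by apply: (enum_valP i).
  exact: (summand_eq yi (pe1 _)).
move: pick_v; rewrite -yk => {yk} /fin_all_exists [v /fin_all_exists [d vd]].
exists v, d; split=> [i j|z z0 U T UT].
  case: eqP => [<-|/eqP ij]; first by rewrite scale1r; case: (vd i).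
  rewrite scale0r; have -> : v i \o d j = v i \o ((d i \o v i) \o (d j \o v j)) \o d j.
    have [_ Ei] := vd i; have [_ Ej] := vd j.
    by rewrite !cA Ei c1f -!cA Ej cf1.
  have [-> _] := vd i; have [-> _] := vd j.
  rewrite -(cA (e _)) (cA (p _) (e _)) pe0; first by rewrite (cc0l SL) !(cc0r SL) (cc0l SL).
  by apply: contra ij => /eqP/enum_val_inj->.
have [jg jgP] : exists jg : gT -> 'I_n, forall g j, (y j == Some g) = (j == jg g).
  apply: (@fin_all_exists _ _ (fun g jg => forall j, (y j == Some g) = (j == jg))) => g.
  have /eqP/cards1P[j0 E] : #|[set j | y j == Some g]| = 1%N.
    by rewrite cardsE; apply: yG.
  by exists j0 => j; have := congr1 (fun B : {set 'I_n} => j \in B) E; rewrite !inE.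
have UE g j : j != jg g -> U g \o e j = 0.
  by move=> jj; apply: (sng_hom0 NG); rewrite jgP.
have ET g j : j != jg g -> p j \o T g = 0.
  by move=> jj; apply: (sng_hom0 NG); rewrite eq_sym jgP.
have TU g : T g \o U g = z *: (e (jg g) \o p (jg g)).
  have Up : U g = U g \o (e (jg g) \o p (jg g)).
    rewrite -[LHS]cf1 -pes (cc_sumr SL) (bigD1 (jg g)) //= big1 ?addr0 // => j jj.
    by rewrite cA UE // cc0l.
  have Tp : T g = (e (jg g) \o p (jg g)) \o T g.
    rewrite -[LHS]c1f -pes (cc_suml SL) (bigD1 (jg g)) //= big1 ?addr0 // => j jj.
    by rewrite -cA ET // cc0r.
  have [b E] := sng_hom1 NG (p (jg g) \o T g \o (U g \o e (jg g))).
  have TUE : T g \o U g = b *: (e (jg g) \o p (jg g)).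
    have -> : b *: (e (jg g) \o p (jg g)) = e (jg g) \o (b *: cid _) \o p (jg g).
      by rewrite (ccZr SL) cf1 (ccZl SL).
    by rewrite -E {1}Tp {1}Up !cA.
  have := congr1 (fun F => F \o T g) TUE.
  rewrite -cA UT (ccZr SL) cf1 (ccZl SL) -Tp => /eqP.
  rewrite -subr_eq0 -scalerBl scaler_eq0 subr_eq0 => /orP[/eqP->//|/eqP T0].
  have /eqP := UT g; rewrite T0 (cc0r SL) eq_sym scaler_eq0 (negPf z0).
  by rewrite (negPf (sng_id0 NG (Some g))).
rewrite -pes (eq_bigr _ (fun g _ => TU g)) -scaler_sumr scalerA mulVf // scale1r.
rewrite (bigID (fun j => y j == None)) /= addrC; congr (_ + _); last first.
  rewrite (big_enum_val (fun j => e j \o p j)) /=; apply: eq_bigr => i _.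
  by have [] := vd i.
have yjg g : y (jg g) = Some g by apply/eqP; rewrite jgP.
rewrite (reindex jg) /=.
  by apply: eq_bigl => g; rewrite yjg.
exists (fun j => odflt 1%g (y j)) => [g _|j]; first by rewrite yjg.
rewrite inE; case E : (y j) => [g|] // _ /=.
by apply/esym/eqP; rewrite -jgP E.
Qed.

Theorem near_group_fusion : (0 < k)%N -> #|gT| = k.+1 ->
  exists F : fusion_data R gT k, fusion_laws F.
Proof.
move=> k0 cardG.
have [lam /fin_all_exists [lamV lamP]] := fin_all_exists (sng_lact NG).
have [rho /fin_all_exists [rhoV rhoP]] := fin_all_exists (sng_ract NG).
have [kap /fin_all_exists [kapV kapP]] :=
  fin_all_exists (fun g => let: ex_intro f h := fin_all_exists (sng_mul NG g) in
     ex_intro _ f (fin_all_exists h)).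
have [ups [upsV [upsVK upsK]]] := sng_unit NG.
have [e [c [zig zag]]] := self_dual.
have [p0 [e0 [pe p0E e0E]]] := unit_line.
have [sc scE] := scalar_fun None.
have id0 := sng_id0 NG None.
(* Both [e] and [c] are nonzero multiples of a split pair, so the loop [e c] has the nonzero value
   [be * bc]. *)
have [be eE] := p0E e; have [bc cE] := e0E c.
have e_neq0 : e != 0.
  by apply/eqP => E; move: id0; rewrite -zig E (lw0 SL) (cc0l SL) eqxx.
have c_neq0 : c != 0.
  by apply/eqP => E; move: id0; rewrite -zig E (rw0 SL) (cc0r SL) eqxx.
have be0 : be != 0 by apply: contra e_neq0 => /eqP E; rewrite eE E scale0r.
have bc0 : bc != 0 by apply: contra c_neq0 => /eqP E; rewrite cE E scale0r.
have ecE : e \o c = (be * bc) *: cid _.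
  by rewrite eE cE (ccZl SL) (ccZr SL) pe scalerA.
(* Hom(m g m, 1) is a line as well; [t g] is the ratio of two nonzero elements of it, and rescaling
   [rho g] by [t g] achieves the normalization. *)
have /fin_all_exists [t tP] g : exists t, t != 0 /\ e \o (m ~> lam g) = e \o ((t *: rho g) <~ [:: m]).
  have [b E] := p0E (e \o (m ~> lam g) \o (rhoV g <~ [:: m])).
  have E' : e \o (m ~> lam g) = (b / be) *: (e \o (rho g <~ [:: m])).
    rewrite {2}eE (ccZl SL) scalerA divfK // -(ccZl SL) -E.
    by rewrite (cch1 SL _ (rwK SL _ (proj2 (rhoP g)))).
  exists (b / be); split; last by rewrite (rwZ SL) (ccZr SL).
  apply: contra e_neq0 => /eqP b0; rewrite b0 scale0r in E'.
  rewrite -[e]cf1 -(lw1 SL) -(proj1 (lamP g)) (lwM SL) cA E' (cc0l SL).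
  by [].
have [n [y [yG yk [p [ep [pe1 pe0 pes]]]]]] := sng_dsum NG.
have [v [d [vd comp]]] := summand_complete yG yk pe1 pe0 pes.
exists (calculus_fusion lam lamV (fun g => t g *: rho g) (fun g => (t g)^-1 *: rhoV g) e sc v d).
have z0 : be * bc != 0 by rewrite mulf_neq0.
refine (@calculus_fusion_laws R A S SL gT (fun g => G g) m k lam lamV _ _ kap kapV e c
  _ _ _ _ _ _ ups upsV upsK upsVK zig zag _ sc scE id0 (be * bc) v d ecE z0 vd _ _ _ _ k0 cardG).
- by move=> g; case: (lamP g).
- by move=> g; case: (lamP g).
- move=> g; case: (rhoP g) (tP g) => _ rhoK [tg0 _].
  by rewrite (ccZl SL) (ccZr SL) scalerA mulVf // scale1r.
- move=> g; case: (rhoP g) (tP g) => rhoVK _ [tg0 _].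
  by rewrite (ccZl SL) (ccZr SL) scalerA divff // scale1r.
- by move=> g h; case: (kapP g h).
- by move=> g h; case: (kapP g h).
- by move=> g; case: (tP g).
- by move=> g f; apply: cell0_Gm.
- by move=> g f; apply: cell0_mG.
- by move=> g h f gh; apply: (sng_hom0 NG).
- exact: comp.
Qed.
End Decomposition.

(** * Absence of invariants *)

Section LinearHelpers.
Variables (R : fieldType).
Implicit Types (U V : vectType R).

Definition lin_of U V (f : U -> V) (lf : linear f) : 'Hom(U, V) :=
  linfun (HB.pack f (GRing.isLinear.Build R U V *:%R f lf) : {linear U -> V}).

Lemma lin_ofE U V (f : U -> V) (lf : linear f) x : lin_of lf x = f x.
Proof. by rewrite lfunE. Qed.

Lemma lin_sum U V (f : U -> V) (I : finType) (a : I -> R) (x : I -> U) : linear f ->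
  f (\sum_i a i *: x i) = \sum_i a i *: f (x i).
Proof.
move=> lf; rewrite -(lin_ofE lf) linear_sum; apply: eq_bigr => i _.
by rewrite linearZ /= lin_ofE.
Qed.

Lemma lin_sum1 U V (f : U -> V) (I : finType) (x : I -> U) : linear f ->
  f (\sum_i x i) = \sum_i f (x i).
Proof.
move=> lf; have := lin_sum (fun=> 1) x lf.
by under eq_bigr do rewrite scale1r; under [in RHS]eq_bigr do rewrite scale1r.
Qed.

Lemma lin0 U V (f : U -> V) : linear f -> f 0 = 0.
Proof. by move=> lf; rewrite -(lin_ofE lf) linear0. Qed.
Lemma linD U V (f : U -> V) x y : linear f -> f (x + y) = f x + f y.
Proof. by move=> lf; rewrite -!(lin_ofE lf) linearD. Qed.
Lemma linZ U V (f : U -> V) a x : linear f -> f (a *: x) = a *: f x.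
Proof. by move=> lf; rewrite -!(lin_ofE lf) linearZ. Qed.

Lemma dim_ffun (I : finType) U : \dim {: {ffun I -> U}} = (#|I| * dim U)%N.
Proof. exact: dimvf. Qed.

End LinearHelpers.

Section Equivariant.
Variables (R : fieldType) (gT : finGroupType).

(** Row convention: [g] sends the basis vector [i] to the sum of the [x g i j] times the vector [j],
    whence the order of [h] and [g] in the product. *)
Definition is_rep (I : finType) (x : gT -> I -> I -> R) :=
  (forall i j, x 1%g i j = (i == j)%:R) /\
  (forall g h i l, x (g * h)%g i l = \sum_j x h i j * x g j l).

Variables (U : vectType R) (T : gT -> 'End(U)).

Definition eqv_def (I : finType) (x : gT -> I -> I -> R) g (A : {ffun I -> U}) : {ffun I -> U} :=
  [ffun i => \sum_j x g i j *: A j - T g (A i)].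

Lemma eqv_def_lin (I : finType) x g : linear (@eqv_def I x g).
Proof.
move=> a A B; apply/ffunP => i; rewrite !ffunE scalerBr scaler_sumr linearP /= opprD addrACA.
congr (_ + _); rewrite -big_split; apply: eq_bigr => j _ /=.
by rewrite !ffunE scalerDr !scalerA mulrC.
Qed.

(* [eqv x] is the space of equivariant maps to [U] from the representation with basis [I] and
   matrices [x], given by their values on the basis. *)
Definition eqv (I : finType) (x : gT -> I -> I -> R) : {vspace {ffun I -> U}} :=
  (\bigcap_g lker (lin_of (@eqv_def_lin I x g)))%VS.

Lemma eqvP (I : finType) x (A : {ffun I -> U}) :
  reflect (forall g i, \sum_j x g i j *: A j = T g (A i)) (A \in eqv x).
Proof.
apply: (iffP idP) => [|E].
  rewrite memvE => /subv_bigcapP E g i; have := E g isT.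
  rewrite -memvE memv_ker lin_ofE => /eqP/ffunP/(_ i).
  by rewrite !ffunE => /eqP; rewrite subr_eq0 => /eqP.
rewrite memvE; apply/subv_bigcapP => g _; rewrite -memvE memv_ker lin_ofE.
by apply/eqP/ffunP => i; rewrite !ffunE E subrr.
Qed.
End Equivariant.

(** * Multiplicities in tensor powers of D *)

Section Fusion.
Variables (R : fieldType) (gT : finGroupType) (k : nat) (F : fusion_data R gT k).
Hypothesis FL : fusion_laws F.
Local Notation V := (fV F).
Local Notation D := (fD F).
Local Notation H := (fH F).
Local Notation v := (bV F).
Local Notation d := (bD F).

Lemma pair0l (x : D) : pair (0 : V) x = 0.
Proof. by have := pair_linl FL x (-1) 0 0; rewrite scaler0 addr0 mulN1r addNr. Qed.
Lemma pair0r (f : V) : pair f (0 : D) = 0.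
Proof. by have := pair_linr FL f (-1) 0 0; rewrite scaler0 addr0 mulN1r addNr. Qed.
Lemma pairZl a (f : V) (x : D) : pair (a *: f) x = a * pair f x.
Proof. by have := pair_linl FL x a f 0; rewrite !addr0 pair0l addr0. Qed.
Lemma pairZr a (f : V) (x : D) : pair f (a *: x) = a * pair f x.
Proof. by have := pair_linr FL f a x 0; rewrite !addr0 pair0r addr0. Qed.
Lemma pair_suml (I : finType) (a : I -> R) (f : I -> V) (x : D) :
  pair (\sum_i a i *: f i) x = \sum_i a i * pair (f i) x.
Proof. by elim/big_rec2: _ => [|i b c _ <-]; [apply: pair0l | apply: pair_linl]. Qed.
Lemma pair_sumr (I : finType) (a : I -> R) (f : V) (x : I -> D) :
  pair f (\sum_i a i *: x i) = \sum_i a i * pair f (x i).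
Proof. by elim/big_rec2: _ => [|i b c _ <-]; [apply: pair0r | apply: pair_linr]. Qed.

Lemma pair_extl (f f' : V) : (forall i, pair f (d i) = pair f' (d i)) -> f = f'.
Proof. by move=> E; rewrite (bVE FL f) (bVE FL f'); apply: eq_bigr => i _; rewrite E. Qed.
Lemma pair_extr (x x' : D) : (forall f, pair f x = pair f x') -> x = x'.
Proof. by move=> E; rewrite (bDE FL x) (bDE FL x'); apply: eq_bigr => i _; rewrite E. Qed.

Lemma aLK g : cancel (@aL _ _ _ F g^-1%g) (aL g).
Proof. by move=> f; rewrite (aLM FL) mulgV (aL1 FL). Qed.

Lemma pair_dL g (f : V) x : pair f (dL g x) = pair (aL g^-1%g f) x.
Proof. by rewrite -{1}(aLK g f) (pair_L FL). Qed.

Lemma dL_lin g : linear (@dL _ _ _ F g).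
Proof.
move=> a x y; apply: pair_extr => f; rewrite pair_dL !(pair_linr FL) !pair_dL.
by [].
Qed.

Lemma dL1 (x : D) : dL 1%g x = x.
Proof. by apply: pair_extr => f; rewrite pair_dL invg1 (aL1 FL). Qed.
Lemma dLM g h (x : D) : dL g (dL h x) = dL (g * h)%g x.
Proof. by apply: pair_extr => f; rewrite !pair_dL (aLM FL) invMg. Qed.

Let N g a b := pair (v b) (dL g (d a)).

Lemma dL_basis g a : dL g (d a) = \sum_b N g a b *: d b.
Proof. exact: (bDE FL). Qed.

Let LE g : 'End(V) := lin_of (aL_lin FL g).
Let HE g : 'End(H) := lin_of (hL_lin FL g).
Let E0 I x := eqv (U := (R^o : vectType R)) (fun _ : gT => \1%VF) (I := I) x.
Let E1 I x := eqv LE (I := I) x.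
Let EH I x := eqv HE (I := I) x.

(** The tensor product of a representation with [D] under the left dual action, whose matrix is
    [N]. *)
Definition tens_rep (I : finType) (x : gT -> I -> I -> R) g (ia jb : I * 'I_k) :=
  x g ia.1 jb.1 * N g ia.2 jb.2.

Lemma tens_rep_rep I x : @is_rep R gT I x -> is_rep (tens_rep x).
Proof.
move=> [x1 xM]; split=> [[i a] [j b]|g h [i a] [l c]]; rewrite /tens_rep /=.
  rewrite x1 /N dL1 (pair_basis FL) eq_sym xpair_eqE (eq_sym b) [j == i]eq_sym.
  by case: (i == j); case: (a == b); rewrite ?mulr1 ?mulr0.
rewrite xM {1}/N -dLM dL_basis (lin_sum _ _ (dL_lin g)) pair_sumr.
rewrite big_distrlr /= (pair_bigA _ (fun i0 b => x h i i0 * x g i0 l * (N h a b * pair (v c) (dL g (d b))))).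
by apply: eq_bigr => -[i0 b] _ /=; rewrite mulrACA.
Qed.

Lemma sum_tens (U : vectType R) (I : finType) (x : gT -> I -> I -> R) g i a (B : I * 'I_k -> U) :
  \sum_jb tens_rep x g (i, a) jb *: B jb =
  \sum_b N g a b *: (\sum_j x g i j *: B (j, b)).
Proof.
transitivity (\sum_j \sum_b tens_rep x g (i, a) (j, b) *: B (j, b)).
  by rewrite pair_bigA; apply: eq_bigr => -[].
rewrite exchange_big; apply: eq_bigr => b _; rewrite scaler_sumr; apply: eq_bigr => j _.
by rewrite scalerA mulrC.
Qed.

(** Pairing with [D] embeds Hom_G(X, V) into Hom_G(X (x) D, 1). *)
Lemma dim_E1_tens (I : finType) (x : gT -> I -> I -> R) : is_rep x ->
  (\dim (E1 x) <= \dim (E0 (tens_rep x)))%N.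
Proof.
move=> xrep.
pose th (B : {ffun I -> V}) : {ffun I * 'I_k -> R^o} := [ffun ia => pair (B ia.1) (d ia.2)].
have thl : linear th.
  by move=> a A B; apply/ffunP => -[i b]; rewrite !ffunE (pair_linl FL).
rewrite -(limg_dim_eq (f := lin_of thl) (U := E1 x)); last first.
  apply/eqP; rewrite -subv0; apply/subvP => B; rewrite memv_cap memv_ker memv0 lin_ofE.
  case/andP => _ /eqP/ffunP E; apply/eqP/ffunP => i; rewrite ffunE; apply: pair_extl => a.
  by have := E (i, a); rewrite !ffunE /= pair0l.
apply/dimvS/subvP => _ /memv_imgP[B /eqvP BE ->]; apply/eqvP => g [i a].
rewrite lin_ofE !lfunE /= ffunE /= -(pair_L FL g).
have := BE g i; rewrite lin_ofE => <-; rewrite dL_basis pair_sumr.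
rewrite sum_tens; apply: eq_bigr => b _; congr (_ * _).
by rewrite pair_suml; apply: eq_bigr => j _; rewrite ffunE.
Qed.

(** Along the second tree the left action touches only the outer factor: it fixes each [qQ h], and
    each [v j] contributes a copy of [V]. *)
Lemma dim_EH_lower (I : finType) (x : gT -> I -> I -> R) :
  (#|gT| * \dim (E0 x) + k * \dim (E1 x) <= \dim (EH x))%N.
Proof.
pose J h (y : {ffun I -> R^o}) : {ffun I -> H} := [ffun i => y i *: qQ F h].
have Jl h : linear (J h).
  by move=> a A B; apply/ffunP => i; rewrite !ffunE scalerDl scalerA.
pose K j (B : {ffun I -> V}) : {ffun I -> H} := [ffun i => t2 (B i) (v j)].
have Kl j : linear (K j).
  by move=> a A B; apply/ffunP => i; rewrite !ffunE (t2_linl FL).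
pose W (s : gT + 'I_k) := match s with
  | inl h => (lin_of (Jl h) @: E0 x)%VS | inr j => (lin_of (Kl j) @: E1 x)%VS end.
have sum0 (y : gT -> {ffun I -> R^o}) (B : 'I_k -> {ffun I -> V}) :
    \sum_h J h (y h) + \sum_j K j (B j) = 0 -> (forall h, y h = 0) /\ (forall j, B j = 0).
  move=> /ffunP E; have {}E i : \sum_h y h i *: qQ F h + \sum_j t2 (B j i) (v j) = 0.
    have := E i; rewrite !ffunE !sum_ffunE => E'; rewrite -[RHS]E'; congr (_ + _); apply: eq_bigr => h _.
      by rewrite ffunE.
    by rewrite ffunE.
  have B0 j i : B j i = 0.
    have := congr1 (fun P => c2 P (d j)) (E i).
    rewrite (lin0 (c2_linl FL _)) (linD _ _ (c2_linl FL _)) (lin_sum _ _ (c2_linl FL _)) big1 ?add0r; last first.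
      by move=> h _; rewrite (c2_qQ FL) scaler0.
    rewrite (lin_sum1 _ (c2_linl FL _)).
    rewrite (bigD1 j) //= big1 ?addr0 => [|l lj].
      by rewrite (c2_t2 FL) (pair_basis FL) eqxx scale1r.
    by rewrite (c2_t2 FL) (pair_basis FL) (negPf lj) scale0r.
  split=> [h|j]; apply/ffunP => i; rewrite [RHS]ffunE; last exact: B0.
  have := E i; rewrite [X in _ + X]big1 ?addr0 => [|j _].
    by move/(qQ_free FL).
  by rewrite B0 (lin0 (t2_linl FL _)).
have dW : directv (\sum_s W s).
  apply/directv_sum_independent => us Us us0.
  have /fin_all_exists [y yE] h : exists y, us (inl h) = J h y.
    by have /memv_imgP[y _ ->] := Us (inl h) isT; exists y; rewrite lin_ofE.
  have /fin_all_exists [B BE] j : exists B, us (inr j) = K j B.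
    by have /memv_imgP[B _ ->] := Us (inr j) isT; exists B; rewrite lin_ofE.
  have [y0 B0] : (forall h, y h = 0) /\ (forall j, B j = 0).
    apply: sum0; rewrite -[RHS]us0 big_sumType /=.
    by congr (_ + _); apply: eq_bigr => i _; rewrite ?yE ?BE.
  by case=> [h|j] _; rewrite ?yE ?BE ?y0 ?B0 ?(lin0 (Jl _)) ?(lin0 (Kl _)).
have subW : (\sum_s W s <= EH x)%VS.
  apply/subv_sumP => -[h|j] _; apply/subvP => _ /memv_imgP[y /eqvP yE ->]; apply/eqvP => g i.
    rewrite !lin_ofE !ffunE (linZ _ _ (hL_lin FL g)) (hL_qQ FL).
    have := yE g i; rewrite lfunE /= => <-; rewrite scaler_suml.
    by apply: eq_bigr => j _; rewrite ffunE scalerA.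
  rewrite !lin_ofE !ffunE (hL_t2 FL).
  have := yE g i; rewrite lin_ofE => <-; rewrite (lin_sum _ _ (t2_linl FL _)).
  by apply: eq_bigr => l _; rewrite ffunE.
apply: leq_trans (dimvS subW); rewrite (directvP dW) /= big_sumType /=.
have dJ h : \dim (lin_of (Jl h) @: E0 x) = \dim (E0 x).
  apply: limg_dim_eq; apply/eqP; rewrite -subv0; apply/subvP => y.
  rewrite memv_cap memv_ker memv0 lin_ofE => /andP[_ /eqP J0].
  have [y0 _] : (forall l, (if l == h then y else 0) = 0) /\ (forall j : 'I_k, (0 : {ffun I -> V}) = 0).
    apply: sum0; rewrite [X in _ + X]big1 ?addr0 => [|j _]; last exact: (lin0 (Kl j)).
    rewrite (bigD1 h) //= eqxx J0 add0r big1 // => l lh.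
    by rewrite (negPf lh) (lin0 (Jl l)).
  by have := y0 h; rewrite eqxx => /eqP.
have dK j : \dim (lin_of (Kl j) @: E1 x) = \dim (E1 x).
  apply: limg_dim_eq; apply/eqP; rewrite -subv0; apply/subvP => B.
  rewrite memv_cap memv_ker memv0 lin_ofE => /andP[_ /eqP K0].
  have [_ B0] : (forall l : gT, (0 : {ffun I -> R^o}) = 0) /\ (forall l, (if l == j then B else 0) = 0).
    apply: (sum0 (fun=> 0)); rewrite big1 ?add0r => [|h _]; last exact: (lin0 (Jl h)).
    rewrite (bigD1 j) //= eqxx K0 add0r big1 // => l lj.
    by rewrite (negPf lj) (lin0 (Kl l)).
  by have := B0 j; rewrite eqxx => /eqP.
rewrite (eq_bigr _ (fun h _ => dJ h)) (eq_bigr _ (fun j _ => dK j)) !sum_nat_const card_ord.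
by [].
Qed.

(** Along the first tree [c1] maps Hom_G(X, H) to Hom_G(X (x) D, V). The kernel takes values in the
    regular representation spanned by the translates of [pP], which allows at most dim X maps. *)
Lemma dim_EH_upper (I : finType) (x : gT -> I -> I -> R) : is_rep x ->
  (\dim (EH x) <= \dim (E1 (tens_rep x)) + #|I|)%N.
Proof.
move=> xrep.
pose Ps (A : {ffun I -> H}) : {ffun I * 'I_k -> V} := [ffun ia => c1 (A ia.1) (d ia.2)].
have Pl : linear Ps.
  by move=> a A B; apply/ffunP => -[i b]; rewrite !ffunE (c1_linl FL).
pose X := [tuple hL (enum_val i) (pP F) | i < #|gT|].
have Xfree : free X.
  apply/freeP => z z0 i; have := hLP_free FL (y := fun g => z (enum_rank g)).
  move/(_ _ (enum_val i)); rewrite enum_valK; apply.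
  rewrite (reindex (@enum_val _ gT)) /=; last by exists enum_rank => j _; rewrite ?enum_valK ?enum_rankK.
  rewrite -[RHS]z0; apply: eq_bigr => j _.
  by rewrite (nth_map j) ?size_enum_ord // nth_ord_enum enum_valK.
(* The coordinate at the identity determines an equivariant map into the regular representation. *)
pose zeta (P : H) : R^o := coord X (enum_rank 1%g) P.
have zetal : linear zeta by move=> a P P'; rewrite /zeta linearP.
have zetaP (y : gT -> R) : zeta (\sum_g y g *: hL g (pP F)) = y 1%g.
  rewrite /zeta (reindex (@enum_val _ gT)) /=; last by exists enum_rank => j _; rewrite ?enum_valK ?enum_rankK.
  rewrite (eq_bigr (fun i => y (enum_val i) *: X`_i)) => [|j _].
    by rewrite coord_sum_free // enum_rankK.
  by rewrite (nth_map j) ?size_enum_ord // nth_ord_enum.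
pose Z (A : {ffun I -> H}) : {ffun I -> R^o} := [ffun i => zeta (A i)].
have Zl : linear Z.
  by move=> a A B; apply/ffunP => i; rewrite !ffunE zetal.
rewrite -(limg_ker_dim (lin_of Pl) (EH x)) addnC; apply: leq_add.
  apply/dimvS/subvP => _ /memv_imgP[A /eqvP AE ->]; apply/eqvP => g [i a].
  rewrite !lin_ofE ffunE /= -(c1_hL FL).
  have := AE g i; rewrite lin_ofE => <-; rewrite dL_basis (lin_sum _ _ (c1_linr FL _)).
  rewrite sum_tens; apply: eq_bigr => b _; congr (_ *: _).
  by rewrite (lin_sum _ _ (c1_linl FL _)); apply: eq_bigr => j _; rewrite ffunE.
rewrite -(limg_dim_eq (f := lin_of Zl)); last first.
  apply/eqP; rewrite -subv0; apply/subvP => A.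
  rewrite memv_cap memv_cap !memv_ker memv0 !lin_ofE -andbA => /and3P[/eqvP AE /eqP/ffunP P0 /eqP/ffunP Z0].
  have /fin_all_exists [y yE] i : exists y : gT -> R, A i = \sum_g y g *: hL g (pP F).
    have [y E] := tree1_span FL (A i); exists y; rewrite {1}E [X in _ + X]big1 ?addr0 // => a _.
    by have := P0 (i, a); rewrite !ffunE /= => ->; rewrite (lin0 (t1_linl FL _)).
  have y1 i : y i 1%g = 0 by have := Z0 i; rewrite !ffunE yE zetaP.
  have yh h i : y i h = 0.
    have := congr1 zeta (AE h^-1%g i); rewrite lin_ofE (lin_sum _ _ zetal) big1 => [|j _]; last first.
      by rewrite yE zetaP y1 scaler0.
    rewrite yE (lin_sum _ _ (hL_lin FL _)).
    under eq_bigr do rewrite (hLM FL).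
    rewrite (reindex_inj (mulgI h)) /=.
    under eq_bigr do rewrite mulKg.
    by rewrite (zetaP (fun g => y i (h * g)%g)) mulg1.
  by apply/eqP/ffunP => i; rewrite ffunE yE big1 // => g _; rewrite yh scale0r.
apply: leq_trans (dimvS (subvf _)) _.
by rewrite dim_ffun /dim /= muln1.
Qed.

(* A nonzero invariant forces [dim Hom_G(D^j, 1) + dim Hom_G(D^j, V)] to grow at least like
   [(k + 1)^j], whereas [dim D^j = k^j]. The recursion compares the two tree bases of [H]. *)
Lemma aL_invariant0 (f : V) : (0 < k)%N -> #|gT| = k.+1 -> (forall g, aL g f = f) -> f = 0.
Proof.
move=> k0 cardG fL; apply/eqP; apply/negPn/negP => fn0.
(* The representation is the [j]-th tensor power of [D]; for [j = 0] the two units of dimension come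
   from the constant 1 and from [f]. *)
have grow j : exists (I : finType) (x : gT -> I -> I -> R),
  [/\ is_rep x, #|I| = (k ^ j)%N & (k ^ j + k.+1 ^ j <= \dim (E0 x) + \dim (E1 x))%N].
  elim: j => [|j [I [x [xrep cardI dimI]]]].
    exists 'I_1, (fun _ i j => 1); split.
    - by split=> [i j|g h i l]; rewrite ?ord1 ?eqxx // big_ord1 mulr1.
    - by rewrite card_ord.
    rewrite expn0; apply: leq_add; rewrite lt0n dimv_eq0.
      apply/negP => /eqP E; have /eqvP : ([ffun=> 1] : {ffun 'I_1 -> R^o}) \notin E0 (fun _ _ _ => 1).
        by rewrite E memv0; apply/eqP => /ffunP/(_ ord0)/eqP; rewrite !ffunE oner_eq0.
      by apply=> g i; rewrite big_ord1 scale1r !ffunE lfunE.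
    apply/negP => /eqP E; have /eqvP : ([ffun=> f] : {ffun 'I_1 -> V}) \notin E1 (fun _ _ _ => 1).
      by rewrite E memv0; apply/eqP => /ffunP/(_ ord0)/eqP; rewrite !ffunE (negPf fn0).
    by apply=> g i; rewrite big_ord1 scale1r !ffunE lin_ofE fL.
  exists (I * 'I_k)%type, (tens_rep x); split.
  - exact: tens_rep_rep.
  - by rewrite card_prod cardI card_ord expnSr.
  have h1 := dim_E1_tens xrep; have h2 := dim_EH_upper xrep; have h3 := dim_EH_lower x.
  rewrite cardI in h2; rewrite cardG in h3.
  (* Adding the bounds gives [f0 + f1 >= (k + 1)(e0 + e1) - a], with [a = k^j] the dimension of the
     current representation and [b = (k + 1)^j]. *)
  have arith a b e0 e1 eH f0 f1 : (e1 <= f0 -> eH <= f1 + a -> k.+1 * e0 + k * e1 <= eH ->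
      a + b <= e0 + e1 -> k * a + k.+1 * b <= f0 + f1)%N.
    move=> l1 l2 l3 l4; have := leq_mul (leqnn k.+1) l4; nia.
  by rewrite !expnS; apply: arith h1 h2 h3 dimI.
(* At [j = k^2] the trivial upper bounds leave [(k + 1)^j <= k * k^j], while Bernoulli's inequality
   gives [(k + 1)^j >= (k + 1) * k^j]. *)
have [I [x [xrep cardI dimI]]] := grow (k * k)%N.
have E0x : (\dim (E0 x) <= k ^ (k * k))%N.
  by apply: leq_trans (dimvS (subvf _)) _; rewrite dim_ffun cardI /dim /= muln1.
have E1x : (\dim (E1 x) <= k ^ (k * k) * k)%N.
  apply: leq_trans (dim_E1_tens xrep) _; apply: leq_trans (dimvS (subvf _)) _.
  by rewrite dim_ffun card_prod cardI card_ord /dim /= muln1.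
have bern j : (k * k ^ j + j * k ^ j <= k * k.+1 ^ j)%N.
  elim: j => [|j IH]; first by rewrite !expn0 mul0n addn0.
  rewrite !expnS; move: (k ^ j)%N (k.+1 ^ j)%N IH => a b IH.
  have := leq_mul (leqnn k.+1) IH; nia.
have := bern (k * k)%N; have : (0 < k ^ (k * k))%N by rewrite expn_gt0 k0.
move: (k ^ (k * k))%N (k.+1 ^ (k * k))%N (\dim (E0 x)) (\dim (E1 x)) dimI E0x E1x => a b e0 e1 l1 l2 l3 a0 l4.
have {l1 l2 l3} l5 : (b <= a * k)%N by lia.
have := leq_mul (leqnn k) l5; nia.
Qed.

End Fusion.

(** * Commutativity of the group *)

Section Centralizer.
Variables (R : fieldType) (gT : finGroupType) (k : nat) (F : fusion_data R gT k).
Hypothesis FL : fusion_laws F.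
Hypothesis k_gt0 : (0 < k)%N.
Hypothesis cardG : #|gT| = k.+1.
Local Notation V := (fV F).
Local Notation D := (fD F).
Local Notation H := (fH F).
Local Notation v := (bV F).
Local Notation d := (bD F).
Local Notation T := (c2 (pP F)).
Local Notation T' := (c1 (pQ F)).

Lemma inj_surj (f : D -> V) : linear f -> (forall x, f x = 0 -> x = 0) -> forall y, exists x, f x = y.
Proof.
move=> lf f0 y; pose A : 'M[R]_k := \matrix_(i, j) pair (f (d i)) (d j).
have fA (r : 'rV_k) : f (\sum_i r 0 i *: d i) = \sum_j (r *m A) 0 j *: v j.
  rewrite (lin_sum _ _ lf); under eq_bigr do rewrite [f _](bVE FL) scaler_sumr.
  rewrite exchange_big; apply: eq_bigr => j _; rewrite mxE scaler_suml.
  by apply: eq_bigr => i _; rewrite scalerA !mxE.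
have coordD (r : 'rV_k) : \sum_i r 0 i *: d i = 0 -> r = 0.
  move=> r0; apply/rowP => j; have := congr1 (pair (v j)) r0.
  rewrite (pair0r FL) (pair_sumr FL) (bigD1 j) //= (pair_basis FL) eqxx mulr1 big1 ?addr0 ?mxE //.
  by move=> i ij; rewrite (pair_basis FL) eq_sym (negPf ij) mulr0.
have Au : A \in unitmx.
  rewrite -row_free_unit -kermx_eq0; apply/rowV0P => r /sub_kermxP rA.
  by apply/coordD/f0; rewrite fA rA big1 // => j _; rewrite mxE scale0r.
exists (\sum_i ((\row_j pair y (d j)) *m invmx A) 0 i *: d i).
rewrite fA mulmxKV // [RHS](bVE FL); apply: eq_bigr => j _.
by rewrite mxE.
Qed.

Lemma T_surj y : exists x, T x = y.
Proof. exact: (inj_surj (c2_linr FL _) (c2_P_inj FL)). Qed.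
Lemma T'_surj y : exists x, T' x = y.
Proof. exact: (inj_surj (c1_linr FL _) (c1_Q_inj FL)). Qed.

(** The canonical tensor of dual bases does not depend on the basis. *)
Lemma dual_bases (B : D -> V -> H) (v' : 'I_k -> V) (d' : 'I_k -> D) :
  (forall x, linear (B x)) -> (forall f, linear (fun x => B x f)) ->
  (forall f, f = \sum_i pair f (d' i) *: v' i) ->
  \sum_i B (d' i) (v' i) = \sum_i B (d i) (v i).
Proof.
move=> Br Bl v'E; under [RHS]eq_bigr => i _ do rewrite {1}(v'E (v i)) (lin_sum _ _ (Br _)).
rewrite exchange_big; apply: eq_bigr => l _ /=.
by rewrite {1}(bDE FL (d' l)) (lin_sum _ _ (Bl _)).
Qed.

(* The component of [pQ] along the first tree, twisted by [X], is invariant under the left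
   action; as [V] has no invariants it lies in the span of the [qQ h]. *)
Lemma centralizer_span (X : V -> V) : linear X -> (forall g f, X (aL g f) = aL g (X f)) ->
  exists y : gT -> R, forall f, X f = \sum_h y h *: aR h f.
Proof.
move=> Xl XL; pose Q' : H := \sum_j t1 (X (T' (d j))) (v j).
have Q'L g : hL g Q' = Q'.
  rewrite (lin_sum1 _ (hL_lin FL g)); under eq_bigr do rewrite (hL_t1 FL) -XL -(c1_Q_L FL).
  apply: (dual_bases (B := fun x f => t1 (X (T' x)) f) (v' := fun i => aL g (v i)) (d' := fun i => dL g (d i))).
  - by move=> x; apply: (t1_linr FL).
  - by move=> f b x x'; rewrite (c1_linr FL) Xl (t1_linl FL).
  - move=> f; rewrite -{1}(aLK FL g f) {1}(bVE FL (aL _ f)) (lin_sum _ _ (aL_lin FL g)).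
    by apply: eq_bigr => i _; rewrite -(pair_dL FL).
have c2Q' x : c2 Q' x = 0.
  by apply: (aL_invariant0 FL k_gt0 cardG) => g; rewrite -(c2_hL FL) Q'L.
have c1Q' x : c1 Q' x = X (T' x).
  rewrite (lin_sum1 _ (c1_linl FL x)); under eq_bigr do rewrite (c1_t1 FL).
  by rewrite {2}(bDE FL x) (lin_sum _ _ (c1_linr FL _)) (lin_sum _ _ Xl).
have [y Q'E] := tree2_span FL Q'; exists y => f; have [x <-] := T'_surj f.
rewrite -c1Q' Q'E [X in _ + X]big1 ?addr0 => [|i _].
  by rewrite (lin_sum _ _ (c1_linl FL _)); apply: eq_bigr => h _; rewrite (c1_qQ FL).
by rewrite c2Q' (lin0 (t2_linl FL _)).
Qed.

(** By [centralizer_span], [aM g] is a combination of right translations, and these commute with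
    [aM h]. *)
Lemma aM_comm g h (f : V) : aM g (aM h f) = aM h (aM g f).
Proof.
have [|y yE] := centralizer_span (aM_lin FL g); first by move=> g' f'; rewrite (aLM_comm FL).
rewrite !yE (lin_sum _ _ (aM_lin FL h)); apply: eq_bigr => l _.
by rewrite (aMR_comm FL).
Qed.

Lemma aM_T g x : aM g (T (dL g x)) = T x.
Proof. exact: (c2_P_M FL). Qed.

Lemma aM_inj g (f : V) : aM g f = 0 -> f = 0.
Proof.
have [x <-] := T_surj f; have -> : x = dL g (dL g^-1%g x) by rewrite (dLM FL) mulgV (dL1 FL).
by rewrite aM_T => /(c2_P_inj FL)->; rewrite (lin0 (dL_lin FL _)) (lin0 (c2_linr FL _)).
Qed.

Lemma aM_surj g (f : V) : exists f', aM g f' = f.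
Proof. by have [x <-] := T_surj f; exists (T (dL g x)); rewrite aM_T. Qed.

Lemma aM_cancel g (f f' : V) : aM g f = aM g f' -> f = f'.
Proof.
move=> E; apply/eqP; rewrite -subr_eq0; apply/eqP/(@aM_inj g).
by rewrite -scaleN1r addrC (aM_lin FL) E scaleN1r addNr.
Qed.

Lemma c2_P_cancel x y : T x = T y -> x = y.
Proof.
move=> E; apply/eqP; rewrite -subr_eq0; apply/eqP/(c2_P_inj FL).
by rewrite -scaleN1r addrC (c2_linr FL) E scaleN1r addNr.
Qed.

Lemma c1_Q_cancel x y : T' x = T' y -> x = y.
Proof.
move=> E; apply/eqP; rewrite -subr_eq0; apply/eqP/(c1_Q_inj FL).
by rewrite -scaleN1r addrC (c1_linr FL) E scaleN1r addNr.
Qed.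

(** The injective rotation [T] carries [dL g] to the inverse of [aM g]. *)
Lemma dL_comm g h (x : D) : dL g (dL h x) = dL h (dL g x).
Proof.
apply: c2_P_cancel; apply: (@aM_cancel g); apply: (@aM_cancel h).
by rewrite aM_T aM_T aM_comm aM_T aM_T.
Qed.

(** If [g] acts trivially on [V], the second tree shows that it fixes [pP], against the independence
    of the translates of [pP]. *)
Lemma aL_faithful g : (forall f : V, aL g f = f) -> g = 1%g.
Proof.
move=> gf; have [y E] := tree2_span FL (pP F).
have hP : hL g (pP F) = pP F.
  rewrite [pP F]E (linD _ _ (hL_lin FL g)) (lin_sum _ _ (hL_lin FL g)) (lin_sum1 _ (hL_lin FL g)).
  by congr (_ + _); apply: eq_bigr => h _; rewrite ?(hL_qQ FL) // (hL_t2 FL) gf.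
apply/eqP/negPn/negP => g1.
have free := hLP_free FL (y := fun h => (h == g)%:R - (h == 1%g)%:R).
suff /free/(_ g)/eqP : \sum_h ((h == g)%:R - (h == 1%g)%:R) *: hL h (pP F) = 0.
  by rewrite eqxx (negPf g1) subr0 oner_eq0.
under eq_bigr do rewrite scalerBl.
rewrite sumrB (bigD1 g) //= eqxx scale1r big1 ?addr0 => [|h hg]; last by rewrite (negPf hg) scale0r.
rewrite (bigD1 1%g) //= eqxx scale1r big1 ?addr0 => [|h hg]; last by rewrite (negPf hg) scale0r.
by rewrite hP (hL1 FL) subrr.
Qed.

Lemma aL_comm g h (f : V) : aL g (aL h f) = aL h (aL g f).
Proof.
apply: (pair_extl FL) => i.
by rewrite -[g]invgK -[h]invgK -!(pair_dL FL) dL_comm.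
Qed.

Lemma gT_abelian (g h : gT) : (g * h = h * g)%g.
Proof.
apply/eqP; rewrite eq_mulVg1; apply/eqP; apply: aL_faithful => f.
by rewrite -(aLM FL) -(aLM FL h) (aL_comm h g) (aLM FL g) (aLM FL) mulVg (aL1 FL).
Qed.

(** The other rotation [T'] carries [dR g] to [aM g]. *)
Lemma dR_comm g h (x : D) : dR g (dR h x) = dR h (dR g x).
Proof. by apply: c1_Q_cancel; rewrite !(c1_Q_M FL) aM_comm. Qed.

Lemma dR_surj g (x : D) : exists y, dR g y = x.
Proof.
have [f E] := aM_surj g (T' x); have [y Ey] := T'_surj f.
by exists y; apply: c1_Q_cancel; rewrite (c1_Q_M FL) Ey.
Qed.

Lemma aR_comm g h (f : V) : aR g (aR h f) = aR h (aR g f).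
Proof.
apply: (pair_extl FL) => i; have [y <-] := dR_surj g (d i); have [x <-] := dR_surj h y.
by rewrite (pair_R FL) (pair_R FL) dR_comm (pair_R FL) (pair_R FL).
Qed.
End Centralizer.

(** Each matrix is killed by [X^n - 1] with [n = |G|], which is split and separable because [n] is
    nonzero in [R]; commuting diagonalizable matrices are diagonalized together. *)
Lemma commuting_rep_diag (R : closedFieldType) (gT : finGroupType) k (X : gT -> 'M[R]_k.+1) :
  #|gT|%:R != 0 :> R -> X 1%g = 1%:M ->
  (forall g h, X g *m X h = X (g * h)%g) -> (forall g h, X g *m X h = X h *m X g) ->
  exists2 U, U \in unitmx & forall g i j, i != j -> (U *m X g *m invmx U) i j = 0.
Proof.
move=> n0 X1 XM Xc.
have /codiagonalizableP [U Uu /allP UX] :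
    {in codom X &, forall f g, comm_mx f g} /\ (forall f, f \in codom X -> diagonalizable f).
  split=> [_ _ /codomP[g ->] /codomP[h ->]|_ /codomP[g ->]]; first exact: Xc.
  have [r rE] := closed_field_poly_normal ('X^#|gT| - 1 : {poly R}).
  have monX : 'X^#|gT| - 1 \is @monic R.
    by rewrite -polyC1 monicXnsubC // -cardsT cardG_gt0.
  rewrite (monicP monX) scale1r in rE.
  apply/diagonalizableP; exists r; first by rewrite -separable_prod_XsubC -rE separable_Xn_sub_1.
  rewrite -rE; apply: mxminpoly_min.
  rewrite rmorphB rmorphXn /= horner_mx_X rmorph1.
  have Xn i : X g ^+ i = X (g ^+ i)%g.
    by elim: i => [|i IH]; rewrite ?expr0 ?expg0 ?X1 // exprS IH expgS -XM.
  by rewrite Xn -cardsT expg_cardG ?inE // X1 subrr.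
exists U => // g i j ij; have := UX (X g) (codom_f X g).
by move=> /similar_diagP -> //.
Qed.

Section Eigenbasis.
Variables (R : closedFieldType) (gT : finGroupType) (k : nat).
Hypothesis cardG : #|gT| = k.+1.
Hypothesis n0 : #|gT|%:R != 0 :> R.

(** The bases are replaced inside the record, so the later argument can assume eigenvectors. The two
    spanning laws transfer by [dual_bases]. *)
Lemma eigenbasis (F : fusion_data R gT k) : fusion_laws F -> (0 < k)%N ->
  exists F' : fusion_data R gT k, fusion_laws F' /\
    exists a : 'I_k -> gT -> R, forall g i, aL g (bV F' i) = a i g *: bV F' i.
Proof.
case: k cardG F => // k' cardG' F FL k0.
pose X g : 'M[R]_k'.+1 := \matrix_(i, j) pair (aL g (bV F i)) (bD F j).
have XE g i : aL g (bV F i) = \sum_j X g i j *: bV F j.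
  by rewrite {1}(bVE FL (aL g _)); apply: eq_bigr => j _; rewrite mxE.
(* Matrices acting on rows multiply in the reverse order; commutativity of [gT] restores it. *)
have XM g h : X g *m X h = X (g * h)%g.
  rewrite (gT_abelian FL k0 cardG' g h); apply/matrixP => i j; rewrite !mxE -(aLM FL) XE.
  rewrite (lin_sum _ _ (aL_lin FL h)) (pair_suml FL).
  by apply: eq_bigr => l _; rewrite !mxE.
have [|||U Uu UX] := @commuting_rep_diag R gT k' X n0.
- by apply/matrixP => i j; rewrite !mxE (aL1 FL) (pair_basis FL).
- exact: XM.
- by move=> g h; rewrite !XM (gT_abelian FL k0 cardG').
pose w i := \sum_j U i j *: bV F j.
pose ws i := \sum_j invmx U j i *: bD F j.
have wE f : f = \sum_i pair f (ws i) *: w i.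
  under eq_bigr do rewrite scaler_sumr.
  rewrite exchange_big {1}(bVE FL f); apply: eq_bigr => j _ /=.
  under eq_bigr do rewrite scalerA (pair_sumr FL) mulr_suml.
  rewrite -scaler_suml exchange_big /=; congr (_ *: _).
  transitivity (\sum_l (invmx U *m U) l j * pair f (bD F l)).
    rewrite mulVmx // (bigD1 j) //= mxE eqxx mul1r big1 ?addr0 // => l lj.
    by rewrite mxE (negPf lj) mul0r.
  apply: eq_bigr => l _; rewrite mxE mulr_suml; apply: eq_bigr => i _.
  by rewrite mulrAC.
have wsE x : x = \sum_i pair (w i) x *: ws i.
  apply: (pair_extr FL) => f; rewrite {1}(wE f) (pair_suml FL) (pair_sumr FL).
  by apply: eq_bigr => i _; rewrite mulrC.
have wws i j : pair (w i) (ws j) = (i == j)%:R.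
  rewrite (pair_suml FL); under eq_bigr do rewrite (pair_sumr FL).
  transitivity ((U *m invmx U) i j); last by rewrite mulmxV // mxE.
  rewrite mxE; apply: eq_bigr => l _; congr (_ * _); rewrite (bigD1 l) //=.
  rewrite (pair_basis FL) eqxx mulr1 big1 ?addr0 // => l' ll.
  by rewrite (pair_basis FL) eq_sym (negPf ll) mulr0.
pose F' := @FusionData R gT k'.+1 (fV F) (fD F) (fH F) (@pair _ _ _ F) w ws (@aL _ _ _ F)
  (@aM _ _ _ F) (@aR _ _ _ F) (@dL _ _ _ F) (@dM _ _ _ F) (@dR _ _ _ F) (@t1 _ _ _ F)
  (@t2 _ _ _ F) (@c1 _ _ _ F) (@c2 _ _ _ F) (@hL _ _ _ F) (pP F) (pQ F) (qQ F).
exists F'; split.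
  case: (FL) => *; split=> //.
  - by move=> P; have [y E] := tree1_span FL P; exists y; rewrite {1}E; congr (_ + _);
    apply/esym/(dual_bases FL (B := fun x f => t1 (c1 P x) f) (v' := w) (d' := ws)) => // *;
    [apply: (t1_linr FL) | move=> b x y'; rewrite (c1_linr FL) (t1_linl FL)].
  - by move=> P; have [y E] := tree2_span FL P; exists y; rewrite {1}E; congr (_ + _);
    apply/esym/(dual_bases FL (B := fun x f => t2 (c2 P x) f) (v' := w) (d' := ws)) => // *;
    [apply: (t2_linr FL) | move=> b x y'; rewrite (c2_linr FL) (t2_linl FL)].
exists (fun i g => (U *m X g *m invmx U) i i) => g i /=.
have UXw : \sum_j (U *m X g) i j *: bV F j = aL g (w i).
  rewrite /w (lin_sum _ _ (aL_lin FL g)); under [RHS]eq_bigr do rewrite XE scaler_sumr.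
  rewrite exchange_big; apply: eq_bigr => j _ /=; rewrite mxE scaler_suml.
  by apply: eq_bigr => l _; rewrite scalerA.
rewrite -UXw /w scaler_sumr; apply: eq_bigr => j _.
rewrite -{1}(mulmxKV Uu (U *m X g)) mxE (bigD1 i) //= big1 ?addr0 ?scalerA // => l li.
by rewrite UX 1?eq_sym // mul0r.
Qed.
End Eigenbasis.

(** * Weights *)

Section Weights.
Variables (R : fieldType) (gT : finGroupType) (k : nat) (F : fusion_data R gT k).
Hypothesis FL : fusion_laws F.
Hypothesis k_gt0 : (0 < k)%N.
Hypothesis cardG : #|gT| = k.+1.
Local Notation V := (fV F).
Local Notation D := (fD F).
Local Notation H := (fH F).
Local Notation v := (bV F).
Local Notation d := (bD F).
Local Notation T := (c2 (pP F)).
Local Notation T' := (c1 (pQ F)).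
Variable a : 'I_k -> gT -> R.
Hypothesis aE : forall g i, aL g (v i) = a i g *: v i.

Lemma v_neq0 i : v i != 0.
Proof.
apply/eqP => v0; have /eqP := pair_basis FL i i.
by rewrite v0 (pair0l FL) eqxx eq_sym oner_eq0.
Qed.

Lemma aM1 i g h : a i (g * h)%g = a i g * a i h.
Proof.
apply/eqP; rewrite -subr_eq0; have /eqP := aLM FL g h (v i).
rewrite !aE (linZ _ _ (aL_lin FL g)) aE scalerA mulrC eq_sym -subr_eq0 -scalerBl.
by rewrite scaler_eq0 (negPf (v_neq0 i)) orbF.
Qed.

Lemma a1 i : a i 1%g = 1.
Proof.
apply/eqP; rewrite -subr_eq0; have /eqP := aL1 FL (v i).
rewrite aE -[X in _ == X]scale1r -subr_eq0 -scalerBl.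
by rewrite scaler_eq0 (negPf (v_neq0 i)) orbF.
Qed.

Lemma aV i g : a i g * a i g^-1%g = 1.
Proof. by rewrite -aM1 mulgV a1. Qed.

Lemma a_neq0 i g : a i g != 0.
Proof. by apply/eqP => a0; have /eqP := aV i g; rewrite a0 mul0r eq_sym oner_eq0. Qed.

Lemma pairE (z : 'I_k -> R) j : pair (\sum_i z i *: v i) (d j) = z j.
Proof.
rewrite (pair_suml FL) (bigD1 j) //= (pair_basis FL) eqxx mulr1 big1 ?addr0 // => i ij.
by rewrite (pair_basis FL) (negPf ij) mulr0.
Qed.

(** The matrix units for the basis [v]: [X i j] sends [v i] to [v j]. *)
Let X i j (f : V) : V := pair f (d i) *: v j.

Lemma X_lin i j : linear (X i j).
Proof. by move=> b f f'; rewrite /X (pair_linl FL) scalerDl scalerA. Qed.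

Lemma aL_coord g f i : pair (aL g f) (d i) = a i g * pair f (d i).
Proof.
rewrite {1}(bVE FL f) (lin_sum _ _ (aL_lin FL g)).
under eq_bigr do rewrite aE scalerA.
by rewrite (pairE (fun i => pair f (d i) * a i g)) mulrC.
Qed.

Lemma X_span i j : a i =1 a j -> exists y : gT -> R, forall f, X i j f = \sum_h y h *: aR h f.
Proof.
move=> aij; apply: (centralizer_span FL k_gt0 cardG (X_lin i j)) => g f.
by rewrite /X aL_coord (linZ _ _ (aL_lin FL g)) aE scalerA aij mulrC.
Qed.

(** The projection [X i i] commutes with the left action, hence is a combination of right
    translations; anything commuting with these preserves the line of [v i]. *)
Lemma X_id i (f : V -> V) : linear f -> (forall h g, f (aR h g) = aR h (f g)) ->
  f (v i) = pair (f (v i)) (d i) *: v i.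
Proof.
move=> fl fR; have [y yE] := X_span (i := i) (fun=> erefl).
rewrite -/(X i i (f (v i))) yE; have Xv : X i i (v i) = v i.
  by rewrite /X (pair_basis FL) eqxx scale1r.
rewrite -{1}Xv yE (lin_sum _ _ fl); apply: eq_bigr => h _.
by rewrite fR.
Qed.

Let b i g := pair (aM g (v i)) (d i).
Let c i g := pair (aR g (v i)) (d i).

Lemma bE g i : aM g (v i) = b i g *: v i.
Proof. by apply: (X_id i (aM_lin FL g)) => h f; rewrite (aMR_comm FL). Qed.
Lemma cE g i : aR g (v i) = c i g *: v i.
Proof. by apply: (X_id i (aR_lin FL g)) => h f; rewrite (aR_comm FL k_gt0 cardG). Qed.

(** With equal weights [X i j] would be a combination of right translations, which are diagonal. *)
Lemma a_inj i j : a i =1 a j -> i = j.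
Proof.
move=> /X_span[y yE]; apply/eqP/negPn/negP => ij; have := yE (v i).
rewrite /X (pair_basis FL) eqxx scale1r; under eq_bigr do rewrite cE scalerA.
rewrite -scaler_suml => /(congr1 (fun f => pair f (d j))).
rewrite (pairZl FL) !(pair_basis FL) eqxx (negPf ij) mulr0 => /eqP.
by rewrite oner_eq0.
Qed.

Lemma a_nontriv i : exists g, a i g != 1.
Proof.
apply/existsP; rewrite -negb_forall; apply/negP => /forallP at1.
move/negP: (v_neq0 i); apply; apply/eqP/(aL_invariant0 FL k_gt0 cardG) => g.
by rewrite aE (eqP (at1 g)) scale1r.
Qed.

Lemma aM_coord g f i : pair (aM g f) (d i) = b i g * pair f (d i).
Proof.
rewrite {1}(bVE FL f) (lin_sum _ _ (aM_lin FL g)).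
under eq_bigr do rewrite bE scalerA.
by rewrite (pairE (fun i => pair f (d i) * b i g)) mulrC.
Qed.
Lemma aR_coord g f i : pair (aR g f) (d i) = c i g * pair f (d i).
Proof.
rewrite {1}(bVE FL f) (lin_sum _ _ (aR_lin FL g)).
under eq_bigr do rewrite cE scalerA.
by rewrite (pairE (fun i => pair f (d i) * c i g)) mulrC.
Qed.

Lemma dLE g j : a j g *: dL g (d j) = d j.
Proof.
rewrite [dL g _](bDE FL) [RHS](bDE FL) scaler_sumr; apply: eq_bigr => i _; rewrite scalerA.
congr (_ *: _); have := pair_L FL g (v i) (d j); rewrite aE (pairZl FL) (pair_basis FL).
by case: eqP => [<-//|_] /eqP; rewrite mulf_eq0 (negPf (a_neq0 i g)) => /eqP ->; rewrite mulr0.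
Qed.

Lemma c_neq0 i g : c i g != 0.
Proof.
apply/eqP => c0; have := pair_R FL g (v i) (d i).
by rewrite cE c0 scale0r (pair0l FL) (pair_basis FL) eqxx => /eqP; rewrite eq_sym oner_eq0.
Qed.

Lemma dRE g j : c j g *: dR g (d j) = d j.
Proof.
rewrite [dR g _](bDE FL) [RHS](bDE FL) scaler_sumr; apply: eq_bigr => i _; rewrite scalerA.
congr (_ *: _); have := pair_R FL g (v i) (d j); rewrite cE (pairZl FL) (pair_basis FL).
by case: eqP => [<-//|_] /eqP; rewrite mulf_eq0 (negPf (c_neq0 i g)) => /eqP ->; rewrite mulr0.
Qed.

Lemma dME g j : dM g (d j) = b j g *: d j.
Proof.
apply: (pair_extr FL) => f; rewrite (pairZr FL) -(pair_M FL).
exact: aM_coord.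
Qed.

Lemma coord_neq0 (f : V) : f != 0 -> exists i, pair f (d i) != 0.
Proof.
move=> f0; apply/existsP; rewrite -[[exists _, _]]negbK negb_exists; apply/negP => /forallP E.
move/negP: f0; apply; apply/eqP/(pair_extl FL) => i; rewrite (pair0l FL).
by apply/eqP/negPn/E.
Qed.

Lemma d_neq0 j : d j != 0.
Proof.
apply/eqP => d0; have /eqP := pair_basis FL j j.
by rewrite d0 (pair0r FL) eqxx eq_sym oner_eq0.
Qed.

(** Rotation is injective and intertwines the actions, so any nonzero coordinate [i] of [T (d j)]
    compares the weights. *)
Lemma weights_T j : exists i, forall g, b i g = a j g /\ c i g * c j g = 1.
Proof.
have Tj : T (d j) != 0 by apply: contra (d_neq0 j) => /eqP/(c2_P_inj FL)->.
have [i ti] := coord_neq0 Tj; exists i => g; split; apply: (mulIf ti).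
  have := aM_T FL g (d j); rewrite -{2}(dLE g j) (linZ _ _ (c2_linr FL _)).
  move=> /(congr1 (fun f => pair f (d i))); rewrite aM_coord (pairZl FL) => E.
  rewrite -(dLE g j) (linZ _ _ (c2_linr FL _)) (pairZl FL) mulrCA E.
  by [].
rewrite mul1r mulrAC -aR_coord -(c2_P_R FL) mulrC -(pairZl FL) -(linZ _ _ (c2_linr FL _)).
by rewrite dRE.
Qed.

Lemma weights_T' j : exists i, forall g, a i g * a j g = 1 /\ b i g * c j g = 1.
Proof.
have Tj : T' (d j) != 0 by apply: contra (d_neq0 j) => /eqP/(c1_Q_inj FL)->.
have [i ti] := coord_neq0 Tj; exists i => g; split; apply: (mulIf ti).
  rewrite mul1r mulrAC -aL_coord -(c1_Q_L FL) mulrC -(pairZl FL) -(linZ _ _ (c1_linr FL _)).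
  by rewrite dLE.
rewrite mul1r mulrAC -aM_coord -(c1_Q_M FL) mulrC -(pairZl FL) -(linZ _ _ (c1_linr FL _)).
by rewrite dRE.
Qed.

(* An eigenvector of the left action on [H] with nontrivial weight has a nonzero component
   along the second tree, since the left action is trivial on the [qQ h]. *)
Lemma weight_component (P : H) (psi : gT -> R) : P != 0 -> (forall g, hL g P = psi g *: P) ->
  (exists g, psi g != 1) -> exists l i, pair (c2 P (d l)) (d i) != 0 /\ a i =1 psi.
Proof.
move=> P0 PL [g0 psi1]; have [y E] := tree2_span FL P.
have [l cl] : exists l, c2 P (d l) != 0.
  apply/existsP; rewrite -[[exists _, _]]negbK negb_exists; apply/negP => /forallP c0.
  have PE : P = \sum_g y g *: qQ F g.
    rewrite {1}E [X in _ + X]big1 ?addr0 // => i _.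
    by have /eqP -> := negPn (c0 i); rewrite (lin0 (t2_linl FL _)).
  have : hL g0 P = P.
    rewrite {1}PE (lin_sum _ _ (hL_lin FL g0)); under eq_bigr do rewrite (hL_qQ FL).
    by rewrite -PE.
  rewrite PL => /eqP; rewrite -[X in _ == X]scale1r -subr_eq0 -scalerBl scaler_eq0 (negPf P0).
  by rewrite orbF subr_eq0 (negPf psi1).
have [i ci] := coord_neq0 cl; exists l, i; split=> // g; apply: (mulIf ci).
by rewrite -aL_coord -(c2_hL FL) PL (linZ _ _ (c2_linl FL _)) (pairZl FL).
Qed.

(** The translates of [pP] span a regular representation, where every character has an
    eigenvector. *)
Lemma weights_exhaust (psi : gT -> R) : (forall g h, psi (g * h)%g = psi g * psi h) ->
  (forall g, psi g != 0) -> (exists g, psi g != 1) -> exists i, a i =1 psi.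
Proof.
move=> psiM psi0 psi1; pose P : H := \sum_g (psi g)^-1 *: hL g (pP F).
have Pn0 : P != 0.
  apply/eqP => /(hLP_free FL)/(_ 1%g)/eqP; rewrite invr_eq0.
  by apply/negP/psi0.
have PL g : hL g P = psi g *: P.
  rewrite /P (lin_sum _ _ (hL_lin FL g)) scaler_sumr [RHS](reindex_inj (mulgI g)) /=.
  apply: eq_bigr => h _; rewrite (hLM FL) scalerA psiM invfM mulrA divff // mul1r.
  by [].
by have [l [i [_ ai]]] := weight_component Pn0 PL psi1; exists i.
Qed.

(** [t1 (v i) (v j)] is a left eigenvector in [H] of weight [a i * a j]; a nonzero coordinate ([l],
    [i']) of it along the second tree turns the sliding laws into equalities of weights. *)
Lemma weights_E i j : (exists g, a i g * a j g != 1) -> exists i' l, forall g,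
  [/\ a i' g = a i g * a j g, b l g = b i g * c j g & b i' g = b j g * a l g].
Proof.
move=> aij; pose P : H := t1 (v i) (v j).
have Pn0 : P != 0.
  apply: contra (v_neq0 i) => /eqP P0; have := c1_t1 FL (v i) (v j) (d j).
  rewrite -/P P0 (lin0 (c1_linl FL _)) (pair_basis FL) eqxx scale1r => <-.
  by [].
have PL g : hL g P = (a i g * a j g) *: P.
  by rewrite (hL_t1 FL) !aE (linZ _ _ (t1_linl FL _)) (linZ _ _ (t1_linr FL _)) scalerA.
have [l [i' [ci' ai']]] := weight_component Pn0 PL aij.
exists i', l => g; split; first exact: ai'.
  have := c2_t1_MR FL g (v i) (v j) (d l); rewrite bE cE dME.
  rewrite (linZ _ _ (t1_linl FL _)) (linZ _ _ (t1_linr FL _)) scalerA (linZ _ _ (c2_linl FL _)).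
  rewrite (linZ _ _ (c2_linr FL _)) => /(congr1 (fun f => pair f (d i'))).
  by rewrite !(pairZl FL) => /(mulIf ci').
have := c2_t1_M FL g (v i) (v j) (d l).
move=> /(congr1 (fun f => pair f (d i'))); rewrite bE aM_coord (linZ _ _ (t1_linr FL _)).
rewrite (linZ _ _ (c2_linl FL _)) (pairZl FL) => /(congr1 (fun x => a l g * x)).
rewrite [in RHS]mulrCA -[in RHS](pairZl FL) -(linZ _ _ (c2_linr FL _)) dLE mulrA.
by move=> /(mulIf ci') <-; rewrite mulrC.
Qed.

End Weights.

Theorem fusion_weights (R : closedFieldType) (gT : finGroupType) (k : nat) (F : fusion_data R gT k) :
  fusion_laws F -> (0 < k)%N -> #|gT| = k.+1 -> #|gT|%:R != 0 :> R ->
  abelian [set: gT] /\ exists a b c : 'I_k -> gT -> R,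
  [/\ (forall i j, a i =1 a j -> i = j) /\ (forall i, exists g, a i g != 1),
      (forall psi : gT -> R, (forall g h, psi (g * h)%g = psi g * psi h) ->
        (forall g, psi g != 0) -> (exists g, psi g != 1) -> exists i, a i =1 psi),
      (forall j, exists i, forall g, b i g = a j g /\ c i g * c j g = 1),
      (forall j, exists i, forall g, a i g * a j g = 1 /\ b i g * c j g = 1) &
      (forall i j, (exists g, a i g * a j g != 1) -> exists i' l, forall g,
        [/\ a i' g = a i g * a j g, b l g = b i g * c j g & b i' g = b j g * a l g])].
Proof.
move=> FL k0 cardG n0; split.
  by apply/centsP => x _ y _; apply: (gT_abelian FL k0 cardG).
have [F' [FL' [a aE]]] := eigenbasis cardG n0 FL k0.
exists a, (fun i g => pair (aM g (bV F' i)) (bD F' i)), (fun i g => pair (aR g (bV F' i)) (bD F' i)).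
split.
- split; first exact: (a_inj FL' k0 cardG aE).
  exact: (a_nontriv FL' k0 cardG aE).
- exact: (weights_exhaust FL' aE).
- exact: (weights_T FL' k0 cardG aE).
- exact: (weights_T' FL' k0 cardG aE).
- exact: (weights_E FL' k0 cardG aE).
Qed.

(** * From weights to the permutation *)

Section FromWeights.
Variables (R : fieldType) (gT : finGroupType) (k : nat).
Hypothesis k_gt0 : (0 < k)%N.
Hypothesis cardG : #|gT| = k.+1.
Hypothesis abelG : abelian [set: gT].
(** The element [x] stands for the character [g |-> B g x]. *)
Variable B : gT -> gT -> R.
Hypothesis Bl : forall x y h, B (x * y)%g h = B x h * B y h.
Hypothesis Br : forall x g h, B x (g * h)%g = B x g * B x h.
Hypothesis B_neq0 : forall x h, B x h != 0.
Hypothesis B_nondeg : forall h, (forall x, B x h = 1) -> h = 1%g.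
Variables a b c : 'I_k -> gT -> R.
Hypothesis a_inj : forall i j, a i =1 a j -> i = j.
Hypothesis a_nontriv : forall i, exists g, a i g != 1.
Hypothesis exhaust : forall psi : gT -> R, (forall g h, psi (g * h)%g = psi g * psi h) ->
  (forall g, psi g != 0) -> (exists g, psi g != 1) -> exists i, a i =1 psi.
Hypothesis wT : forall j, exists i, forall g, b i g = a j g /\ c i g * c j g = 1.
Hypothesis wT' : forall j, exists i, forall g, a i g * a j g = 1 /\ b i g * c j g = 1.
Hypothesis wE : forall i j, (exists g, a i g * a j g != 1) -> exists i' l, forall g,
  [/\ a i' g = a i g * a j g, b l g = b i g * c j g & b i' g = b j g * a l g].

Lemma mulC (x y : gT) : (x * y = y * x)%g.
Proof. by apply: (centsP abelG); rewrite inE. Qed.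

Lemma B1 x : B x 1%g = 1.
Proof. by apply: (mulfI (B_neq0 x 1%g)); rewrite -Br mulg1 mulr1. Qed.

Lemma BV x h : B x h^-1%g = (B x h)^-1.
Proof. by apply: (mulfI (B_neq0 x h)); rewrite -Br mulgV B1 divff. Qed.

Lemma B_inj h h' : (forall x, B x h = B x h') -> h = h'.
Proof.
move=> E; apply/eqP; rewrite eq_mulgV1; apply/eqP/B_nondeg => x.
by rewrite Br BV E divff.
Qed.

Lemma index_ex x : exists i, x != 1%g -> forall g, a i g = B g x.
Proof.
(* The index at the identity is a placeholder. *)
case: (eqVneq x 1%g) => [_|x1]; first by exists (Ordinal k_gt0).
have [i ai] : exists i, a i =1 B^~ x.
  apply: exhaust => [g h|g|]; [exact: Bl | exact: B_neq0 |].
  apply/existsP; rewrite -negb_forall; apply: contra x1 => /forallP E.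
  by apply/eqP/B_nondeg => g; apply/eqP.
by exists i => _.
Qed.

Lemma permutation_ex : exists pi : {perm gT},
    [/\ pi 1%g = 1%g,
        (pi ^+ 3)%g = 1%g,
        (forall x : gT, x != 1%g -> ((pi x)^-1)%g = (pi^-1)%g (x^-1)%g) &
        (forall s t : gT, s != 1%g -> t != 1%g -> s != (t^-1)%g ->
           pi (s * t)%g = (pi t * pi ((pi s)^-1 * pi (t^-1)))%g)].
Proof.
have [j jE] := fin_all_exists index_ex.
have j_inj x y : x != 1%g -> y != 1%g -> j x = j y -> x = y.
  by move=> x1 y1 jxy; apply: B_inj => g; rewrite -(jE _ x1) -(jE _ y1) jxy.
(* Injectivity on the [k] nonidentity elements suffices, as there are [k] indices. *)
have j_surj i : exists2 x, x != 1%g & j x = i.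
  have : i \in j @: [set~ 1%g].
    have -> : j @: [set~ 1%g] = setT; last by rewrite inE.
    apply/eqP; rewrite eqEcard subsetT cardsT card_ord card_in_imset.
      by rewrite cardsC1 cardG leqnn.
    by move=> x y; rewrite !inE; apply: j_inj.
  by case/imsetP => x; rewrite !inE => x1 ->; exists x.
have T1 y : exists x, y != 1%g ->
    [/\ x != 1%g, forall g, b (j x) g = B g y & forall g, c (j x) g * c (j y) g = 1].
  case: (eqVneq y 1%g) => [_|y1]; first by exists 1%g.
  have [i iE] := wT (j y); have [x x1 jx] := j_surj i; exists x => _; rewrite jx.
  by split=> // g; have [E1 E2] := iE g; rewrite ?E1 ?jE.
have [tau tauE] := fin_all_exists T1.
have T2 y : y != 1%g -> forall g, b (j y^-1%g) g * c (j y) g = 1.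
  move=> y1 g; have [i iE] := wT' (j y); have [x x1 jx] := j_surj i.
  suff <- : x = y^-1%g by rewrite jx; case: (iE g).
  apply: B_inj => h; rewrite BV -(jE _ y1) -(jE _ x1) jx; have [E _] := iE h.
  have n0 : a (j y) h != 0 by rewrite jE.
  by apply: (mulIf n0); rewrite E mulVf.
have E3 x y : x != 1%g -> y != 1%g -> (x * y)%g != 1%g -> exists2 l, l != 1%g &
   forall g, b (j l) g = b (j x) g * c (j y) g /\ b (j (x * y)%g) g = b (j y) g * B g l.
  move=> x1 y1 xy1; have [|i' [l lE]] := wE (i := j x) (j := j y).
    apply/existsP; rewrite -negb_forall; apply: contra xy1 => /forallP E; apply/eqP/B_nondeg => g.
    by rewrite Br -!jE //; apply/eqP.
  have [l0 l1 jl] := j_surj l; have [z z1 jz] := j_surj i'; exists l0 => // g.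
  suff <- : z = (x * y)%g by rewrite jz -jE // jl; case: (lE g).
  by apply: B_inj => h; rewrite Br -!jE // jz; case: (lE h).
pose mu y := if y == 1%g then 1%g else tau y.
have mu1 : mu 1%g = 1%g by rewrite /mu eqxx.
have muE y : y != 1%g -> mu y = tau y by rewrite /mu => /negPf->.
have mu_neq1 y : y != 1%g -> mu y != 1%g by move=> y1; rewrite muE //; case: (tauE y y1).
have bmu y g : y != 1%g -> b (j (mu y)) g = B g y.
  by move=> y1; rewrite muE //; case: (tauE y y1).
have cmu y g : y != 1%g -> c (j (mu y)) g * c (j y) g = 1.
  by move=> y1; rewrite muE //; case: (tauE y y1).
have mu_inj : injective mu.
  move=> x y; case: (eqVneq x 1%g) => [->|x1]; case: (eqVneq y 1%g) => [->|y1] //.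
  - by rewrite mu1 => E; have := mu_neq1 y y1; rewrite -E eqxx.
  - by rewrite mu1 => E; have := mu_neq1 x x1; rewrite E eqxx.
  by move=> E; apply: B_inj => g; rewrite -bmu // -[RHS]bmu // E.
have mu_surj y : exists x, mu x = y.
  by have [nu _ nuK] := injF_bij mu_inj; exists (nu y); apply: nuK.
have b_inj x y : x != 1%g -> y != 1%g -> (forall g, b (j x) g = b (j y) g) -> x = y.
  have [x' <-] := mu_surj x; have [y' <-] := mu_surj y => x1 y1 E.
  have x'1 : x' != 1%g by apply: contra x1 => /eqP->; rewrite mu1.
  have y'1 : y' != 1%g by apply: contra y1 => /eqP->; rewrite mu1.
  by congr mu; apply: B_inj => g; rewrite -bmu // E bmu.
have b_neq0 y g : y != 1%g -> b (j y) g != 0.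
  have [x <-] := mu_surj y => y1; rewrite bmu //.
  by apply: contra y1 => /eqP->; rewrite mu1.
have cE y g : y != 1%g -> c (j y) g = (b (j y^-1%g) g)^-1.
  move=> y1; have n0 : b (j y^-1%g) g != 0 by rewrite b_neq0 // invg_eq1.
  by apply: (mulfI n0); rewrite T2 // divff.
have c_inj x y : x != 1%g -> y != 1%g -> (forall g, c (j x) g = c (j y) g) -> x = y.
  move=> x1 y1 E; apply: invg_inj; apply: b_inj; rewrite ?invg_eq1 // => g.
  by apply: invr_inj; rewrite -!cE.
(* The relation [c (mu y) * c y = 1] is symmetric: applied twice it gives [mu (mu y)] and [y] the
   same weight [c], which determines the element. *)
have mu_mu y : mu (mu y) = y.
  case: (eqVneq y 1%g) => [->|y1]; first by rewrite !mu1.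
  apply: c_inj; rewrite ?mu_neq1 // => g.
  have n0 : c (j (mu y)) g != 0.
    by apply/eqP => c0; have /eqP := cmu y g y1; rewrite c0 mul0r eq_sym oner_eq0.
  by apply: (mulIf n0); rewrite cmu ?mu_neq1 // mulrC cmu.
have bE y g : y != 1%g -> b (j y) g = B g (mu y).
  by move=> y1; rewrite -bmu ?mu_neq1 // mu_mu.
have muV y : mu (mu y)^-1%g = (mu y^-1)^-1%g.
  case: (eqVneq y 1%g) => [->|y1]; first by rewrite !(mu1, invg1).
  apply: B_inj => g; rewrite BV -!bE ?invg_eq1 ?mu_neq1 //.
  have := cmu y g y1; rewrite !cE ?mu_neq1 // => E.
  have n0 : b (j (mu y)^-1%g) g != 0 by rewrite b_neq0 // invg_eq1 mu_neq1.
  by apply: (mulfI (invr_neq0 n0)); rewrite E mulVf.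
(* The auxiliary [l] is pinned down by its weight: [mu l] represents the character
   [b (j x) * c (j y)], that is [mu x * (mu y^-1)^-1]. *)
have muM x y : x != 1%g -> y != 1%g -> (x * y)%g != 1%g ->
    mu (x * y)%g = (mu y * mu (mu x * (mu y^-1)^-1))%g.
  move=> x1 y1 xy1; have [l l1 lE] := E3 x y x1 y1 xy1.
  have mul : mu l = (mu x * (mu y^-1)^-1)%g.
    apply: B_inj => g; have [E _] := lE g.
    by rewrite -bE // E cE // Br BV -!bE // invg_eq1.
  rewrite -mul mu_mu; apply: B_inj => g; have [_ E] := lE g.
  by rewrite Br -bE // E bE.
have pi_inj : injective (fun x => (mu x)^-1%g) by move=> x y /invg_inj/mu_inj.
exists (perm pi_inj); have piE x : perm pi_inj x = (mu x)^-1%g by rewrite permE.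
split=> [||x x1|s t s1 t1 st].
- by rewrite piE mu1 invg1.
(* By [muV], the square of [pi] is [x |-> mu (x^-1)]; one more [pi] returns to [x] since [mu] is an
   involution. *)
- apply/permP => x; rewrite perm1 expgSr expgSr expg1 !permM !piE.
  by rewrite muV !invgK mu_mu ?invgK.
- by rewrite piE invgK; apply: (@perm_inj _ (perm pi_inj)); rewrite permKV piE mu_mu.
rewrite !piE muM //; last by move: st; rewrite eq_mulgV1 invgK.
by rewrite invgK invMg mulC.
Qed.
End FromWeights.

(** * Nondegenerate bicharacters *)

Section Bicharacter.
Variables (R : closedFieldType) (gT : finGroupType).

(** Stated relative to a subset [G], because the construction runs by induction over the direct
    factors of a group. *)
Definition bicharacter (G : {set gT}) (B : gT -> gT -> R) :=
  [/\ {in G & &, forall x y h, B (x * y)%g h = B x h * B y h},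
      {in G & &, forall x g h, B x (g * h)%g = B x g * B x h},
      {in G &, forall x h, B x h != 0} &
      {in G, forall h, {in G, forall x, B x h = 1} -> h = 1%g}].

Lemma prim_root_closed n : n%:R != 0 :> R -> exists z : R, n.-primitive_root z.
Proof.
move=> n0; have n_gt0 : (0 < n)%N by case: n n0 => //; rewrite eqxx.
have [r rE] := closed_field_poly_normal ('X^n - 1 : {poly R}).
have monX : 'X^n - 1 \is @monic R by rewrite -polyC1 monicXnsubC.
rewrite (monicP monX) scale1r in rE.
have /hasP[z _ zP] : has n.-primitive_root r; last by exists z.
apply: has_prim_root => //.
- by apply/allP => z zr; rewrite /root_of_unity rE root_prod_XsubC.
- by rewrite -separable_prod_XsubC -rE separable_Xn_sub_1.
- by rewrite -ltnS -(size_prod_XsubC r id) -rE -polyC1 size_XnsubC.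
Qed.

(** The form sends the pair of [x^i] and [x^j] to [z^(i j)]; [e] chooses exponents. *)
Lemma bicharacter_cycle x (z : R) : (#[x]%g).-primitive_root z -> exists B, bicharacter <[x]>%g B.
Proof.
move=> zP.
have [e eE] : exists e : gT -> nat, {in <[x]>%g, forall g, (x ^+ e g)%g = g}.
  have P g : exists i : 'I_#[x]%g, g \in <[x]>%g -> (x ^+ i)%g = g.
    case gx : (g \in <[x]>%g); last by exists (Ordinal (order_gt0 x)).
    by have [i ix ->] := cyclePmin gx; exists (Ordinal ix).
  by have [e eP] := fin_all_exists P; exists (fun g => e g) => g /eP.
have eM g h : g \in <[x]>%g -> h \in <[x]>%g -> e (g * h)%g = e g + e h %[mod #[x]%g].
  move=> gx hx; apply/eqP; rewrite -eq_expg_mod_order expgD !eE //.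
  by rewrite groupM.
have zM i j l : i = j %[mod #[x]%g] -> z ^+ (i * l) = z ^+ (j * l).
  by move=> ij; apply/eqP; rewrite (eq_prim_root_expr zP) -modnMml ij modnMml.
exists (fun g h => z ^+ (e g * e h)); split.
- by move=> g h l gx hx lx /=; rewrite -exprD -mulnDl; apply/zM/eM.
- move=> g h l gx hx lx /=; rewrite -exprD -mulnDr mulnC [in RHS]mulnC.
  exact/zM/eM.
- move=> g h gx hx /=; apply/eqP => /(congr1 (fun u => u ^+ #[x]%g)) /eqP.
  by rewrite -exprM mulnC exprM (prim_expr_order zP) expr1n expr0n gtn_eqF // oner_eq0.
move=> h hx /(_ x (cycle_id x)) /eqP; rewrite -(prim_order_dvd zP) => dvd.
rewrite -(eE h hx); apply/eqP; rewrite -order_dvdn.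
(* The test element is the generator [x], whose chosen exponent [e x] is congruent to 1 modulo the
   order. *)
suff co : coprime #[x]%g (e x) by rewrite -(Gauss_dvdr (e h) co).
have : (1%N == e x %[mod #[x]%g]) by rewrite -eq_expg_mod_order expg1 eE // cycle_id.
by move/eqP => E; rewrite -coprime_modr -E coprime_modr coprimen1.
Qed.

(** Orthogonal sum of the two forms along the projections to [H] and [K]. *)
Lemma bicharacter_dprod (H K G : {group gT}) B1 B2 : (H \x K)%g = G ->
  bicharacter H B1 -> bicharacter K B2 -> exists B, bicharacter G B.
Proof.
move=> HK [B1l B1r B10 B1d] [B2l B2r B20 B2d].
(* Each projection is the product of an identity and a trivial morphism, whose images have to
   commute. *)
have cHK1 : (trivm K @* K \subset 'C(morphism.idm H @* H))%g by rewrite morphim_trivm sub1G.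
have cHK2 : (morphism.idm K @* K \subset 'C(trivm H @* H))%g by rewrite morphim_trivm cents1.
have [p1 p1M p1E] : exists2 p1 : gT -> gT, {in G &, {morph p1 : x y / (x * y)%g}} &
    forall x y, x \in H -> y \in K -> p1 (x * y)%g = x.
  exists (dprodm_morphism HK cHK1); first exact: morphM.
  by move=> x y xH yK; rewrite [LHS](dprodmE HK cHK1 xH yK) mulg1.
have [p2 p2M p2E] : exists2 p2 : gT -> gT, {in G &, {morph p2 : x y / (x * y)%g}} &
    forall x y, x \in H -> y \in K -> p2 (x * y)%g = y.
  exists (dprodm_morphism HK cHK2); first exact: morphM.
  by move=> x y xH yK; rewrite [LHS](dprodmE HK cHK2 xH yK) mul1g.
have p1H : {in G, forall g, p1 g \in H}.
  by move=> g /(mem_dprod HK)[x [y [xH yK -> _]]]; rewrite p1E.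
have p2K : {in G, forall g, p2 g \in K}.
  by move=> g /(mem_dprod HK)[x [y [xH yK -> _]]]; rewrite p2E.
have p12 : {in G, forall g, (p1 g * p2 g)%g = g}.
  by move=> g /(mem_dprod HK)[x [y [xH yK -> _]]]; rewrite p1E ?p2E.
have [_ HKG _ _] := dprodP HK.
have HG g : g \in H -> g \in G by rewrite -HKG => /(subsetP (mulG_subl K H)).
have KG g : g \in K -> g \in G by rewrite -HKG => /(subsetP (mulG_subr H K)).
have one_l1 : {in H, forall h, B1 1%g h = 1}.
  by move=> h hH; apply: (mulfI (B10 _ _ (group1 H) hH)); rewrite -B1l ?group1 // mulg1 mulr1.
have one_l2 : {in K, forall h, B2 1%g h = 1}.
  by move=> h hH; apply: (mulfI (B20 _ _ (group1 K) hH)); rewrite -B2l ?group1 // mulg1 mulr1.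
exists (fun g h => B1 (p1 g) (p1 h) * B2 (p2 g) (p2 h)); split.
- move=> g h l gG hG lG; cbv beta; rewrite p1M ?p2M // B1l ?B2l ?p1H ?p2K //.
  by rewrite mulrACA.
- move=> g h l gG hG lG; cbv beta; rewrite p1M ?p2M // B1r ?B2r ?p1H ?p2K //.
  by rewrite mulrACA.
- by move=> g h gG hG; cbv beta; rewrite mulf_neq0 ?B10 ?B20 ?p1H ?p2K.
move=> h hG hB; rewrite -(p12 h hG).
have -> : p1 h = 1%g.
  apply: (B1d _ (p1H h hG)) => x xH; have := hB x (HG x xH).
  by rewrite -{1 2}[x]mulg1 p1E ?p2E ?group1 // one_l2 ?mulr1 // p2K.
have -> : p2 h = 1%g.
  apply: (B2d _ (p2K h hG)) => x xK; have := hB x (KG x xK).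
  by rewrite -{1 2}[x]mul1g p1E ?p2E ?group1 // one_l1 ?mul1r // p1H.
by rewrite mulg1.
Qed.

(** Induction over a cyclic decomposition; the order of each factor divides [|G|] and so remains
    nonzero in [R]. *)
Lemma bicharacter_abelian (G : {group gT}) : abelian G -> #|G|%:R != 0 :> R ->
  exists B, bicharacter G B.
Proof.
move=> /abelian_structure[b bG _]; elim: b G bG => [|x b IH] G.
  rewrite big_nil => G1 _; exists (fun _ _ => 1).
  split=> [? *|? *|? *|h hG _]; rewrite ?mulr1 ?oner_eq0 //.
  by move: hG; rewrite -G1 => /set1gP.
rewrite big_cons => xbG; have [[_ K _ KE] _ _ _] := dprodP xbG.
rewrite KE in xbG; rewrite -(dprod_card xbG) natrM mulf_eq0 negb_or => /andP[ox oK].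
have [B2 B2P] := IH K KE oK.
have [z zP] := prim_root_closed ox; have [B1 B1P] := bicharacter_cycle zP.
exact: (bicharacter_dprod xbG B1P B2P).
Qed.
End Bicharacter.

Unset Implicit Arguments.
Local Close Scope ring_scope.

(** A permutation of the nonidentity elements is encoded as a permutation of [gT] fixing 1. *)
Theorem theorem4p2 (R : closedFieldType) (gT : finGroupType) (k : nat) :
  (forall p : nat, p \in [pchar R]%R -> ~~ (p %| #|gT|)%N) ->
  (1 <= k)%N -> #|gT| = k.+1 ->
  (exists C : MonCat R, near_group_category C gT k) ->
  exists pi : {perm gT},
    [/\ pi 1%g = 1%g,
        (pi ^+ 3)%g = 1%g,
        (forall x : gT, x != 1%g -> ((pi x)^-1)%g = (pi^-1)%g (x^-1)%g) &
        (forall s t : gT, s != 1%g -> t != 1%g -> s != (t^-1)%g ->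
           pi (s * t)%g = (pi t * pi ((pi s)^-1 * pi (t^-1)))%g)].
Proof.
move=> charR k0 cardG [C [rigC /(near_group_strict rigC) [s NG]]].
have n0 : (#|gT|%:R != 0 :> R)%R.
  rewrite natf_neq0_pchar cardG; apply/pnatP => // p _ pn; apply/negP => pR.
  by have := charR p pR; rewrite cardG pn.
have [F FL] := near_group_fusion NG k0 cardG.
have [abelG [a [b [c [[a_inj _] exhaust wT wT' wE]]]]] := fusion_weights FL k0 cardG n0.
have [|B [Bl Br B0 Bd]] := @bicharacter_abelian R gT [group of [set: gT]] abelG.
  by rewrite cardsT.
apply: (@permutation_ex R gT k k0 cardG abelG B _ _ _ _ a b c) => //.
- by move=> x y h; apply: Bl; rewrite inE.
- by move=> x g h; apply: Br; rewrite inE.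
- by move=> x h; apply: B0; rewrite inE.
- by move=> h hB; apply: Bd; rewrite ?inE // => x _; apply: hB.
Qed.
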